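(* Let $\lambda>0$ and $t>0$. For all $\nu\in(0,1]$ and $\alpha\in(0,1]$, $$E_{\nu\alpha,1}(-\lambda t^{\nu\alpha})=\frac{\sin\nu\pi}{\pi}\int_0^\infty\frac{r^{\nu-1}}{r^{2\nu}+2r^\nu\cos\nu\pi+1}\,E_{\alpha,1}\!\left(-r\lambda^{1/\nu}t^\alpha\right)dr.$$ A sort of commutativity is valid: for all $\nu\in(0,1]$ and $\alpha\in(0,1]$, $$E_{\alpha\nu,1}(-\lambda t^{\alpha\nu})=\frac{\sin\alpha\pi}{\pi}\int_0^\infty\frac{r^{\alpha-1}}{r^{2\alpha}+2r^\alpha\cos\alpha\pi+1}\,E_{\nu,1}\!\left(-r\lambda^{1/\alpha}t^\nu\right)dr.$$ Moreover, the following integral relation holds: $$\frac{\sin\nu\pi}{\nu}\int_0^\infty\frac{E_{\alpha,1}\!\left(-r^{1/\nu}\lambda^{1/\nu}t^\alpha\right)}{r^2+2r\cos\nu\pi+1}\,dr=\frac{\sin\nu\alpha\pi}{\nu\alpha}\int_0^\infty\frac{e^{-r^{1/(\nu\alpha)}\lambda^{1/(\nu\alpha)}t}}{r^2+2r\cos\nu\alpha\pi+1}\,dr.$$ For $\alpha=1$ the first formula is the integral representation of the Mittag--Leffler function $E_{\nu,1}(-\lambda t^\nu)$; for $\nu=1$, where the kernel becomes a delta function with pole at $r=1$, it is an identity. Repeated application of the first formula gives, for three indices $\nu,\alpha,\beta$, $$E_{\nu\alpha\beta,1}(-\lambda t^{\nu\alpha\beta})=\frac{\sin\nu\pi}{\pi}\int_0^\infty\frac{r^{\nu-1}}{r^{2\nu}+2r^\nu\cos\nu\pi+1}E_{\alpha\beta,1}\!\left(-r\lambda^{1/\nu}t^{\alpha\beta}\right)dr$$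 $$=\frac{\sin\nu\pi\,\sin\alpha\pi}{\pi^2}\int_0^\infty\!\!\int_0^\infty\frac{r^{\nu-1}w^{\alpha-1}\,E_{\beta,1}\!\left(-w\,r^{1/\alpha}\lambda^{1/(\nu\alpha)}t^\beta\right)}{(r^{2\nu}+2r^\nu\cos\nu\pi+1)(w^{2\alpha}+2w^\alpha\cos\alpha\pi+1)}\,dw\,dr,$$ and, in general, for $n\ge2$, $\nu_1,\dots,\nu_n\in(0,1]$ and $\eta_k=\prod_{i=1}^k\nu_i$, $$E_{\eta_n,1}(-\lambda t^{\eta_n})=\int_0^\infty\!\!\cdots\!\int_0^\infty\prod_{j=1}^{n-1}\left(\frac{\sin\nu_j\pi}{\pi}\frac{r_j^{\nu_j-1}}{r_j^{2\nu_j}+2r_j^{\nu_j}\cos\nu_j\pi+1}\right)E_{\nu_n,1}\!\left(-r_1r_2^{\frac1{\nu_1}}r_3^{\frac1{\nu_1\nu_2}}\cdots r_{n-1}^{\frac1{\eta_{n-2}}}\lambda^{\frac1{\eta_{n-1}}}t^{\nu_n}\right)\prod_{j=1}^{n-1}dr_j$$ $$=\mathbb{E}\left[E_{\nu_n,1}\!\left(-W_1W_2^{\frac1{\nu_1}}W_3^{\frac1{\nu_1\nu_2}}\cdots W_{n-1}^{\frac1{\eta_{n-2}}}\lambda^{\frac1{\eta_{n-1}}}t^{\nu_n}\right)\right],$$ where $W_1,\dots,W_{n-1}$ are independent random variables, $W_j$ having density $\frac{\sin\nu_j\pi}{\pi}\frac{r^{\nu_j-1}}{r^{2\nu_j}+2r^{\nu_j}\cos\nu_j\pi+1}$,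 $r>0$.
   Context: $E_{\beta,1}(x)=\sum_{h=0}^\infty\frac{x^h}{\Gamma(\beta h+1)}$, $\beta>0$, is the Mittag--Leffler function. All indices $\nu,\alpha,\beta$ range over $(0,1]$. When the index of a kernel equals $1$, the normalised kernel $\frac{\sin\nu\pi}{\pi}\frac{r^{\nu-1}}{r^{2\nu}+2r^\nu\cos\nu\pi+1}$ is understood as the delta function at $r=1$. *)

(* Defs.v *)
From HB Require Import structures.
From mathcomp Require Import all_boot all_order all_algebra.
From mathcomp Require Import all_classical all_reals all_analysis.
Set Implicit Arguments.
Unset Strict Implicit.
Unset Printing Implicit Defensive.
Import Order.TTheory GRing.Theory Num.Theory.
Import numFieldNormedType.Exports.
Local Open Scope classical_set_scope.
Local Open Scope ring_scope.

Section MittagLeffler.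
Context {R : realType}.

Definition Gamma (x : R) : R :=
  \int[lebesgue_measure]_(s in `]0, +oo[) (s `^ (x - 1) * expR (- s)).

(* The Mittag-Leffler function with second parameter 1, E_{b,1}(x). *)
Definition ML (b x : R) : R :=
  limn (series (fun h : nat => x ^+ h / Gamma (b * h%:R + 1))).

Definition in01 (nu : R) : Prop := 0 < nu <= 1.

(* An integral against the normalised kernel of index nu is written
   \int[kref nu]_(r in `]0, +oo[) (kern nu r * f r)%:E.  For nu <> 1 this is a
   Lebesgue integral against the kernel.  The kernel of index 1 is the delta
   function at r = 1, which has no density with respect to Lebesgue measure:
   there the reference measure is the Dirac mass at 1, with factor 1.  Constant
   prefactors such as sin (nu pi) / pi are part of the kernel, inside the integral,
   because only the normalised kernel makes sense at index 1. *)
Definition kref (nu : R) : {measure set (measurableTypeR R) -> \bar R} :=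
  if nu == 1 as _ return {measure set (measurableTypeR R) -> \bar R}
  then \d_(1 : measurableTypeR R) else lebesgue_measure.

Definition kern (nu r : R) : R :=
  if nu == 1 then 1
  else sin (nu * pi) / pi *
       (r `^ (nu - 1) / (r `^ (2 * nu) + 2 * r `^ nu * cos (nu * pi) + 1)).

(* The kernel of the integral relation, sin (nu pi) / nu being included.  At
   nu = 1 the expression is pi times the normalised kernel of index 1, that is,
   pi times the delta function at 1. *)
Definition kern2 (nu r : R) : R :=
  if nu == 1 then pi
  else sin (nu * pi) / nu * (r ^+ 2 + 2 * r * cos (nu * pi) + 1)^-1.

(* Iterated integral in the variables r 1, ..., r m over ]0, +oo[, with r 1
   outermost; the values of r outside 1, ..., m are irrelevant. *)
Fixpoint iter_int (mu : nat -> {measure set (measurableTypeR R) -> \bar R}) (m : nat)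
    (F : (nat -> R) -> \bar R) : \bar R :=
  if m is k.+1 then
    iter_int mu k (fun r =>
      (\int[mu k.+1]_(x in `]0%R, +oo[) F [eta r with k.+1 |-> x])%E)
  else F (fun=> 0).

Section Probability.
Context {d : measure_display} {T : measurableType d} (P : probability T R).

Definition independent_RVs (I : choiceType) (D : set I)
    (X : I -> {RV P >-> R}) : Prop :=
  forall (J : seq I) (A : I -> set R), uniq J ->
    (forall i, i \in J -> D i /\ measurable (A i)) ->
    P (\bigcap_(i in [set` J]) (X i @^-1` A i)) =
    (\prod_(i <- J) P (X i @^-1` A i))%E.

(* The law of X has the normalised kernel of index nu on ]0, +oo[ as its density;
   X is almost surely equal to 1 if nu = 1. *)
Definition has_kernel_law (X : {RV P >-> R}) (nu : R) : Prop :=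
  forall A : set R, measurable A ->
    distribution P X A =
    (\int[kref nu]_(r in A `&` `]0%R, +oo[) (kern nu r)%:E)%E.

End Probability.
End MittagLeffler.

(* Main.v *)
Require Import Defs.
From HB Require Import structures.
From mathcomp Require Import all_boot all_order all_algebra.
From mathcomp Require Import all_classical all_reals all_analysis.
From mathcomp Require Import measurable_realfun ring lra.
Import Order.TTheory GRing.Theory Num.Theory.
Import numFieldNormedType.Exports.
Local Open Scope classical_set_scope.
Local Open Scope ring_scope.

Set Implicit Arguments.
Unset Strict Implicit.
Unset Printing Implicit Defensive.

(** For nu < 1, Cauchy's theorem for (z^nu - s^nu) / ((z - s) (z^nu + 1)) on an
    annular sector closing up on the negative axis gives the Stieltjes transform
    of the kernel: the integral of kern nu r / (r + s) is s^(nu-1) / (s^nu + 1).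
    The right-hand side is also the Laplace transform of t |-> E_nu(-t^nu), so
    uniqueness of Laplace transforms exhibits this function as a mixture of
    exponentials, in particular with values in [0, 1].  The same comparison
    applied to E_al(-r t^al), whose Laplace transform is p^(al-1) / (p^al + r),
    gives the composition formula for nu * al.  The integral relation follows by
    r -> r^nu, and the iterated formula by induction on the law of
    W_1 W_2^c_2 ... W_m^c_m under the product of the kernels. *)

(** The integral taken around the sector is that of f(z) dz/z, written in real polar coordinates;
    its value comes from the small arc, where f(0) = s^(nu-1). The kernel of index 1 is a point
    mass, so the later arguments run through one probability measure, [kernel_prob], whose Stieltjes
    transform has the same form at every index in ]0, 1]. Integrands against it live on the whole
    line, and [|r|] stands for r to keep them nonnegative there. The alternating series of E_b(-t^b)
    is integrated termwise against e^(-p t) under domination by E_b(t^b), whose transform is finite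
    only for p > 1; uniqueness therefore has to work from p > 1 alone. Once the mixture of
    exponentials has bounded E_al(-y) between 0 and 1, all further exchanges of integrals are
    instances of Tonelli, which is why that mixture precedes the composition formula. For n indices,
    a single law is shown by induction to have three properties at once: it represents the iterated
    integral, it composes Mittag-Leffler functions, and it is the law of the random product. *)

(** * Holomorphic functions in polar coordinates *)

Section PolarHolomorphic.
Context {R : realType}.
Implicit Types (P : R -> R -> Prop) (U V D E : R -> R -> R).

Definition joint_cont (F : R -> R -> R) (r th : R) :=
  {for (r, th), continuous (fun p : R * R => F p.1 p.2)}.

(* Cauchy-Riemann in polar coordinates for f = U + i V at z = r e^(i th):
   D + i E is z f'(z). *)
Definition polar_holo P U V D E := forall r th, 0 < r -> P r th ->
  [/\ is_derive r 1 (U^~ th) (D r th / r), is_derive r 1 (V^~ th) (E r th / r),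
      is_derive th 1 (U r) (- E r th) & is_derive th 1 (V r) (D r th)] /\
  [/\ joint_cont U r th, joint_cont V r th, joint_cont D r th & joint_cont E r th].

Lemma joint_contM F G r th : joint_cont F r th -> joint_cont G r th ->
  joint_cont (fun r th => F r th * G r th) r th.
Proof. by move=> hF hG; exact: (cvgM hF hG). Qed.

Lemma joint_contB F G r th : joint_cont F r th -> joint_cont G r th ->
  joint_cont (fun r th => F r th - G r th) r th.
Proof. by move=> hF hG; exact: (cvgB hF hG). Qed.

Lemma joint_contD F G r th : joint_cont F r th -> joint_cont G r th ->
  joint_cont (fun r th => F r th + G r th) r th.
Proof. by move=> hF hG; exact: (cvgD hF hG). Qed.

Lemma joint_contN F r th : joint_cont F r th ->
  joint_cont (fun r th => - F r th) r th.
Proof. by move=> hF; exact: (cvgN hF). Qed.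

Lemma joint_contV F r th : F r th != 0 -> joint_cont F r th ->
  joint_cont (fun r th => (F r th)^-1) r th.
Proof. by move=> F0 hF; exact: (cvgV F0 hF). Qed.

Lemma joint_cont_l F r th : joint_cont F r th -> {for r, continuous (F^~ th)}.
Proof.
move=> h; apply: (@continuous_comp R (R * R)%type R (fun r => (r, th)) (fun p => F p.1 p.2)); last exact: h.
exact: (@cvg_pair R R R (nbhs r) (nbhs r) (nbhs th) _ _ _ id (fun=> th) cvg_id (cvg_cst th)).
Qed.

Lemma joint_cont_r F r th : joint_cont F r th -> {for th, continuous (F r)}.
Proof.
move=> h; apply: (@continuous_comp R (R * R)%type R (fun th => (r, th)) (fun p => F p.1 p.2)); last exact: h.
exact: (@cvg_pair R R R (nbhs th) (nbhs r) (nbhs th) _ _ _ (fun=> r) id (cvg_cst r) cvg_id).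
Qed.

Lemma polar_holo_pow P (m : R) :
  polar_holo P (fun r th => r `^ m * cos (m * th)) (fun r th => r `^ m * sin (m * th))
    (fun r th => m * (r `^ m * cos (m * th))) (fun r th => m * (r `^ m * sin (m * th))).
Proof.
move=> r th r0 _.
have e : m * r `^ (m - 1) = m * r `^ m / r.
  by rewrite -mulrA powRD ?powR_inv1 ?(ltW r0)// (gt_eqF r0) implybT.
have c1 : joint_cont (fun r th => r `^ m * cos (m * th)) r th.
  apply: (@joint_contM (fun r _ => r `^ m) (fun _ th => cos (m * th))).
    apply: (@continuous_comp _ _ _ fst (fun r => r `^ m)); first exact: cvg_fst.
    by apply/differentiable_continuous/derivable1_diffP/ex_derive; apply: is_derive1_powR.
  apply: (@continuous_comp _ _ _ snd (fun th => cos (m * th))); first exact: cvg_snd.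
  by apply/differentiable_continuous/derivable1_diffP/ex_derive.
have c2 : joint_cont (fun r th => r `^ m * sin (m * th)) r th.
  apply: (@joint_contM (fun r _ => r `^ m) (fun _ th => sin (m * th))).
    apply: (@continuous_comp _ _ _ fst (fun r => r `^ m)); first exact: cvg_fst.
    by apply/differentiable_continuous/derivable1_diffP/ex_derive; apply: is_derive1_powR.
  apply: (@continuous_comp _ _ _ snd (fun th => sin (m * th))); first exact: cvg_snd.
  by apply/differentiable_continuous/derivable1_diffP/ex_derive.
have dp := is_derive1_powR m r0.
have dc : is_derive th 1 (fun th => cos (m * th)) (- sin (m * th) * m).
  by apply: is_derive_eq; rewrite -mulr_algl /GRing.scale/=; ring.
have ds : is_derive th 1 (fun th => sin (m * th)) (cos (m * th) * m).
  by apply: is_derive_eq; rewrite -mulr_algl /GRing.scale/=; ring.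
split; split => //.
- apply: is_derive_eq; rewrite /GRing.scale/= e; field; exact: lt0r_neq0.
- apply: is_derive_eq; rewrite /GRing.scale/= e; field; exact: lt0r_neq0.
- by apply: is_derive_eq; rewrite /GRing.scale/=; ring.
- by apply: is_derive_eq; rewrite /GRing.scale/=; ring.
- by apply: (@joint_contM (fun _ _ => m)) => //; exact: cvg_cst.
- by apply: (@joint_contM (fun _ _ => m)) => //; exact: cvg_cst.
Qed.

Lemma polar_holoDc P U V D E (c : R) : polar_holo P U V D E ->
  polar_holo P (fun r th => U r th + c) V D E.
Proof.
move=> h r th r0 /(h _ _ r0)[[dU dV tU tV] [cU cV cD cE]].
split; split => //.
- by apply: is_derive_eq; rewrite addr0.
- by apply: is_derive_eq; rewrite addr0.
- by apply: joint_contD => //; exact: cvg_cst.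
Qed.

(** The last two components expand z (f g)' = (z f') g + f (z g)'. *)
Lemma polar_holoM P U1 V1 D1 E1 U2 V2 D2 E2 :
  polar_holo P U1 V1 D1 E1 -> polar_holo P U2 V2 D2 E2 ->
  polar_holo P (fun r th => U1 r th * U2 r th - V1 r th * V2 r th)
    (fun r th => U1 r th * V2 r th + V1 r th * U2 r th)
    (fun r th => (D1 r th * U2 r th - E1 r th * V2 r th) + (U1 r th * D2 r th - V1 r th * E2 r th))
    (fun r th => (D1 r th * V2 r th + E1 r th * U2 r th) + (U1 r th * E2 r th + V1 r th * D2 r th)).
Proof.
move=> h1 h2 r th r0 Prt.
have [[dU1 dV1 tU1 tV1] [cU1 cV1 cD1 cE1]] := h1 _ _ r0 Prt.
have [[dU2 dV2 tU2 tV2] [cU2 cV2 cD2 cE2]] := h2 _ _ r0 Prt.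
have := lt0r_neq0 r0 => r0'.
split; split.
- by apply: is_derive_eq; rewrite /GRing.scale/=; field.
- by apply: is_derive_eq; rewrite /GRing.scale/=; field.
- by apply: is_derive_eq; rewrite /GRing.scale/=; ring.
- by apply: is_derive_eq; rewrite /GRing.scale/=; ring.
- by apply: joint_contB; apply: joint_contM.
- by apply: joint_contD; apply: joint_contM.
- by apply: joint_contD; apply: joint_contB; apply: joint_contM.
- by apply: joint_contD; apply: joint_contD; apply: joint_contM.
Qed.

(** Here 1/f = (U - i V) / N with N = |f|^2, and z (1/f)' = - (D + i E) (U - i V)^2 / N^2. *)
Lemma polar_holoV P U V D E :
  (forall r th, 0 < r -> P r th -> U r th ^+ 2 + V r th ^+ 2 != 0) ->
  polar_holo P U V D E ->
  let N r th := U r th ^+ 2 + V r th ^+ 2 in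
  polar_holo P (fun r th => U r th / N r th) (fun r th => - V r th / N r th)
    (fun r th => (- (D r th * (U r th * U r th - V r th * V r th) + 2 * E r th * U r th * V r th)) / (N r th * N r th))
    (fun r th => (- (E r th * (U r th * U r th - V r th * V r th) - 2 * D r th * U r th * V r th)) / (N r th * N r th)).
Proof.
move=> N0 h N r th r0 Prt.
have [[dU dV tU tV] [cU cV cD cE]] := h _ _ r0 Prt.
have r0' := lt0r_neq0 r0.
have Nn : N r th != 0 by exact: N0.
have cN : joint_cont N r th by apply: joint_contD; apply: joint_contM.
have cNV : joint_cont (fun r th => (N r th)^-1) r th by exact: joint_contV.
have cNV2 : joint_cont (fun r th => (N r th * N r th)^-1) r th.
  by apply: (@joint_contV (fun r th => N r th * N r th)); [rewrite mulf_neq0|exact: joint_contM].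
have dN : is_derive r 1 (N^~ th) (2 * (U r th * D r th + V r th * E r th) / r).
  by rewrite /N; apply: is_derive_eq; rewrite /GRing.scale/=; field.
have tN : is_derive th 1 (N r) (2 * (- U r th * E r th + V r th * D r th)).
  by rewrite /N; apply: is_derive_eq; rewrite /GRing.scale/=; ring.
have dNV : is_derive r 1 (fun r => (N r th)^-1) (- (N r th) ^- 2 * (2 * (U r th * D r th + V r th * E r th) / r)).
  exact: (@is_deriveV R (N^~ th) r _ 1 Nn dN).
have tNV : is_derive th 1 (fun th => (N r th)^-1) (- (N r th) ^- 2 * (2 * (- U r th * E r th + V r th * D r th))).
  exact: (@is_deriveV R (N r) th _ 1 Nn tN).
have c2 : joint_cont (fun _ _ => 2) r th by exact: cvg_cst.
have Nn' : (U r th) ^+ 2 + (V r th) ^+ 2 != 0 by [].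
split; split.
- apply: is_derive_eq; rewrite /GRing.scale/= /N; field; exact/andP.
- apply: is_derive_eq; rewrite /GRing.scale/= /N; field; exact/andP.
- by apply: is_derive_eq; rewrite /GRing.scale/= /N; field.
- by apply: is_derive_eq; rewrite /GRing.scale/= /N; field.
- exact: joint_contM.
- by apply: joint_contM => //; exact: joint_contN.
- apply: joint_contM => //; apply: joint_contN; apply: joint_contD.
    by apply: joint_contM => //; apply: joint_contB; apply: joint_contM.
  by do 3! apply: joint_contM => //.
- apply: joint_contM => //; apply: joint_contN; apply: joint_contB.
    by apply: joint_contM => //; apply: joint_contB; apply: joint_contM.
  by do 3! apply: joint_contM => //.
Qed.

End PolarHolomorphic.

(** * Cauchy's theorem on an annular sector *)

Section PolarCauchy.
Context {R : realType}.
Notation mu := (@lebesgue_measure R).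

Lemma Rintegral_FTC2 (f F : R -> R) (a b : R) : a < b ->
  {in `[a, b], forall x : R, {for x, continuous f}} ->
  {in `[a, b], forall x : R, is_derive x 1 F (f x)} ->
  \int[mu]_(x in `[a, b]) f x = F b - F a.
Proof.
move=> ab cf dF.
have cF x : x \in `[a, b] -> {for x, continuous F}.
  move=> /dF ?; exact/differentiable_continuous/derivable1_diffP/ex_derive.
rewrite /Rintegral (@continuous_FTC2 R f F)//.
- by apply: continuous_in_subspaceT => x; rewrite inE/= => /cf.
- split.
  + by move=> x /subset_itv_oo_cc/dF ?; exact: ex_derive.
  + by apply: cvg_at_right_filter; apply: cF; rewrite in_itv/= lexx ltW.
  + by apply: cvg_at_left_filter; apply: cF; rewrite in_itv/= lexx ltW.
- by move=> x /subset_itv_oo_cc/dF ?; rewrite derive1E derive_val.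
Qed.

(** This is the imaginary part of the vanishing of the integral of f(z) dz/z around the sector. The
    radial integral is differentiated in th: dV/dth = D and D / r = dU/dr, so its derivative is U b
    th - U a th. *)
Lemma polar_cauchy (v a b t1 t2 : R) (U V D E : R -> R -> R) :
  polar_holo (fun _ th => 0 < th < v) U V D E ->
  0 < a < b -> 0 < t1 < t2 -> t2 < v ->
  \int[mu]_(r in `[a, b]) (V r t2 / r) - \int[mu]_(r in `[a, b]) (V r t1 / r) =
  \int[mu]_(th in `[t1, t2]) (U b th - U a th).
Proof.
move=> h /andP[a0 ab] /andP[t10 t12] t2v.
have rp r : r \in `[a, b] -> 0 < r.
  by rewrite in_itv/= => /andP[+ _]; exact: lt_le_trans.
pose I th := \int[mu]_(r in `[a, b]) (V r th / r).
have cdiv (F : R -> R -> R) th r : r \in `[a, b] -> joint_cont F r th ->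
    joint_cont (fun r th => F r th / r) r th.
  move=> rab cF; apply: joint_contM => //.
  apply: (@joint_contV _ (fun r _ => r)); first exact/lt0r_neq0/rp.
  by apply: (@continuous_comp _ _ _ fst id); [exact: cvg_fst|exact: cvg_id].
have dI th : 0 < th < v -> is_derive th 1 I (U b th - U a th).
  move=> /andP[th0 thv].
  (* A closed angular box around [th] inside the sector: by compactness D / r is bounded over it,
     which dominates the derivative of the integrand. *)
  pose u' := th / 2; pose v' := (th + v) / 2.
  have box t : t \in `[u', v'] -> 0 < t < v.
    rewrite in_itv/= /u' /v' => /andP[h1 h2]; apply/andP; split; lra.
  have [M M0 DM] : exists2 M, 0 <= M & forall r t, r \in `[a, b] -> t \in `[u', v'] ->
      `|D r t / r| <= M.
    pose K : set (R * R) := `[a, b] `*` `[u', v'].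
    have cK : compact ((fun p : R * R => D p.1 p.2 / p.1) @` K).
      apply: continuous_compact; last by apply: compact_setX; exact: segment_compact.
      apply: continuous_in_subspaceT => -[r t]; rewrite inE => -[/= rab tuv].
      apply: (@cdiv D) => //.
      by have [_ []] := h _ _ (rp _ rab) (box _ tuv).
    have [M [_ HM]] := compact_bounded cK.
    exists (`|M| + 1); first by rewrite addr_ge0.
    move=> r t rab tuv; apply: HM; last by exists (r, t).
    by rewrite (le_lt_trans (ler_norm _))// ltrDl.
  have Ith : `]u', v'[%classic th by rewrite /= in_itv/= /u' /v'; apply/andP; split; lra.
  have dV t r : `]u', v'[%classic t -> `[a, b]%classic r ->
      is_derive t 1 (fun t => V r t / r) (D r t / r).
    move=> /subset_itv_oo_cc/box tv rab.
    have [[_ _ _ ?] _] := h _ _ (rp _ rab) tv.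
    by apply: is_derive_eq; rewrite scaler0 add0r /GRing.scale/= mulrC.
  have intV t : `]u', v'[%classic t -> mu.-integrable `[a, b] (EFin \o (fun r => V r t / r)).
    move=> /subset_itv_oo_cc/box tv.
    apply: continuous_compact_integrable; first exact: segment_compact.
    apply: continuous_in_subspaceT => r; rewrite inE => rab.
    apply: (@joint_cont_l R (fun r t => V r t / r)); apply: cdiv => //.
    by have [_ []] := h _ _ (rp _ rab) tv.
  have der t r : `]u', v'[%classic t -> `[a, b]%classic r -> derivable (fun t => V r t / r) t 1.
    by move=> ut ra; apply: ex_derive; exact: dV.
  have intM : mu.-integrable `[a, b] (EFin \o cst M).
    apply: continuous_compact_integrable; first exact: segment_compact.
    by apply: continuous_subspaceT; exact: cst_continuous.
  have Gub t r : `]u', v'[%classic t -> `[a, b]%classic r ->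
      `|partial1of2 (fun t r => V r t / r) t r| <= cst M r.
    move=> ut ra; rewrite partial1of2E.
    have := dV _ _ ut ra => ?; rewrite derive_val; apply: DM => //.
    exact: subset_itv_oo_cc.
  have mab : measurable (`[a, b]%classic : set R) by [].
  have H1 := @derivable_under_integral R _ _ mu _ _ mab th u' v' Ith intV der _ (fun=> M0) intM Gub.
  have H2 := @differentiation_under_integral R _ _ mu _ _ mab th u' v' Ith intV der _ (fun=> M0) intM Gub.
  apply: DeriveDef; first exact: H1.
  rewrite -derive1E H2.
  transitivity (\int[mu]_(r in `[a, b]) (D r th / r)).
    apply: eq_Rintegral => r /set_mem rab.
    rewrite partial1of2E.
    by have := dV _ _ Ith rab => ?; rewrite derive_val.
  have thv' : 0 < th < v by rewrite th0 thv.
  apply: (@Rintegral_FTC2 _ (fun r => U r th)) => // r rab.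
    apply: (@joint_cont_l R (fun r t => D r t / r)); apply: cdiv => //.
    by have [_ []] := h _ _ (rp _ rab) thv'.
  by have [[]] := h _ _ (rp _ rab) thv'.
have tv t : t \in `[t1, t2] -> 0 < t < v.
  rewrite in_itv/= => /andP[h1 h2]; apply/andP; split; lra.
symmetry; apply: (@Rintegral_FTC2 _ I) => // t /tv tv0.
  have b0 : 0 < b by rewrite (lt_trans a0).
  by apply: cvgB; apply: joint_cont_r;
    [have [_ []] := h _ _ b0 tv0|have [_ []] := h _ _ a0 tv0].
exact: dI.
Qed.

End PolarCauchy.

(** * The contour integral giving the Stieltjes transform of the kernel *)

Section StieltjesContour.
Context {R : realType}.
Variables (nu s : R).
Hypotheses (nu01 : 0 < nu < 1) (s_gt0 : 0 < s).
Notation mu := (@lebesgue_measure R).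
Let A := s `^ nu.
Let m := sin (nu * pi).

Let w1 (r th : R) := r `^ nu * cos (nu * th).
Let w2 (r th : R) := r `^ nu * sin (nu * th).
Let z1 (r th : R) := r `^ 1 * cos (1 * th).
Let z2 (r th : R) := r `^ 1 * sin (1 * th).
Let Nn r th := (w1 r th - A) ^+ 2 + w2 r th ^+ 2.
Let Nz r th := (z1 r th - s) ^+ 2 + z2 r th ^+ 2.
Let Nw r th := (w1 r th + 1) ^+ 2 + w2 r th ^+ 2.
Let U1 r th := (w1 r th - A) * ((z1 r th - s) / Nz r th) - w2 r th * (- z2 r th / Nz r th).
Let V1 r th := (w1 r th - A) * (- z2 r th / Nz r th) + w2 r th * ((z1 r th - s) / Nz r th).
(* [U] and [V] are the real and imaginary parts of
   (z^nu - s^nu) / ((z - s) (z^nu + 1)) at z = r e^(i th): the numerator cancels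
   the pole at z = s, and the jump across the negative axis is the kernel. *)
Let U r th := U1 r th * ((w1 r th + 1) / Nw r th) - V1 r th * (- w2 r th / Nw r th).
Let V r th := U1 r th * (- w2 r th / Nw r th) + V1 r th * ((w1 r th + 1) / Nw r th).

Let nu_gt0 : 0 < nu. Proof. by case/andP: nu01. Qed.
Let nu_lt1 : nu < 1. Proof. by case/andP: nu01. Qed.
Let pi0 : 0 < pi :> R. Proof. exact: pi_gt0. Qed.
Let A_gt0 : 0 < A. Proof. exact: powR_gt0. Qed.

Let m_gt0 : 0 < m.
Proof. by apply: sin_gt0_pi; rewrite mulr_gt0//= -[ltRHS]mul1r ltr_pM2r. Qed.

Let nupi_lt (th : R) : 0 <= th <= pi -> 0 <= nu * th <= th.
Proof.
by move=> /andP[h0 h1]; rewrite mulr_ge0 ?(ltW nu_gt0)//= ler_piMl// ltW.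
Qed.

Let cos_nu_le (th : R) : 0 <= th <= pi -> cos th <= cos (nu * th).
Proof.
move=> h; have /andP[h0 h1] := nupi_lt h; have /andP[t0 t1] := h.
by rewrite leNgt ltr_cos ?in_itv/= ?t0 ?t1 ?h0 ?(le_trans h1)// -leNgt.
Qed.

Let cos_nupi_le (th : R) : 0 <= th <= pi -> cos (nu * pi) <= cos (nu * th).
Proof.
move=> h; have /andP[h0 h1] := nupi_lt h; have /andP[t0 t1] := h.
have /andP[p0 p1] : 0 <= nu * pi <= pi by apply: nupi_lt; rewrite lexx ltW.
rewrite leNgt ltr_cos ?in_itv/= ?p0 ?p1 ?h0 ?(le_trans h1)// -leNgt.
by rewrite ler_pM2l.
Qed.

(** The law of cosines, split into a radial and an angular part, each of which is later compared
    with its counterpart in |z - s|^2. *)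
Let NnE r th : Nn r th = (r `^ nu - A) ^+ 2 + 2 * (r `^ nu * A) * (1 - cos (nu * th)).
Proof. by rewrite /Nn /w1 /w2 [(_ * sin _) ^+ 2]exprMn sin2cos2; ring. Qed.

Let NzE r th : 0 < r -> Nz r th = (r - s) ^+ 2 + 2 * (r * s) * (1 - cos th).
Proof.
move=> r0; rewrite /Nz /z1 /z2 powRr1 ?ltW// mul1r.
by rewrite [(_ * sin _) ^+ 2]exprMn sin2cos2; ring.
Qed.

Let NwE r th : Nw r th = (r `^ nu + cos (nu * th)) ^+ 2 + sin (nu * th) ^+ 2.
Proof. by rewrite /Nw /w1 /w2 [(_ * sin _) ^+ 2]exprMn sin2cos2; ring. Qed.

(** With x = r^nu, c = cos (nu th) and d = cos (nu pi), |z^nu + 1|^2 = x^2 + 2 x c + 1 >= x^2 + 2 x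
    d + 1 >= 1 - d^2. *)
Let Nw_ge r th : 0 <= th <= pi -> m ^+ 2 <= Nw r th.
Proof.
move=> h; rewrite /m NwE !sin2cos2.
have := cos_nupi_le h; have := powR_ge0 r nu.
set x := r `^ nu; set c := cos (nu * th); set d := cos (nu * pi) => x0 cd.
have h1 : 0 <= x * (c - d) by rewrite mulr_ge0 ?subr_ge0.
by have h2 := sqr_ge0 (x + d); nra.
Qed.

Let UV2 r th : Nz r th != 0 -> Nw r th != 0 ->
  U r th ^+ 2 + V r th ^+ 2 = Nn r th / (Nz r th * Nw r th).
Proof.
move=> h1 h2; rewrite /U /V /U1 /V1 /Nn; move: h1 h2; rewrite /Nz /Nw => h1 h2.
by field; rewrite h1 h2.
Qed.

Let P (r th : R) := Nz r th != 0 /\ Nw r th != 0.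

Let holoQ : exists D E, polar_holo P U V D E.
Proof.
have hz := polar_holoDc (- s) (@polar_holo_pow R P 1).
have hn := polar_holoDc (- A) (@polar_holo_pow R P nu).
have hw := polar_holoDc 1 (@polar_holo_pow R P nu).
have hz' := polar_holoV (fun r th _ (h : P r th) => h.1) hz.
have hw' := polar_holoV (fun r th _ (h : P r th) => h.2) hw.
by have := polar_holoM (polar_holoM hn hz') hw' => h; do 2 eexists; exact: h.
Qed.

Let Nw_gt0 r th : 0 <= th <= pi -> 0 < Nw r th.
Proof. by move=> /(Nw_ge r); apply: lt_le_trans; rewrite exprn_gt0. Qed.

Let Nz_ge r th : 0 < r -> (r - s) ^+ 2 <= Nz r th.
Proof.
move=> r0; rewrite NzE// lerDl mulr_ge0 ?subr_ge0 ?cos_le1//.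
by rewrite mulr_ge0// mulr_ge0 ?ltW.
Qed.

Let Nz_gt0 r th : 0 < r -> r != s -> 0 < Nz r th.
Proof.
move=> r0 rs; apply: lt_le_trans (Nz_ge th r0).
by rewrite exprn_even_gt0//= subr_eq0.
Qed.

(** The angle may pass pi, since z^nu is a function of (r, th) rather than of z; thus th = pi is an
    interior point, with two-sided derivatives. The bound 2 pi keeps z away from s, the bound pi /
    nu keeps z^nu away from -1. *)
Let P_cut r th : 0 < r -> 0 < th < Num.min (pi *+ 2) (pi / nu) -> P r th.
Proof.
move=> r0 /andP[th0]; rewrite lt_min ltr_pdivlMr// mulrC => /andP[th2 thn].
split; apply: lt0r_neq0.
  have : 0 < sin (th / 2).
    apply: sin_gt0_pi; rewrite divr_gt0//= ltr_pdivrMr//.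
    by rewrite mulr_natr.
  have e : cos th = cos ((th / 2) *+ 2) by rewrite -mulr_natr mulfVK.
  rewrite NzE// e cos_mulr2n.
  rewrite cos2sin2 => h.
  have h1 : 0 < r * s * sin (th / 2) ^+ 2 by rewrite !mulr_gt0// exprn_gt0.
  by have := sqr_ge0 (r - s); nra.
have : 0 < sin (nu * th) by apply: sin_gt0_pi; rewrite mulr_gt0.
by move=> h; rewrite NwE ltr_wpDl ?sqr_ge0 ?exprn_gt0.
Qed.

Let P_pi r th : 0 < r -> r != s -> 0 <= th <= pi -> P r th.
Proof. by move=> r0 rs h; split; apply: lt0r_neq0; [exact: Nz_gt0|exact: Nw_gt0]. Qed.

Let pi_cut : pi < Num.min (pi *+ 2) (pi / nu).
Proof. by rewrite lt_min mulr2n ltrDr pi0/= ltr_pdivlMr// gtr_pMr. Qed.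

Let P_pos r th : 0 < r -> 0 < th <= pi -> P r th.
Proof.
by move=> r0 /andP[h0 h1]; apply: P_cut => //; rewrite h0 (le_lt_trans h1).
Qed.

Let sqr_norm_le (x y : R) : 0 <= y -> x ^+ 2 <= y ^+ 2 -> `|x| <= y.
Proof. by move=> y0; rewrite -[x ^+ 2]real_normK ?num_real// ler_pXn2r ?nnegrE. Qed.

(** A Lipschitz bound for z^nu at s, valid for |z| >= a down to the positive axis, so that the
    cancelled pole is controlled uniformly in th. Radially, r^nu = r r^(nu-1) with r^(nu-1)
    decreasing gives |r^nu - s^nu| <= s^(nu-1) |r - s|; angularly, cos th <= cos (nu th). Here A / s
    is s^(nu-1). *)
Let Nn_le a r th : 0 < a <= r -> 0 <= th <= pi ->
  Nn r th <= (A / s) * (A / s + a `^ (nu - 1)) * Nz r th.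
Proof.
move=> /andP[a0 ar] h; have r0 := lt_le_trans a0 ar.
have cc := cos_nu_le h.
have c1 : cos (nu * th) <= 1 by exact: cos_le1.
have rE : r `^ nu = r * r `^ (nu - 1) by rewrite mulr_powRB1// ltW.
have AE : A = s * s `^ (nu - 1) by rewrite mulr_powRB1// ltW.
have rd : r `^ (nu - 1) <= a `^ (nu - 1).
  have -> : nu - 1 = - (1 - nu) by ring.
  rewrite !powRN lef_pV2 ?posrE ?powR_gt0//.
  by apply: ge0_ler_powR; rewrite ?nnegrE ?subr_ge0 ?(ltW a0) ?(ltW r0) ?(ltW nu_lt1).
have sE : A / s = s `^ (nu - 1) by rewrite AE; field; exact: lt0r_neq0.
rewrite NnE NzE// sE.
set q := s `^ (nu - 1) in AE sE *; set p := a `^ _ in rd *; set o := r `^ (nu - 1) in rE rd.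
have q0 : 0 < q by exact: powR_gt0.
have o0 : 0 < o by exact: powR_gt0.
have p0 : 0 < p by exact: powR_gt0.
have h1 : (r `^ nu - A) ^+ 2 <= q ^+ 2 * (r - s) ^+ 2.
  rewrite -exprMn.
  have [sr|rs] := leP s r.
    have oq : o <= q.
      rewrite /o /q (_ : nu - 1 = - (1 - nu)); last by ring.
      rewrite !powRN lef_pV2 ?posrE ?powR_gt0//.
      by apply: ge0_ler_powR; rewrite ?nnegrE ?subr_ge0 ?(ltW s_gt0) ?(ltW r0) ?(ltW nu_lt1).
    have Ar : A <= r `^ nu by apply: ge0_ler_powR; rewrite ?nnegrE ?(ltW nu_gt0) ?(ltW r0) ?(ltW s_gt0)// ltW.
    rewrite ler_pXn2r ?nnegrE ?subr_ge0// ?mulr_ge0 ?subr_ge0 ?(ltW q0)//.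
    rewrite rE AE mulrBr (mulrC s) lerD2r mulrC ler_wpM2r// ltW//.
  have oq : q <= o.
    rewrite /o /q (_ : nu - 1 = - (1 - nu)); last by ring.
    rewrite !powRN lef_pV2 ?posrE ?powR_gt0//.
    by apply: ge0_ler_powR; rewrite ?nnegrE ?subr_ge0 ?(ltW s_gt0) ?(ltW r0) ?(ltW rs) ?(ltW nu_lt1).
  have Ar : r `^ nu <= A by apply: ge0_ler_powR; rewrite ?nnegrE ?(ltW nu_gt0) ?(ltW r0) ?(ltW s_gt0)// ltW.
  rewrite -sqrrN opprB -[leRHS]sqrrN -mulrN opprB.
  rewrite ler_pXn2r ?nnegrE ?subr_ge0// ?mulr_ge0 ?subr_ge0 ?(ltW q0) ?(ltW rs)//.
  by rewrite rE AE mulrBr (mulrC s) lerD2l lerN2 (mulrC q) ler_pM2l.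
have h2 : 2 * (r * o * (s * q)) * (1 - cos (nu * th)) <= 2 * (r * s) * (q * p) * (1 - cos th).
  have -> : 2 * (r * o * (s * q)) = 2 * (r * s) * (q * o) by ring.
  apply: ler_pM; rewrite ?subr_ge0//.
  - by rewrite !mulr_ge0 ?(ltW r0) ?(ltW s_gt0) ?(ltW q0) ?(ltW o0).
  - by apply: ler_wpM2l; [rewrite !mulr_ge0 ?(ltW r0) ?(ltW s_gt0)|rewrite ler_pM2l].
  - by rewrite lerD2l lerN2.
have h3 : 0 <= q * p * (r - s) ^+ 2 by rewrite mulr_ge0 ?sqr_ge0// ltW// mulr_gt0.
have h4 : 0 <= q * q * (2 * (r * s) * (1 - cos th)).
  by rewrite !mulr_ge0 ?subr_ge0 ?cos_le1 ?(ltW q0) ?(ltW r0) ?(ltW s_gt0).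
move: h1; rewrite {}rE AE => h1.
apply: le_trans (lerD h1 h2) _; rewrite -subr_ge0.
rewrite [leRHS](_ : _ = q * p * (r - s) ^+ 2 + q * q * (2 * (r * s) * (1 - cos th))).
  exact: addr_ge0.
by ring.
Qed.

Let V_bound a b : 0 < a -> exists2 K, 0 <= K & forall r th, r \in `[a, b] ->
  r != s -> 0 <= th <= pi -> `|V r th| <= K.
Proof.
move=> a0; pose C := (A / s) * (A / s + a `^ (nu - 1)).
have C0 : 0 <= C by rewrite mulr_ge0 ?addr_ge0 ?powR_ge0 ?divr_ge0 ?(ltW A_gt0) ?(ltW s_gt0).
have D0 : 0 <= C / m ^+ 2 by rewrite divr_ge0 ?sqr_ge0.
(* V^2 <= q implies |V| <= q + 1, which spares a square root. *)
exists (C / m ^+ 2 + 1) => [|r th]; first by rewrite addr_ge0.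
rewrite in_itv/= => /andP[ar _] rs h; have r0 := lt_le_trans a0 ar.
apply: sqr_norm_le; first by rewrite addr_ge0.
have Nz0 := Nz_gt0 th r0 rs; have Nw0 := Nw_gt0 r h.
have : V r th ^+ 2 <= C / m ^+ 2.
  have : V r th ^+ 2 <= Nn r th / (Nz r th * Nw r th).
    by rewrite -UV2 ?lt0r_neq0// lerDr sqr_ge0.
  move=> /le_trans; apply.
  rewrite ler_pdivrMr ?mulr_gt0// mulrC mulrA.
  have : Nn r th <= C * Nz r th by apply: Nn_le; rewrite ?a0.
  move=> /le_trans; apply.
  rewrite -mulrA [leRHS](_ : _ = C * Nz r th * (Nw r th / m ^+ 2)); last by ring.
  rewrite ler_peMr ?(mulr_ge0 C0 (ltW Nz0))//.
  by rewrite ler_pdivlMr ?mul1r ?Nw_ge// exprn_gt0.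
by move: D0; set q := C / m ^+ 2 => q0; nra.
Qed.

Let U_bound r th : 0 < r -> r != s -> 0 <= th <= pi ->
  `|U r th| <= (r `^ nu + A) / (`|r - s| * m).
Proof.
move=> r0 rs h; have Nz0 := Nz_gt0 th r0 rs; have Nw0 := Nw_gt0 r h.
have rs0 : 0 < `|r - s| by rewrite normr_gt0 subr_eq0.
apply: sqr_norm_le; first by rewrite divr_ge0 ?addr_ge0 ?powR_ge0 ?mulr_ge0 ?(ltW m_gt0).
have : U r th ^+ 2 <= Nn r th / (Nz r th * Nw r th).
  by rewrite -UV2 ?lt0r_neq0// lerDl sqr_ge0.
move=> /le_trans; apply.
rewrite expr_div_n; apply: ler_pM.
- by rewrite addr_ge0 ?sqr_ge0.
- by rewrite invr_ge0 mulr_ge0 ?ltW.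
- rewrite NnE; have := cos_geN1 (nu * th); have := powR_ge0 r nu.
  set q := r `^ nu; set c := cos _ => q0 c0.
  have h1 : 0 <= q * A * (1 + c) by rewrite !mulr_ge0 ?(ltW A_gt0)//; lra.
  by nra.
- rewrite lef_pV2 ?posrE ?mulr_gt0 ?exprn_gt0// ?mulr_gt0//.
  rewrite exprMn real_normK ?num_real//.
  by apply: ler_pM; rewrite ?sqr_ge0 ?Nz_ge ?Nw_ge.
Qed.

(** The function is real on the positive axis; at r = s the quotient reads 0 / 0 there. *)
Let V_cont0 r : 0 < r -> r != s -> {for 0, continuous (V r)} /\ V r 0 = 0.
Proof.
move=> r0 rs; split; last first.
  by rewrite /V /V1 /U1 /w2 /z2 !(mulr0, sin0, oppr0, mul0r, addr0).
have [D [E h]] := holoQ.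
have P0 : P r 0 by apply: P_pi; rewrite ?lexx ?ltW.
by have [_ [_ + _ _]] := h _ _ r0 P0; exact: joint_cont_r.
Qed.

Let holo_cut : exists D E,
  polar_holo (fun _ th => 0 < th < Num.min (pi *+ 2) (pi / nu)) U V D E.
Proof.
have [D [E h]] := holoQ; exists D, E => r th r0 hth.
by apply: h => //; exact: P_cut.
Qed.

Let I a b th := \int[mu]_(r in `[a, b]) (V r th / r).

Let mV a b th : 0 < a -> 0 < th <= pi ->
  mu.-integrable `[a, b] (EFin \o (fun r => V r th / r)).
Proof.
move=> a0 hth; apply: continuous_compact_integrable; first exact: segment_compact.
apply: continuous_in_subspaceT => r; rewrite inE/= in_itv/= => /andP[ar _].
have r0 := lt_le_trans a0 ar.
have [D [E h]] := holoQ.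
have [_ [_ hV _ _]] := h _ _ r0 (P_pos r0 hth).
apply: (@joint_cont_l R (fun r t => V r t / r)); apply: joint_contM => //.
apply: (@joint_contV _ (fun r _ => r)); first exact/lt0r_neq0.
by apply: (@continuous_comp _ _ _ fst id); [exact: cvg_fst|exact: cvg_id].
Qed.

(** The lower side of the sector can be pushed onto the positive axis: [V] tends to 0 for r != s,
    under the uniform bound [V_bound]. The angle is made small as well, so that the arcs fill up to
    ]0, pi]. *)
Let I_small a b e : 0 < a -> 0 < e -> exists th, [/\ 0 < th, th < pi, th < e & `|I a b th| < e].
Proof.
move=> a0 e0.
pose th (n : nat) : R := pi / 2 * (n.+1%:R)^-1.
have th0 n : 0 < th n by rewrite mulr_gt0 ?divr_gt0 ?invr_gt0.
have thpi n : th n < pi.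
  apply: (@le_lt_trans _ _ (pi / 2)); last by rewrite ltr_pdivrMr// ltr_pMr// ltr1n.
  by rewrite ler_piMr ?divr_ge0 ?(ltW pi0)// invf_le1// ler1n.
have thc : th n @[n --> \oo] --> (0 : R).
  rewrite -(mulr0 (pi / 2)); apply: cvgM; first exact: cvg_cst.
  exact: cvg_harmonic.
have [K K0 hK] := V_bound b a0.
have mab : measurable (`[a, b]%classic : set R) by [].
have rab r : `[a, b]%classic r -> 0 < r.
  by rewrite /= in_itv/= => /andP[+ _]; exact: lt_le_trans.
have h1 n : measurable_fun (`[a, b]%classic : set (measurableTypeR R)) (fun r => (V r (th n) / r)%:E : \bar R).
  by apply: (measurable_int mu); apply: mV; rewrite ?th0 ?ltW.
have aes (Q : R -> Prop) : (forall r, r != s -> Q r) -> {ae mu, forall r, Q r}.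
  move=> hQ; exists [set s]; split => //; first exact: lebesgue_measure_set1.
  by move=> r /= nQ; apply/eqP; apply: contrapT => /negP/hQ.
have h2 : {ae mu, forall r, `[a, b]%classic r -> (V r (th n) / r)%:E @[n --> \oo] --> (0%:E : \bar R)}.
  apply: aes => r rs rab'.
  apply: cvg_EFin; first exact: nearW.
  rewrite -(mul0r r^-1); apply: cvgM; last exact: cvg_cst.
  have [c0 V0] := V_cont0 (rab _ rab') rs.
  by rewrite -V0; apply: (cvg_comp _ _ thc c0).
have h3 : {ae mu, forall r (n : nat), `[a, b]%classic r -> (`|(V r (th n) / r)%:E| <= (K / a)%:E)%E}.
  apply: aes => r rs n rab'.
  rewrite abse_EFin lee_fin normrM; apply: ler_pM => //.
    by apply: hK => //; rewrite !ltW.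
  have := rab'; rewrite /= in_itv/= => /andP[ar _].
  have r0 := rab _ rab'.
  by rewrite normfV (gtr0_norm r0) lef_pV2 ?posrE.
have h4 : mu.-integrable `[a, b] (EFin \o (fun=> K / a)).
  apply: continuous_compact_integrable; first exact: segment_compact.
  by apply: continuous_subspaceT; exact: cst_continuous.
have [_ _] := @dominated_convergence _ _ R mu _ mab _ (cst 0%:E) _ h1 (measurable_cst _) h2 h4 h3.
rewrite integral0.
move=> /fine_cvgP[_] /cvgrPdist_lt /(_ _ e0) H1.
have H2 : \forall n \near \oo, th n < e.
  move/cvgrPdist_lt : thc => /(_ _ e0); apply: filterS => n.
  by rewrite sub0r normrN gtr0_norm.
have [n [nI ne]] := filter_ex (filterI H1 H2).
exists (th n); split => //.
by move: nI; rewrite /= sub0r normrN.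
Qed.

(** The shifts by 2 / s and 2 s give an <= s / 2 and bn >= 2 s, so both arcs keep a definite
    distance from s. *)
Let an (n : nat) : R := (n.+1%:R + 2 / s)^-1.
Let bn (n : nat) : R := n.+1%:R + 2 * s.

(** Two sides survive in the limit: the upper one on the negative axis, and the small arc, where
    f(0) = A / s contributes - pi A / s. On the large arc f is of order r^(nu-1), which tends to
    0. *)
Let contour_cvg :
  \int[mu]_(r in `[an n, bn n]) (V r pi / r) @[n --> \oo] --> - (pi * (A / s)).
Proof.
have n0 n : (0 : R) < n.+1%:R by rewrite ltr0n.
have ds0 : 0 < 2 / s by rewrite divr_gt0.
have an0 n : 0 < an n by rewrite invr_gt0 addr_gt0.
have an1 n : an n <= s / 2.
  by rewrite -[s / 2]invrK invf_div lef_pV2 ?posrE ?addr_gt0// lerDr ltW.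
have bn0 n : 0 < bn n by rewrite addr_gt0 ?mulr_gt0.
have bn1 n : 2 * s <= bn n by rewrite lerDr ltW.
have bn2 n : 1 <= bn n by rewrite -[leLHS]addr0 lerD ?ler1n ?mulr_ge0 ?(ltW s_gt0).
have ans n : an n < s by apply: le_lt_trans (an1 n) _; rewrite ltr_pdivrMr// ltr_pMr// ltr1n.
have bns n : s < bn n by apply: lt_le_trans (bn1 n); rewrite ltr_pMl// ltr1n.
have an_ne n : an n != s by rewrite lt_eqF.
have bn_ne n : bn n != s by rewrite gt_eqF.
have an_cvg : an n @[n --> \oo] --> (0 : R).
  apply: (@squeeze_cvgr _ _ _ _ (cst 0) (@harmonic R)).
  - apply: nearW => n; rewrite (ltW (an0 n))/= /harmonic.
    by rewrite lef_pV2 ?posrE ?addr_gt0// lerDl ltW.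
  - exact: cvg_cst.
  - exact: cvg_harmonic.
have bnV_cvg : (bn n)^-1 @[n --> \oo] --> (0 : R).
  apply: (@squeeze_cvgr _ _ _ _ (cst 0) (@harmonic R)).
  - apply: nearW => n; rewrite invr_ge0 (ltW (bn0 n))/= /harmonic.
    by rewrite lef_pV2 ?posrE ?addr_gt0 ?mulr_gt0// lerDl mulr_ge0 ?ltW.
  - exact: cvg_cst.
  - exact: cvg_harmonic.
have powV0 (x : nat -> R) (p : R) : 0 < p -> (forall n, 0 < x n) -> x n @[n --> \oo] --> (0 : R) ->
    x n `^ p @[n --> \oo] --> (0 : R).
  by move=> p0 x0 xc; have /cvg_at_rightP h := powR_cvg0 p0; exact: h.
have [dl hdl] : exists dl : nat -> R, forall n, [/\ 0 < dl n, dl n < pi, dl n < n.+1%:R^-1 &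
    `|I (an n) (bn n) (dl n)| < n.+1%:R^-1].
  have h n : exists th, [/\ 0 < th, th < pi, th < n.+1%:R^-1 &
    `|I (an n) (bn n) th| < n.+1%:R^-1] by apply: (I_small _ (an0 n)); rewrite invr_gt0.
  by exists (fun n => projT1 (cid (h n))) => n; case: cid.
have dl_cvg : dl n @[n --> \oo] --> (0 : R).
  apply: (@squeeze_cvgr _ _ _ _ (cst 0) (@harmonic R)).
  - by apply: nearW => n; have [h1 _ h2 _] := hdl n; rewrite (ltW h1) (ltW h2).
  - exact: cvg_cst.
  - exact: cvg_harmonic.
have I_cvg : I (an n) (bn n) (dl n) @[n --> \oo] --> (0 : R).
  apply: norm_cvg0.
  apply: (@squeeze_cvgr _ _ _ _ (cst 0) (@harmonic R)).
  - by apply: nearW => n; have [_ _ _ h2] := hdl n; rewrite normr_ge0 (ltW h2).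
  - exact: cvg_cst.
  - exact: cvg_harmonic.
pose F n th := U (bn n) th - U (an n) th.
pose J n := \int[mu]_(th in `[dl n, pi]) F n th.
have IE n : I (an n) (bn n) pi = I (an n) (bn n) (dl n) + J n.
  have [D [E h]] := holo_cut; have [h1 h2 _ _] := hdl n.
  apply/eqP; rewrite addrC -subr_eq; apply/eqP.
  apply: (polar_cauchy h); rewrite ?an0 ?h1 ?h2 ?pi_cut//=.
  by rewrite (lt_trans (ans n)).
suff : J n @[n --> \oo] --> - (pi * (A / s)).
  move=> JC; rewrite -[- (pi * _)]add0r; under eq_cvg do rewrite -/(I _ _ _) IE.
  exact: cvgD.
pose D : set R := `]0, pi]%classic.
have mD : measurable D by exact: measurable_itv.
have Db th : D th -> 0 < th <= pi by rewrite /D/= in_itv/=.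
have Db' th : D th -> 0 <= th <= pi by move=> /Db/andP[/ltW -> ->].
(* [K1] bounds U on the large arcs, using b >= 2 s and b >= 1; [K2] bounds it on the small arcs,
   using a <= s / 2. *)
pose K1 := 2 * (1 + A) / m; pose K2 := 4 * A / (s * m).
have Ub_le n th : D th -> `|U (bn n) th| <= 2 * ((bn n)^-1 `^ (1 - nu) + A * (bn n)^-1) / m.
  move=> /Db' h; apply: le_trans (U_bound (bn0 n) (bn_ne n) h) _.
  have := bn1 n; have := bn0 n; set b := bn n => b0 b2.
  have bE : b `^ nu = b * b^-1 `^ (1 - nu).
    by rewrite -powR_inv1 ?(ltW b0)// -powRrM mulN1r opprB mulr_powRB1// ltW.
  rewrite bE gtr0_norm; last by rewrite subr_gt0; lra.
  rewrite ler_pdivrMr; last by rewrite mulr_gt0// subr_gt0; lra.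
  rewrite [leRHS](_ : _ = (b * b^-1 `^ (1 - nu) + A) * (2 * (b - s) / b)); last first.
    by field; rewrite !lt0r_neq0.
  rewrite ler_peMr ?addr_ge0 ?mulr_ge0 ?powR_ge0 ?(ltW b0) ?(ltW A_gt0)//.
  by rewrite ler_pdivlMr// mul1r; lra.
have Ub_le1 n th : D th -> `|U (bn n) th| <= K1.
  move=> h; apply: le_trans (Ub_le n th h) _.
  rewrite /K1 ler_pM2r ?invr_gt0// ler_pM2l//.
  have b1 : (bn n)^-1 <= 1 by rewrite invf_le1.
  apply: lerD; last by rewrite ler_piMr// ltW.
  apply: (@le_trans _ _ (1 `^ (1 - nu))); last by rewrite powR1.
  by apply: ge0_ler_powR; rewrite ?nnegrE ?subr_ge0 ?(ltW nu_lt1) ?invr_ge0 ?(ltW (bn0 n)).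
have Ua_le n th : D th -> `|U (an n) th| <= K2.
  move=> /Db' h; apply: le_trans (U_bound (an0 n) (an_ne n) h) _.
  have := an1 n; have := ans n; have := an0 n; set a := an n => a0 as_ a2.
  have Ar : a `^ nu <= A by apply: ge0_ler_powR; rewrite ?nnegrE ?(ltW nu_gt0) ?(ltW a0) ?(ltW s_gt0)// ltW.
  rewrite distrC gtr0_norm ?subr_gt0//.
  rewrite ler_pdivrMr; last by rewrite mulr_gt0// subr_gt0.
  rewrite [leRHS](_ : _ = A * (4 * (s - a) / s)); last by rewrite /K2; field; rewrite !lt0r_neq0.
  apply: (@le_trans _ _ (A * 2)); first by rewrite mulr_natr mulr2n lerD2r.
  by rewrite ler_pM2l// ler_pdivlMr//; lra.
have F_cvg th : D th -> F n th @[n --> \oo] --> - (A / s).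
  move=> Dth; rewrite -[- (A / s)]add0r; apply: cvgB.
    apply: norm_cvg0.
    apply: (@squeeze_cvgr _ _ _ _ (cst 0) (fun n => 2 * ((bn n)^-1 `^ (1 - nu) + A * (bn n)^-1) / m)).
    - by apply: nearW => n; rewrite normr_ge0 Ub_le.
    - exact: cvg_cst.
    - rewrite [X in _ --> X](_ : _ = 2 * (0 + A * 0) / m); last by rewrite mulr0 addr0 mulr0 mul0r.
      apply: cvgM; last exact: cvg_cst.
      apply: cvgM; first exact: cvg_cst.
      apply: cvgD; first by apply: powV0; rewrite ?subr_gt0// => n; rewrite invr_gt0.
      by apply: cvgM; first exact: cvg_cst.
  have rho0 : an n `^ nu @[n --> \oo] --> (0 : R) by exact: powV0.
  have w1c : w1 (an n) th @[n --> \oo] --> (0 : R).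
    by rewrite -[0](mul0r (cos (nu * th))); apply: cvgM => //; exact: cvg_cst.
  have w2c : w2 (an n) th @[n --> \oo] --> (0 : R).
    by rewrite -[0](mul0r (sin (nu * th))); apply: cvgM => //; exact: cvg_cst.
  have r0 : an n `^ 1 @[n --> \oo] --> (0 : R) by exact: powV0.
  have z1c : z1 (an n) th @[n --> \oo] --> (0 : R).
    by rewrite -[0](mul0r (cos (1 * th))); apply: cvgM => //; exact: cvg_cst.
  have z2c : z2 (an n) th @[n --> \oo] --> (0 : R).
    by rewrite -[0](mul0r (sin (1 * th))); apply: cvgM => //; exact: cvg_cst.
  have z1s : z1 (an n) th - s @[n --> \oo] --> 0 - s by apply: cvgB => //; exact: cvg_cst.
  have w1A : w1 (an n) th - A @[n --> \oo] --> 0 - A by apply: cvgB => //; exact: cvg_cst.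
  have w11 : w1 (an n) th + 1 @[n --> \oo] --> (0 + 1 : R) by apply: cvgD => //; exact: cvg_cst.
  have Nzc : (Nz (an n) th)^-1 @[n --> \oo] --> (((0 - s) ^+ 2 + 0 ^+ 2)^-1 : R).
    apply: cvgV; first by rewrite sub0r sqrrN expr0n/= addr0 expf_neq0// lt0r_neq0.
    by apply: cvgD; apply: cvgM.
  have Nwc : (Nw (an n) th)^-1 @[n --> \oo] --> (((0 + 1) ^+ 2 + 0 ^+ 2)^-1 : R).
    apply: cvgV; first by rewrite add0r expr1n expr0n/= addr0 oner_neq0.
    by apply: cvgD; apply: cvgM.
  have U1c : U1 (an n) th @[n --> \oo] --> A / s.
    rewrite [X in _ --> X](_ : _ = (0 - A) * ((0 - s) * ((0 - s) ^+ 2 + 0 ^+ 2)^-1)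
       - 0 * (- 0 * ((0 - s) ^+ 2 + 0 ^+ 2)^-1)); last first.
      by field; rewrite !lt0r_neq0// ?expr0n/= ?sub0r ?sqrrN ?addr0 exprn_gt0.
    by apply: cvgB; apply: cvgM => //; apply: cvgM => //; apply: cvgN.
  have V1c : V1 (an n) th @[n --> \oo] --> (0 : R).
    rewrite [X in _ --> X](_ : _ = (0 - A) * (- 0 * ((0 - s) ^+ 2 + 0 ^+ 2)^-1)
       + 0 * ((0 - s) * ((0 - s) ^+ 2 + 0 ^+ 2)^-1)); last by rewrite oppr0 !(mul0r, mulr0) addr0.
    by apply: cvgD; apply: cvgM => //; apply: cvgM => //; apply: cvgN.
  rewrite [X in _ --> X](_ : _ = A / s * ((0 + 1) * ((0 + 1) ^+ 2 + 0 ^+ 2)^-1)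
     - 0 * (- 0 * ((0 + 1) ^+ 2 + 0 ^+ 2)^-1)); last first.
    by rewrite oppr0 !(mul0r, mulr0) subr0 add0r expr1n expr0n/= addr0 invr1 !mulr1.
  by apply: cvgB; apply: cvgM => //; apply: cvgM => //; apply: cvgN.
(* Extension by zero puts all the arcs on the common domain [D], as dominated convergence
   requires. *)
pose f n : R -> R := F n \_ `[dl n, pi].
have f_le n th : D th -> `|f n th| <= K1 + K2.
  move=> Dth; have K0 : 0 <= K1 + K2.
    by rewrite addr_ge0// ?(le_trans _ (Ub_le1 n th Dth)) ?(le_trans _ (Ua_le n th Dth)).
  rewrite /f patchE; case: ifPn => _; last by rewrite normr0.
  by rewrite (le_trans (ler_normB _ _))// lerD ?Ub_le1 ?Ua_le.
have cU r : 0 < r -> r != s -> measurable_fun (`[0, pi]%classic : set (measurableTypeR R)) (U r).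
  move=> r0 rs; apply: subspace_continuous_measurable_fun => //.
  apply: continuous_in_subspaceT => th; rewrite inE/= in_itv/= => hth.
  have [? [? h]] := holoQ; have [_ [+ _ _ _]] := h _ _ r0 (P_pi r0 rs hth).
  exact: joint_cont_r.
have mf n : measurable_fun (D : set (measurableTypeR R)) (fun th => (f n th)%:E).
  apply/measurable_EFinP/measurable_restrict => //.
  apply: (@measurable_funS _ _ _ _ `[0, pi]%classic) => //.
    by move=> th [/Db' h _]; rewrite /= in_itv.
  by apply: measurable_funB; exact: cU.
have DJ n : D `&` `[dl n, pi] = `[dl n, pi]%classic.
  apply/seteqP; split=> [th []//|th h]; split => //.
  have [d0 _ _ _] := hdl n; move: h; rewrite /D/= !in_itv/= => /andP[h ->].
  by rewrite (lt_le_trans d0 h).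
have JE n : J n = \int[mu]_(th in D) f n th.
  by rewrite /f -Rintegral_mkcondr DJ.
have h2 : {ae mu, forall th, D th -> (f n th)%:E @[n --> \oo] --> ((- (A / s))%:E : \bar R)}.
  apply: aeW => th Dth; apply: cvg_EFin; first exact: nearW.
  apply: cvg_trans (F_cvg th Dth); apply: near_eq_cvg.
  have /andP[th0 thpi] := Db _ Dth.
  move/cvgrPdist_lt : dl_cvg => /(_ _ th0); apply: filterS => n.
  rewrite sub0r normrN gtr0_norm; last by have [] := hdl n.
  by move=> dth /=; rewrite /f patchE ifT// inE/= in_itv/= thpi ltW.
have h3 : {ae mu, forall th (n : nat), D th -> (`|(f n th)%:E| <= (K1 + K2)%:E)%E}.
  by apply: aeW => th n Dth; rewrite abse_EFin lee_fin f_le.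
have h4 : mu.-integrable D (EFin \o (fun=> K1 + K2)).
  apply: (@integrableS _ (measurableTypeR R) R mu (`[0, pi]%classic : set R)) => //.
  apply: continuous_compact_integrable; first exact: segment_compact.
  by apply: continuous_subspaceT; exact: cst_continuous.
have [_ _] := @dominated_convergence _ _ R mu _ mD _ (cst (- (A / s))%:E) _ mf (measurable_cst _) h2 h4 h3.
rewrite integral_cst//= lebesgue_measure_itv/= lte_fin pi0 sube0 -EFinM.
move=> /fine_cvgP[_]; rewrite mulNr [A / s * _]mulrC.
by under [X in _ -> X]eq_cvg do rewrite JE.
Qed.

(** At z = -r, with w = z^nu, the function is - (1 - (1 + A) / (w + 1)) / (r + s), so its imaginary
    part comes from that of 1 / (w + 1) alone. *)
Let V_pi r : 0 < r -> V r pi / r = - (pi * (1 + A)) * (kern nu r / (r + s)).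
Proof.
move=> r0; rewrite /kern lt_eqF// /V /V1 /U1.
have N0 : Nw r pi != 0 by apply/lt0r_neq0/Nw_gt0; rewrite lexx ltW.
have NE : r `^ (2 * nu) + 2 * r `^ nu * cos (nu * pi) + 1 = Nw r pi.
  rewrite /Nw /w1 /w2 mulrC powRrM powR_mulrn ?powR_ge0//.
  by rewrite [(_ * sin _) ^+ 2]exprMn sin2cos2; ring.
have rE : r `^ (nu - 1) = r `^ nu / r.
  by rewrite powRB ?(gt_eqF r0) ?implybT// powRr1// ltW.
have zE : z1 r pi = - r by rewrite /z1 powRr1 ?ltW// mul1r cospi mulrN1.
have zE2 : z2 r pi = 0 by rewrite /z2 mul1r sinpi mulr0.
have NzE' : Nz r pi = (r + s) ^+ 2 by rewrite /Nz zE zE2; ring.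
have rs0 : r + s != 0 by rewrite lt0r_neq0// addr_gt0.
rewrite NE rE NzE' zE zE2 -/m /w2 -/m.
have p0 := lt0r_neq0 pi0; set p := pi in N0 p0 *; clearbody p.
by field; rewrite N0 rs0 p0 lt0r_neq0.
Qed.

(** Dividing the limit - pi A / s by - pi (1 + A) gives A / (s (1 + A)). Positivity of the integrand
    lets the integrals over growing segments pass to the half-line. *)
Lemma stieltjes_kern_lt1 :
  (\int[mu]_(r in `]0%R, +oo[) (kern nu r / (r + s))%:E = (s `^ (nu - 1) / (s `^ nu + 1))%:E)%E.
Proof.
pose g (r : R) := kern nu r / (r + s).
have kern_ge0' r : 0 <= kern nu r.
  rewrite /kern lt_eqF// mulr_ge0 ?divr_ge0 ?(ltW m_gt0) ?(ltW pi0) ?powR_ge0//.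
  have -> : r `^ (2 * nu) + 2 * r `^ nu * cos (nu * pi) + 1 = Nw r pi.
    rewrite /Nw /w1 /w2 mulrC powRrM powR_mulrn ?powR_ge0//.
    by rewrite [(_ * sin _) ^+ 2]exprMn sin2cos2; ring.
  by rewrite addr_ge0 ?sqr_ge0.
have g0 r : 0 < r -> 0 <= g r by move=> r0; rewrite divr_ge0// addr_ge0 ?(ltW r0) ?(ltW s_gt0).
pose c := - (pi * (1 + A)).
have c0 : c != 0 by rewrite oppr_eq0 lt0r_neq0// mulr_gt0// addr_gt0.
have an0 n : 0 < an n by rewrite invr_gt0 addr_gt0 ?divr_gt0.
have pos n r : `[an n, bn n]%classic r -> 0 < r.
  by rewrite /= in_itv/= => /andP[+ _]; exact: lt_le_trans.
have gV n r : `[an n, bn n]%classic r -> g r = c^-1 * (V r pi / r).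
  by move=> /pos r0; rewrite V_pi// mulKf.
have pipi : 0 < (pi : R) <= pi by rewrite lexx pi0.
have ig n : mu.-integrable `[an n, bn n] (EFin \o g).
  apply: (@eq_integrable _ _ R mu _ _ (fun r => (c^-1)%:E * (V r pi / r)%:E)%E) => //.
    by move=> r /set_mem/gV /= ->; rewrite EFinM.
  by apply: integrableZl => //; exact: mV.
have gI n : (\int[mu]_(r in `[an n, bn n]) (g r)%:E = (c^-1 * I (an n) (bn n) pi)%:E)%E.
  rewrite EFinM /I /Rintegral fineK; last by apply: integrable_fin_num => //; exact: mV.
  rewrite -integralZl//; last exact: mV.
  by apply: eq_integral => r /set_mem/gV ->; rewrite EFinM.
have nd : nondecreasing_seq (fun n => `[an n, bn n]%classic : set R).
  move=> i j ij; apply/subsetPset => r; rewrite /= !in_itv/= => /andP[h1 h2].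
  apply/andP; split.
    apply: le_trans h1; rewrite lef_pV2 ?posrE ?addr_gt0 ?divr_gt0//.
    by rewrite lerD2r ler_nat.
  by apply: le_trans h2 _; rewrite lerD2r ler_nat.
have UI : \bigcup_n `[an n, bn n]%classic = `]0, +oo[%classic :> set R.
  apply/seteqP; split=> [r [n _ /pos]|r]; first by rewrite /= in_itv/= andbT.
  rewrite /= in_itv/= andbT => r0.
  pose n := Num.truncn (r + r^-1).
  have hn : r + r^-1 < n.+1%:R by rewrite truncnS_gt.
  exists n => //; rewrite /= in_itv/=; apply/andP; split.
    rewrite -[leRHS]invrK lef_pV2 ?posrE ?addr_gt0 ?divr_gt0 ?invr_gt0//.
    have : 0 < 2 / s by rewrite divr_gt0.
    by lra.
  have : 0 < r^-1 by rewrite invr_gt0.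
  by rewrite /bn; have := s_gt0; lra.
have h1 : (\int[mu]_(r in `[an n, bn n]) (g r)%:E)%E @[n --> \oo] -->
    (\int[mu]_(r in \bigcup_n `[an n, bn n]%classic) (g r)%:E)%E.
  apply: ge0_nondecreasing_set_cvg_integral => //.
    by move=> n; exact: measurable_int (ig n).
  by move=> n r /pos; exact: g0.
rewrite UI in h1.
have h2 : (\int[mu]_(r in `[an n, bn n]) (g r)%:E)%E @[n --> \oo] --> (c^-1 * - (pi * (A / s)))%:E.
  under eq_cvg do rewrite gI.
  apply: cvg_EFin; first exact: nearW.
  by apply: cvgM; [exact: cvg_cst|exact: contour_cvg].
rewrite (cvg_unique _ h1 h2)//; congr EFin.
rewrite powRB ?(gt_eqF s_gt0) ?implybT// powRr1 ?(ltW s_gt0)// -/A /c.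
have p0 := lt0r_neq0 pi0; set p := pi in p0 *; clearbody p.
by field; rewrite p0 !lt0r_neq0// addr_gt0.
Qed.

End StieltjesContour.

(** * The kernels as measures *)

Section KernelProb.
Context {R : realType}.
Implicit Types nu r : R.

(** The denominator is |r^nu e^(i nu pi) + 1|^2, hence nonnegative. *)
Lemma kern_denE nu r : r `^ (2 * nu) + 2 * r `^ nu * cos (nu * pi) + 1 =
  (r `^ nu + cos (nu * pi)) ^+ 2 + sin (nu * pi) ^+ 2.
Proof. by rewrite mulrC powRrM powR_mulrn ?powR_ge0// sin2cos2; ring. Qed.

Lemma kern_den_ge0 nu r : 0 <= r `^ (2 * nu) + 2 * r `^ nu * cos (nu * pi) + 1.
Proof. by rewrite kern_denE addr_ge0 ?sqr_ge0. Qed.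

Lemma sin_nupi_ge0 nu : in01 nu -> 0 <= sin (nu * pi).
Proof.
move=> /andP[nu0 nu1]; apply: sin_ge0_pi.
by rewrite mulr_ge0 ?pi_ge0 ?(ltW nu0)//= ler_piMl ?pi_ge0.
Qed.

Lemma kern_ge0 nu r : in01 nu -> 0 <= kern nu r.
Proof.
move=> nu01; rewrite /kern; case: ifPn => // _.
by rewrite mulr_ge0 ?divr_ge0 ?powR_ge0 ?pi_ge0 ?kern_den_ge0 ?sin_nupi_ge0.
Qed.

Lemma measurable_kern nu : measurable_fun [set: measurableTypeR R] (kern nu).
Proof.
have mp (p : R) : measurable_fun [set: measurableTypeR R] (fun r => r `^ p).
  exact: measurable_powR.
rewrite /kern; case: (nu == 1); first exact: measurable_cst.
have md : measurable_fun [set: measurableTypeR R]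
    (fun r => r `^ (2 * nu) + 2 * r `^ nu * cos (nu * pi) + 1).
  apply: measurable_funD => //; apply: measurable_funD => //.
  apply: measurable_funM => //; exact: measurable_funM.
apply: measurable_funM => //; apply: measurable_funM => //.
under eq_fun do rewrite -powR_inv1 ?kern_den_ge0//.
exact: (measurableT_comp (measurable_powR _)).
Qed.

Lemma kref1 : kref 1 = \d_(1 : measurableTypeR R) :> {measure set (measurableTypeR R) -> \bar R}.
Proof. by rewrite /kref eqxx. Qed.

Lemma kref_lt1 nu : nu < 1 -> kref nu = lebesgue_measure.
Proof. by move=> nu1; rewrite /kref lt_eqF. Qed.

(** The density is relative to [kref nu], so index 1 gives the point mass at 1 and most later
    arguments avoid a case distinction. The proof [nu01] is an argument of the term so that the
    measure structure, which rests on positivity of the kernel, can be attached to it. *)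
Definition kernel_prob nu (nu01 : in01 nu) (A : set (measurableTypeR R)) : \bar R :=
  (\int[kref nu]_(r in A `&` `]0%R, +oo[) (kern nu r)%:E)%E.

Section measure.
Variables (nu : R) (nu01 : in01 nu).

Let kp0 : kernel_prob nu01 set0 = 0%E.
Proof. by rewrite /kernel_prob set0I integral_set0. Qed.

Let kp_ge0 A : (0 <= kernel_prob nu01 A)%E.
Proof. by apply: integral_ge0 => x _; rewrite lee_fin kern_ge0. Qed.

Let kp_sigma : semi_sigma_additive (kernel_prob nu01).
Proof.
move=> /= F mF tF mUF; rewrite /kernel_prob; apply: cvg_toP.
  apply: ereal_nondecreasing_is_cvgn => m n mn.
  apply: lee_sum_nneg_natr => // k _ _; apply: integral_ge0 => /= x Fkx.
  by rewrite lee_fin kern_ge0.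
rewrite setI_bigcupl ge0_integral_bigcup//=.
- by move=> n; apply: measurableI.
- by apply/measurable_EFinP/measurable_funTS; exact: measurable_kern.
- by move=> x _; rewrite lee_fin kern_ge0.
- exact: trivIset_setIr.
Qed.

HB.instance Definition _ := isMeasure.Build _ _ _ (kernel_prob nu01) kp0 kp_ge0 kp_sigma.

Import HBNNSimple.

Let D : set (measurableTypeR R) := `]0%R, +oo[%classic.

Let kp_indic E : measurable E -> (\int[kernel_prob nu01]_x (\1_E x)%:E =
  \int[kref nu]_(x in D) ((kern nu x)%:E * (\1_E x)%:E))%E.
Proof.
move=> mE; rewrite integral_indic// setIT.
rewrite -[LHS]/(\int[kref nu]_(r in E `&` D) (kern nu r)%:E)%E setIC.
rewrite integral_mkcondr; apply: eq_integral => x _.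
by rewrite patchE indicE; case: ifPn => _; rewrite ?mule1 ?mule0.
Qed.

Let mk : measurable_fun D (fun x => (kern nu x)%:E).
Proof. by apply/measurable_EFinP/measurable_funTS; exact: measurable_kern. Qed.

Let k0 x : (0 <= (kern nu x)%:E)%E.
Proof. by rewrite lee_fin kern_ge0. Qed.

Let kp_nnsfun (h : {nnsfun (measurableTypeR R) >-> R}) :
  (\int[kernel_prob nu01]_x (h x)%:E = \int[kref nu]_(x in D) ((kern nu x)%:E * (h x)%:E))%E.
Proof.
have mD : measurable D by exact: measurable_itv.
under [LHS]eq_integral do rewrite fimfunE -fsumEFin//.
rewrite [LHS]ge0_integral_fsum//; last 2 first.
  - by move=> r; exact/measurable_EFinP/measurableT_comp.
  - by move=> n x _; rewrite EFinM nnfun_muleindic_ge0.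
under [RHS]eq_integral.
  move=> x xD; rewrite fimfunE -fsumEFin// ge0_mule_fsumr; last first.
    by move=> r; rewrite EFinM nnfun_muleindic_ge0.
  over.
rewrite [RHS]ge0_integral_fsum//; last 2 first.
  - move=> r; apply: emeasurable_funM => //.
    by apply/measurable_EFinP/measurable_funTS/measurableT_comp.
  - by move=> n x _; rewrite mule_ge0// EFinM nnfun_muleindic_ge0.
apply: eq_fsbigr => r _; rewrite integralZl_indic_nnsfun// kp_indic//.
have [r0|r0] := leP 0 r; last first.
  rewrite preimage_nnfun0// indic0.
  transitivity (0 : \bar R)%E.
    by rewrite integral0_eq ?mule0// => x _; rewrite /= mule0.
  by apply/esym; apply: integral0_eq => x _; rewrite /= mulr0 mule0.
rewrite -ge0_integralZl//.
- by apply: eq_integral => x _; rewrite EFinM muleCA.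
- apply: emeasurable_funM => //.
  by apply/measurable_EFinP/measurable_funTS.
- by move=> x _; rewrite mule_ge0// lee_fin.
Qed.

(** The density formula, extended from indicators to simple functions and then to monotone
    limits. *)
Lemma ge0_integral_kernel_prob (f : R -> \bar R) :
  measurable_fun [set: measurableTypeR R] f -> (forall x, 0 <= f x)%E ->
  (\int[kernel_prob nu01]_x f x = \int[kref nu]_(x in D) ((kern nu x)%:E * f x))%E.
Proof.
move=> mf f0; have mT : measurable [set: measurableTypeR R] by [].
have mD : measurable D by exact: measurable_itv.
pose f_ := nnsfun_approx mT mf.
have f_E x : (f_ n x)%:E @[n --> \oo] --> f x by apply: cvg_nnsfun_approx.
transitivity (limn (fun n => \int[kernel_prob nu01]_x (f_ n x)%:E))%E.
  rewrite -monotone_convergence//=.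
  - by apply: eq_integral => x _; apply/esym/cvg_lim.
  - by move=> n; apply/measurable_EFinP.
  - by move=> n x _; rewrite lee_fin.
  - by move=> x _ a b ab; rewrite lee_fin//; exact/lefP/nd_nnsfun_approx.
rewrite (_ : \int[kref nu]_(x in D) _ =
    limn (fun n => \int[kref nu]_(x in D) ((kern nu x)%:E * (f_ n x)%:E)))%E; last first.
  rewrite -monotone_convergence//=.
  - apply: eq_integral => x _; apply/esym/cvg_lim => //.
    by apply: cvgeZl.
  - move=> n; apply: emeasurable_funM => //.
    by apply/measurable_EFinP/measurable_funTS.
  - by move=> n x _; rewrite mule_ge0// lee_fin.
  - move=> x _ a b ab; apply: lee_wpmul2l => //.
    by rewrite lee_fin//; exact/lefP/nd_nnsfun_approx.
by under eq_fun do rewrite kp_nnsfun.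
Qed.

End measure.

End KernelProb.

(** * The substitution x -> c x^p on the half-line *)

Section PowerSubstitution.
Context {R : realType}.
Notation mu := (@lebesgue_measure R).
Implicit Types x y r t : R.

Lemma ge0_cvg_integral_itv0y (a b : nat -> R) (g : R -> R) :
  (forall n, 0 < a n) -> {homo a : i j / (i <= j)%N >-> j <= i} ->
  {homo b : i j / (i <= j)%N >-> i <= j} ->
  (forall x, 0 < x -> exists n, a n <= x <= b n) ->
  (forall x, 0 < x -> 0 <= g x) -> measurable_fun (`]0%R, +oo[%classic : set (measurableTypeR R)) g ->
  (\int[mu]_(x in `[a n, b n]) (g x)%:E)%E @[n --> \oo] -->
  (\int[mu]_(x in `]0%R, +oo[) (g x)%:E)%E.
Proof.
move=> a0 na nb ab g0 mg.
have pos n r : `[a n, b n]%classic r -> 0 < r.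
  by rewrite /= in_itv/= => /andP[+ _]; exact: lt_le_trans.
have nd : nondecreasing_seq (fun n => `[a n, b n]%classic : set R).
  move=> i j ij; apply/subsetPset => r; rewrite /= !in_itv/= => /andP[h1 h2].
  by rewrite (le_trans (na _ _ ij))//= (le_trans h2)// nb.
have <- : \bigcup_n `[a n, b n]%classic = `]0, +oo[%classic :> set R.
  apply/seteqP; split=> [r [n _ /pos]|r]; first by rewrite /= in_itv/= andbT.
  by rewrite /= in_itv/= andbT => /ab[n rn]; exists n => //=; rewrite in_itv.
apply: ge0_nondecreasing_set_cvg_integral => //.
  move=> n; apply/measurable_EFinP; apply: measurable_funS mg => //.
  by move=> r /pos; rewrite /= in_itv/= andbT.
by move=> n r /pos ?; rewrite lee_fin g0.
Qed.

Lemma pos_continuous_measurable (g : R -> R) : (forall x, 0 < x -> {for x, continuous g}) ->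
  measurable_fun (`]0%R, +oo[%classic : set (measurableTypeR R)) g.
Proof.
move=> cg; apply: subspace_continuous_measurable_fun => //.
by apply: continuous_in_subspaceT => x; rewrite inE/= in_itv/= andbT; exact: cg.
Qed.

Lemma continuous_powR_gt0 (p x : R) : 0 < x -> {for x, continuous (fun x => x `^ p)}.
Proof.
move=> x0; apply/differentiable_continuous/derivable1_diffP/ex_derive.
exact: is_derive1_powR.
Qed.

(** On the segments [1 / (n + 1), n + 1] the map is increasing with continuous derivative, so the
    substitution rule for segments applies; both sides then converge monotonically to integrals over
    the half-line. *)
Lemma ge0_integral_subst_powR (c p : R) (G : R -> R) : 0 < c -> 0 < p ->
  (forall x, 0 < x -> 0 <= G x) -> (forall x, 0 < x -> {for x, continuous G}) ->
  (\int[mu]_(x in `]0%R, +oo[) (G x)%:E =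
   \int[mu]_(x in `]0%R, +oo[) (G (c * x `^ p) * (c * (p * x `^ (p - 1))))%:E)%E.
Proof.
move=> c0 p0 G0 cG.
pose F (x : R) := c * x `^ p; pose F' (x : R) := c * (p * x `^ (p - 1)).
pose a (n : nat) : R := n.+1%:R^-1; pose b (n : nat) : R := n.+1%:R.
have a0 n : 0 < a n by rewrite invr_gt0.
have ab n : a n <= b n by rewrite (@le_trans _ _ 1)// ?invf_le1// ler1n.
have F0 x : 0 < x -> 0 < F x by move=> x0; rewrite mulr_gt0 ?powR_gt0.
have Flt x y : 0 < x -> x < y -> F x < F y.
  move=> x0 xy; rewrite ltr_pM2l//; apply: gt0_ltr_powR => //; rewrite nnegrE ltW//.
  exact: lt_trans xy.
have Fle x y : 0 < x -> x <= y -> F x <= F y.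
  by move=> x0; rewrite le_eqVlt => /predU1P[->//|/(Flt _ _ x0)/ltW].
have dF x : 0 < x -> is_derive x 1 F (F' x).
  move=> x0; have := is_derive1_powR p x0 => ?.
  by apply: is_derive_eq; rewrite /F' /GRing.scale/= ?mulr0 ?addr0.
have cF' x : 0 < x -> {for x, continuous F'}.
  move=> x0; apply: cvgM; first exact: cvg_cst.
  by apply: cvgM; [exact: cvg_cst|exact: continuous_powR_gt0].
have F'E x : 0 < x -> derive1 F x = F' x.
  by move=> x0; have := dF _ x0 => ?; rewrite derive1E derive_val.
have nF' x : 0 < x -> \forall y \near x, F' y = derive1 F y.
  move=> x0; near=> y; rewrite F'E//.
  by near: y; exact: lt_nbhsr.
have cF1 x : 0 < x -> {for x, continuous (derive1 F)}.
  move=> x0; suff : derive1 F y @[y --> x] --> derive1 F x by []; rewrite F'E//.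
  by apply: cvg_trans (cF' _ x0); apply: near_eq_cvg; exact: nF'.
have cF x : 0 < x -> {for x, continuous F}.
  by move=> x0; have := dF _ x0 => ?; exact/differentiable_continuous/derivable1_diffP/ex_derive.
have archi (x : R) : 0 < x -> exists n, a n <= x <= b n.
  move=> x0; exists (Num.truncn (x + x^-1)).
  have h := truncnS_gt (x + x^-1); have h1 : 0 < x^-1 by rewrite invr_gt0.
  rewrite /a /b; apply/andP; split; last by apply: ltW; apply: lt_trans h; rewrite ltrDl.
  rewrite -[leRHS]invrK lef_pV2 ?posrE ?invr_gt0//.
  by apply: ltW; apply: lt_trans h; rewrite ltrDr.
have na : {homo a : i j / (i <= j)%N >-> j <= i}.
  by move=> i j ij; rewrite lef_pV2 ?posrE// ler_nat.
have nb : {homo b : i j / (i <= j)%N >-> i <= j} by move=> i j ij; rewrite ler_nat.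
have h1 : (\int[mu]_(x in `[F (a n), F (b n)]) (G x)%:E)%E @[n --> \oo] -->
  (\int[mu]_(x in `]0%R, +oo[) (G x)%:E)%E.
  apply: ge0_cvg_integral_itv0y => //.
  - by move=> n; exact: F0.
  - by move=> i j ij; apply: Fle => //; exact: na.
  - by move=> i j ij; apply: Fle; [exact: ltr0n|exact: nb].
  (* The preimage of x under [F]: the images of the segments exhaust the half-line. *)
  - move=> x x0; pose y := (x / c) `^ (p^-1).
    have y0 : 0 < y by rewrite powR_gt0// divr_gt0.
    have Fy : F y = x.
      rewrite /F /y -powRrM mulVf ?lt0r_neq0// powRr1 ?divr_ge0 ?ltW//.
      by rewrite mulrC divfK// lt0r_neq0.
    have [n /andP[h1 h2]] := archi _ y0.
    by exists n; rewrite -Fy !Fle.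
  - exact: pos_continuous_measurable.
have h2 : (\int[mu]_(x in `[a n, b n]) (G (F x) * F' x)%:E)%E @[n --> \oo] -->
  (\int[mu]_(x in `]0%R, +oo[) (G (F x) * F' x)%:E)%E.
  apply: ge0_cvg_integral_itv0y => //.
  - move=> x x0; apply: mulr_ge0; first exact/G0/F0.
    by rewrite !mulr_ge0 ?powR_ge0 ?ltW.
  - apply: pos_continuous_measurable => x x0; apply: cvgM; last exact: cF'.
    by apply: (continuous_comp (cF _ x0)); exact/cG/F0.
have E n : (\int[mu]_(x in `[F (a n), F (b n)]) (G x)%:E =
    \int[mu]_(x in `[a n, b n]) (G (F x) * F' x)%:E)%E.
  have b0 : 0 < b n by exact: ltr0n.
  have pos x : x \in `[a n, b n] -> 0 < x.
    by rewrite in_itv/= => /andP[+ _]; exact: lt_le_trans.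
  rewrite (integration_by_substitution_increasing (ab n)); first last.
  - apply: continuous_in_subspaceT => x; rewrite inE/= in_itv/= => /andP[h _].
    by apply: cG; apply: lt_le_trans h; exact: F0.
  - split.
    + by move=> x /subset_itv_oo_cc/pos/dF ?; exact: ex_derive.
    + by apply: cvg_at_right_filter; exact: cF.
    + by apply: cvg_at_left_filter; exact: cF.
  - apply/cvg_ex; exists (derive1 F (b n)); apply: cvg_at_left_filter; exact: cF1.
  - apply/cvg_ex; exists (derive1 F (a n)); apply: cvg_at_right_filter; exact: cF1.
  - by move=> x /subset_itv_oo_cc/pos; exact: cF1.
  - by move=> x y /pos x0 _; exact: Flt.
  by apply: eq_integral => x /set_mem/pos x0; rewrite /= !fctE F'E.
have h3 : (\int[mu]_(x in `[F (a n), F (b n)]) (G x)%:E)%E @[n --> \oo] -->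
    (\int[mu]_(x in `]0%R, +oo[) (G (F x) * F' x)%:E)%E by rewrite (eq_cvg _ _ E).
exact: cvg_unique h1 h3.
Unshelve. all: by end_near. Qed.

Lemma ge0_integral_scale (c : R) (G : R -> R) : 0 < c ->
  (forall x, 0 < x -> 0 <= G x) -> (forall x, 0 < x -> {for x, continuous G}) ->
  (\int[mu]_(x in `]0%R, +oo[) (G x)%:E =
   c%:E * \int[mu]_(x in `]0%R, +oo[) (G (c * x))%:E)%E.
Proof.
move=> c0 G0 cG; rewrite (@ge0_integral_subst_powR c 1)//.
rewrite -ge0_integralZl ?lee_fin ?(ltW c0)//; last 2 first.
- apply/measurable_EFinP; apply: pos_continuous_measurable => x x0.
  apply: (@continuous_comp _ _ _ ( *%R c) G); first exact: mulrl_continuous.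
  by apply: cG; rewrite mulr_gt0.
- by move=> x; rewrite /= in_itv/= andbT => x0; rewrite lee_fin G0// mulr_gt0.
apply: eq_integral => x; rewrite inE/= in_itv/= andbT => x0.
by rewrite powRr1 ?(ltW x0)// subrr powRr0 !mulr1 -EFinM mulrC.
Qed.

End PowerSubstitution.

(** * Gamma integrals and lower bounds on Gamma *)

Section MittagLefflerLaplace.
Context {R : realType}.
Notation mu := (@lebesgue_measure R).
Notation D := (`]0%R, +oo[%classic : set (measurableTypeR R)).
Implicit Types a b p q r s t x y z : R.

Lemma continuous_expRM p t : {for t, continuous (fun t => expR (- (p * t)))}.
Proof. by apply/differentiable_continuous/derivable1_diffP/ex_derive. Qed.

Lemma integral_expR_itv0y p : 0 < p ->
  (\int[mu]_(t in D) (expR (- (p * t)))%:E = (p^-1)%:E)%E.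
Proof.
move=> p0; have cE t := @continuous_expRM p t.
transitivity (\int[mu]_(t in `[0%R, +oo[) (expR (- (p * t)))%:E)%E.
  apply: integral_itv_obnd_cbnd; apply/measurable_EFinP.
  by apply: pos_continuous_measurable => x _; exact: cE.
pose F (t : R) := - (p^-1 * expR (- (p * t))).
have dF t : is_derive t 1 F (expR (- (p * t))).
  by apply: is_derive_eq; rewrite /GRing.scale/=; field; exact: lt0r_neq0.
rewrite (@ge0_continuous_FTC2y _ _ F 0 0)//.
- by rewrite /F mulr0 oppr0 expR0 mulr1 EFinN oppeK add0e.
- by apply: continuous_subspaceT => z; exact: cE.
- rewrite -oppr0 -(mulr0 p^-1); apply: cvgN; apply: cvgM; first exact: cvg_cst.
  apply: (@cvg_comp _ _ _ ( *%R p) (fun z => expR (- z)) _ (pinfty_nbhs R)); last exact: cvgr_expR.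
  exact: gt0_cvgMry.
- apply: cvg_at_right_filter; have := dF 0 => ?.
  exact/differentiable_continuous/derivable1_diffP/ex_derive.
- by move=> x _; have := dF x => ?; rewrite derive1E derive_val.
Qed.

(** From s <= c^-1 e^(c s): raising to the power a costs a factor e^(a c s), and c = 1 / (2 (a + 1))
    makes a c at most 1/2. *)
Lemma powR_expR_le a : 0 <= a -> exists2 C, 0 <= C & forall s, 0 <= s -> s `^ a * expR (- s) <= C * expR (- (2^-1 * s)).
Proof.
move=> a0; pose c := (2 * (a + 1))^-1.
have c0 : 0 < c by rewrite invr_gt0 mulr_gt0// ltr_wpDl.
have cV0 : 0 <= c^-1 by rewrite invr_ge0 ltW.
exists (c^-1 `^ a) => [|s s0]; first exact: powR_ge0.
have h : s <= c^-1 * expR (s * c).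
  rewrite mulrC ler_pdivlMr//; apply: le_trans (expR_ge1Dx _).
  by rewrite lerDr.
have h2 : s `^ a <= c^-1 `^ a * expR (2^-1 * s).
  apply: (@le_trans _ _ ((c^-1 * expR (s * c)) `^ a)).
    by apply: ge0_ler_powR => //; rewrite nnegrE// mulr_ge0// expR_ge0.
  rewrite powRM ?expR_ge0// ler_wpM2l ?powR_ge0//.
  rewrite -expRM ler_expR -mulrA (mulrC s) ler_wpM2r//.
  rewrite /c mulrC; rewrite ler_pdivrMr; last by rewrite mulr_gt0// ltr_wpDl.
  by rewrite mulrA mulVf// mul1r lerDl.
rewrite (_ : - (2^-1 * s) = 2^-1 * s + - s); last by field.
by rewrite expRD mulrA ler_wpM2r ?expR_ge0.
Qed.

Lemma powR_expR_cont a p x : 0 < x -> {for x, continuous (fun s => s `^ a * expR (- (p * s)))}.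
Proof. by move=> x0; apply: cvgM; [exact: continuous_powR_gt0|exact: continuous_expRM]. Qed.

Lemma measurable_powR_expR a p : measurable_fun D (fun s => (s `^ a * expR (- (p * s)))%:E).
Proof.
by apply/measurable_EFinP; apply: pos_continuous_measurable => x; exact: powR_expR_cont.
Qed.

Lemma powR_expR_cont1 a x : 0 < x -> {for x, continuous (fun s => s `^ a * expR (- s))}.
Proof.
have h : {for x, continuous (fun s => expR (- s))}.
  exact/differentiable_continuous/derivable1_diffP/ex_derive.
by move=> x0; apply: cvgM; [exact: continuous_powR_gt0|exact: h].
Qed.

Lemma measurable_powR_expR1 a : measurable_fun D (fun s => (s `^ a * expR (- s))%:E).
Proof.
by apply/measurable_EFinP; apply: pos_continuous_measurable => x; exact: powR_expR_cont1.
Qed.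

(** [Gamma] is a real-valued integral, which reads 0 when the extended one is infinite; the
    exponential bound excludes this. *)
Lemma Gamma_EFin a : 0 <= a ->
  (\int[mu]_(s in D) (s `^ a * expR (- s))%:E)%E = (Gamma (a + 1))%:E.
Proof.
move=> a0; rewrite /Gamma addrK /Rintegral fineK//.
have [C C0 hC] := powR_expR_le a0.
rewrite ge0_fin_numE; last first.
  by apply: integral_ge0 => s _; rewrite lee_fin mulr_ge0 ?powR_ge0 ?expR_ge0.
apply: (@le_lt_trans _ _ (\int[mu]_(s in D) (C%:E * (expR (- (2^-1 * s)))%:E))%E).
  apply: ge0_le_integral => //.
  - by move=> s _; rewrite lee_fin mulr_ge0 ?powR_ge0 ?expR_ge0.
  - exact: measurable_powR_expR1.
  - apply/measurable_EFinP; apply: measurable_funM => //.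
    by apply: pos_continuous_measurable => x _; exact: continuous_expRM.
  - by move=> s; rewrite /= in_itv/= andbT => s0; rewrite lee_fin hC// ltW.
rewrite ge0_integralZl ?lee_fin//; last first.
  apply/measurable_EFinP.
  by apply: pos_continuous_measurable => x _; exact: continuous_expRM.
by rewrite integral_expR_itv0y ?invr_gt0// -EFinM ltry.
Qed.

(** Only the interval [M, M + 1] of the integral is kept. As M is arbitrary, Gamma outgrows every
    geometric sequence. *)
Lemma Gamma_ge a M : 0 <= a -> 0 < M -> M `^ a * expR (- (M + 1)) <= Gamma (a + 1).
Proof.
move=> a0 M0; rewrite -lee_fin -Gamma_EFin//.
have sub : `[M, M + 1]%classic `<=` (D : set R).
  by move=> s; rewrite /= !in_itv/= andbT => /andP[+ _]; exact: lt_le_trans.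
apply: (@le_trans _ _ (\int[mu]_(s in `[M, (M + 1)%R]) (s `^ a * expR (- s))%:E)%E); last first.
  apply: ge0_subset_integral => //.
  - exact: measurable_powR_expR1.
  - by move=> s _; rewrite lee_fin mulr_ge0 ?powR_ge0 ?expR_ge0.
apply: (@le_trans _ _ (\int[mu]_(s in `[M, (M + 1)%R]) (cst (M `^ a * expR (- (M + 1)))%:E s))%E).
  rewrite integral_cst//= lebesgue_measure_itv/= lte_fin ltrDl ltr01.
  by rewrite -EFinB addrAC subrr add0r mule1.
apply: ge0_le_integral => //.
- by move=> s _; rewrite lee_fin mulr_ge0 ?powR_ge0 ?expR_ge0.
- apply: measurable_funS sub _ => //.
  exact: measurable_powR_expR1.
- move=> s; rewrite /= in_itv/= => /andP[s1 s2]; rewrite lee_fin.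
  apply: ler_pM; rewrite ?powR_ge0 ?expR_ge0 ?ler_expR ?lerN2//.
  apply: ge0_ler_powR => //; rewrite nnegrE ?(ltW M0)//.
  by rewrite (le_trans _ s1)// ltW.
Qed.

Lemma Gamma_gt0 a : 0 <= a -> 0 < Gamma (a + 1).
Proof.
move=> a0; apply: lt_le_trans (Gamma_ge a0 ltr01).
by rewrite mulr_gt0 ?powR_gt0 ?expR_gt0.
Qed.

Lemma integral_powR_expR a p : 0 <= a -> 0 < p ->
  (\int[mu]_(t in D) (t `^ a * expR (- (p * t)))%:E)%E = (Gamma (a + 1) / p `^ (a + 1))%:E.
Proof.
move=> a0 p0; rewrite EFinM -Gamma_EFin//.
rewrite (@ge0_integral_scale _ p (fun s => s `^ a * expR (- s)))//; last 2 first.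
- by move=> x _; rewrite mulr_ge0 ?powR_ge0 ?expR_ge0.
- by move=> x; exact: powR_expR_cont1.
transitivity ((p `^ (- a))%:E * \int[mu]_(t in D) ((p * t) `^ a * expR (- (p * t)))%:E)%E.
  rewrite -ge0_integralZl ?lee_fin ?powR_ge0//; last 2 first.
  - apply/measurable_EFinP; apply: pos_continuous_measurable => x x0.
    apply: cvgM; last exact: continuous_expRM.
    apply: (@continuous_comp _ _ _ ( *%R p) (fun s => s `^ a)); first exact: mulrl_continuous.
    by apply: continuous_powR_gt0; rewrite mulr_gt0.
  - by move=> s _; rewrite lee_fin mulr_ge0 ?powR_ge0 ?expR_ge0.
  apply: eq_integral => t; rewrite inE/= in_itv/= andbT => t0.
  rewrite powRM ?(ltW t0) ?(ltW p0)// -EFinM !mulrA -powRD ?addNr ?powRr0 ?mul1r//.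
  by rewrite eqxx lt0r_neq0.
rewrite [RHS]muleAC -EFinM powRD ?(gt_eqF p0) ?implybT// powRr1 ?(ltW p0)//.
by rewrite powRN; congr (_%:E * _)%E; field; rewrite !lt0r_neq0// powR_gt0.
Qed.

End MittagLefflerLaplace.

(** * Entire power series; continuity of the Mittag-Leffler function *)

Section EntireSeries.
Context {R : realType}.
Implicit Types (c : nat -> R) (x K C b p t : R).

(** Infinite radius of convergence, in a form stable under termwise differentiation. *)
Definition entire c := forall K, 0 < K -> exists C, forall h, `|c h| * K ^+ h <= C.

(** The bound at K = 2 (|x| + 1) leaves a geometric majorant of ratio 1/2. *)
Lemma entire_cvg c x : entire c -> cvgn (pseries c x).
Proof.
move=> ec; apply: normed_cvg.
have K0 : 0 < 2 * (`|x| + 1) by rewrite mulr_gt0// ltr_wpDl.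
have [C hC] := ec _ K0.
apply: (@series_le_cvg _ _ (geometric C 2^-1)) => [n|n|n|].
- exact: normr_ge0.
- rewrite /geometric /= mulr_ge0 ?exprn_ge0 ?invr_ge0//.
  by apply: le_trans (hC 0%N); rewrite expr0 mulr1.
- rewrite /geometric/= exprVn ler_pdivlMr ?exprn_gt0//.
  rewrite normrM -mulrA; apply: le_trans (hC n).
  rewrite ler_wpM2l// normrX -exprMn.
  apply: lerXn2r; rewrite ?nnegrE ?mulr_ge0 ?addr_ge0//.
  by rewrite mulrC ler_pM2l// lerDl.
- by apply: is_cvg_geometric_series; rewrite gtr0_norm ?invr_gt0// invf_lt1// ltr1n.
Qed.

(** Doubling K absorbs the new factor, since h + 1 <= 2^(h + 1). *)
Lemma entire_diffs c : entire c -> entire (pseries_diffs c).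
Proof.
move=> ec K K0; have K2 : 0 < 2 * K by rewrite mulr_gt0.
have [C hC] := ec _ K2; exists (C / K) => h.
rewrite ler_pdivlMr// -mulrA -exprSr; apply: le_trans (hC h.+1).
rewrite /pseries_diffs normrM exprMn mulrA ler_pM2r ?exprn_gt0// mulrC.
rewrite ler_wpM2l// normr_nat -natrX ler_nat.
exact/ltnW/ltn_expl.
Qed.

(** Continuity comes from differentiability, which rests on convergence of the series and its first
    two derived series at the larger point |x| + 1. *)
Lemma entire_continuous c : entire c -> continuous (fun x => limn (pseries c x)).
Proof.
move=> ec x; have e1 := entire_diffs ec; have e2 := entire_diffs e1.
have /pseries_snd_diffs h : `|x| < `| `|x| + 1 |.
  by rewrite [ltRHS]ger0_norm ?addr_ge0// ltrDl.
have {}h := h _ (entire_cvg ec) (entire_cvg e1) (entire_cvg e2).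
exact/differentiable_continuous/derivable1_diffP/ex_derive.
Qed.

(** With M = K^(1/b) one has M^(b h) = K^h, so [Gamma_ge] reads K^h e^(-(M + 1)) <= Gamma (b h +
    1). *)
Lemma entire_Gamma b : 0 < b -> entire (fun h => (Gamma (b * h%:R + 1))^-1).
Proof.
move=> b0 K K0; pose M := K `^ (b^-1).
have M0 : 0 < M by exact: powR_gt0.
exists (expR (M + 1)) => h.
have bh : 0 <= b * h%:R by rewrite mulr_ge0// ltW.
have G0 := Gamma_gt0 bh.
rewrite gtr0_norm ?invr_gt0// mulrC ler_pdivrMr//.
rewrite -ler_pdivrMl ?expR_gt0// -expRN mulrC.
apply: le_trans (Gamma_ge bh M0); rewrite ler_pM2r ?expR_gt0//.
by rewrite /M -powRrM mulrA mulVf ?lt0r_neq0// mul1r powR_mulrn// ltW.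
Qed.

Lemma ML_pseries b x : ML b x = limn (pseries (fun h => (Gamma (b * h%:R + 1))^-1) x).
Proof. by rewrite /ML /pseries; congr (limn (series _)); apply/funext => h; rewrite mulrC. Qed.

Lemma ML_continuous b : 0 < b -> continuous (ML b).
Proof.
move=> b0; rewrite (_ : ML b = fun x => limn (pseries (fun h => (Gamma (b * h%:R + 1))^-1) x)).
  exact/entire_continuous/entire_Gamma.
by apply/funext => x; exact: ML_pseries.
Qed.

Lemma ML_cvg b x : 0 < b ->
  series (fun h => x ^+ h / Gamma (b * h%:R + 1)) n @[n --> \oo] --> ML b x.
Proof.
move=> b0; have := @entire_cvg _ x (entire_Gamma b0).
rewrite /pseries (_ : (fun i => _) = fun h => x ^+ h / Gamma (b * h%:R + 1))//.
by apply/funext => h; rewrite mulrC.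
Qed.

End EntireSeries.

(** * The Laplace transform of E_b(-t^b) for p > 1 *)

Section MLLaplace.
Context {R : realType}.
Notation mu := (@lebesgue_measure R).
Notation D := (`]0%R, +oo[%classic : set (measurableTypeR R)).
Variables (b p : R).
Hypotheses (b0 : 0 < b) (p1 : 1 < p).
Implicit Types (t x : R) (h n : nat).

(** The h-th term of E_b(t^b) e^(-p t). Its integral is p^-1 z^h with z = p^(-b), and z < 1 is where
    p > 1 enters. *)
Let u h t := t `^ (b * h%:R) * expR (- (p * t)) / Gamma (b * h%:R + 1).
Let p0 : 0 < p. Proof. exact: lt_trans p1. Qed.
Let z := p `^ (- b).
Let bh h : 0 <= b * h%:R. Proof. by rewrite mulr_ge0// ltW. Qed.

Let z01 : 0 < z < 1.
Proof.
rewrite /z powR_gt0//= powRN invf_lt1 ?powR_gt0//.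
have : 1 `^ b < p `^ b by apply: gt0_ltr_powR; rewrite ?nnegrE ?(ltW p0).
by rewrite powR1.
Qed.

Let u_ge0 h t : 0 <= u h t.
Proof. by rewrite !mulr_ge0 ?powR_ge0 ?expR_ge0// invr_ge0 ltW// Gamma_gt0. Qed.

Let mu_ h : measurable_fun D (u h).
Proof.
apply: measurable_funM => //; apply/measurable_EFinP.
exact: measurable_powR_expR.
Qed.

Let int_u h : (\int[mu]_(t in D) (u h t)%:E = (p^-1 * z ^+ h)%:E)%E.
Proof.
have G0 := Gamma_gt0 (bh h).
under eq_integral do rewrite /u mulrC EFinM.
rewrite ge0_integralZl//; last 3 first.
- exact: measurable_powR_expR.
- by move=> t _; rewrite lee_fin mulr_ge0 ?powR_ge0 ?expR_ge0.
- by rewrite lee_fin invr_ge0 ltW.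
rewrite integral_powR_expR// -EFinM mulrA mulVf ?lt0r_neq0// mul1r; congr EFin.
rewrite -powRN opprD powRD ?(gt_eqF p0) ?implybT// mulrC powR_inv1 ?(ltW p0)//.
by rewrite -mulNr powRrM powR_mulrn// powR_ge0.
Qed.

Let iu h : mu.-integrable D (EFin \o u h).
Proof.
apply/integrableP; split; first exact/measurable_EFinP.
under eq_integral do rewrite /= ger0_norm ?u_ge0//.
by rewrite int_u ltry.
Qed.

(** Partial sums for both signs: those with e = 1 increase, and their limit dominates those with e =
    -1. *)
Let T (e : R) n t := \sum_(0 <= h < n) e ^+ h * u h t.

Let int_T e n : (\int[mu]_(t in D) (T e n t)%:E = (series (geometric p^-1 (e * z)) n)%:E)%E.
Proof.
rewrite /T /series/=; under eq_integral do rewrite -sumEFin.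
rewrite integral_sum//; last first.
  move=> h; apply: (@eq_integrable _ _ R mu _ _ (fun t => (e ^+ h)%:E * (u h t)%:E)%E) => //.
  by apply: integrableZl => //; exact: iu.
rewrite -sumEFin; apply: eq_bigr => h _.
under eq_integral do rewrite EFinM.
rewrite integralZl//; last exact: iu.
by rewrite int_u -EFinM exprMn mulrCA.
Qed.

Let T_cvg e t : 0 < t -> T e n t @[n --> \oo] --> ML b (e * t `^ b) * expR (- (p * t)).
Proof.
move=> t0; have h := @ML_cvg R b (e * t `^ b) b0.
apply: cvg_trans (cvgM h (cvg_cst (expR (- (p * t))))).
apply: near_eq_cvg; apply: nearW => n /=.
rewrite /series/T/= mulr_suml; apply: eq_bigr => i _.
by rewrite /u exprMn -(powR_mulrn i (powR_ge0 t b)) -powRrM; ring.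
Qed.

Let mT e n : measurable_fun D (fun t => (T e n t)%:E).
Proof.
apply/measurable_EFinP; apply: measurable_sum => h.
by apply: measurable_funM => //; exact: mu_.
Qed.

Let mlim e : measurable_fun D (fun t => (ML b (e * t `^ b) * expR (- (p * t)))%:E).
Proof.
apply/measurable_EFinP; apply: pos_continuous_measurable => t t0.
apply: cvgM; last exact: continuous_expRM.
apply: (@continuous_comp _ _ _ (fun t => e * t `^ b) (ML b)); last exact: ML_continuous.
by apply: cvgM; [exact: cvg_cst|exact: continuous_powR_gt0].
Qed.

Let nT t : nondecreasing_seq (fun n => T 1 n t).
Proof.
move=> i j ij; rewrite /T (big_cat_nat _ ij)//= lerDl sumr_ge0// => h _.
by rewrite expr1n mul1r u_ge0.
Qed.

(** Monotone convergence bounds the integral by the geometric sum p^-1 / (1 - z); this is the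
    dominating function for the alternating series. *)
Let int_pos : mu.-integrable D (fun t => (ML b (1 * t `^ b) * expR (- (p * t)))%:E).
Proof.
have [z0 z1] := andP z01.
apply/integrableP; split; first exact: mlim.
have le0 t : 0 < t -> 0 <= ML b (1 * t `^ b) * expR (- (p * t)).
  move=> t0; rewrite -(cvg_lim _ (T_cvg (e := 1) t0))//.
  apply: limr_ge; first by apply/cvg_ex; eexists; exact: T_cvg.
  by apply: nearW => n; apply: sumr_ge0 => h _; rewrite expr1n mul1r u_ge0.
under eq_integral.
  by move=> t; rewrite inE/= in_itv/= andbT => t0; rewrite ger0_norm ?le0//; over.
have h1 : (\int[mu]_(t in D) (T 1 n t)%:E)%E @[n --> \oo] -->
    (\int[mu]_(t in D) limn (fun n => (T 1 n t)%:E))%E.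
  apply: cvg_monotone_convergence => [//|n|n t _|t _ i j ij].
  - exact: mT.
  - by rewrite lee_fin; apply: sumr_ge0 => h _; rewrite expr1n mul1r u_ge0.
  - by rewrite lee_fin nT.
have h2 : (\int[mu]_(t in D) (T 1 n t)%:E)%E @[n --> \oo] --> (p^-1 * (1 - z)^-1)%:E.
  under eq_cvg do rewrite int_T mul1r.
  apply: cvg_EFin; first exact: nearW.
  by apply: cvg_geometric_series; rewrite gtr0_norm.
apply: (@le_lt_trans _ _ (p^-1 * (1 - z)^-1)%:E); last exact: ltry.
rewrite -(cvg_unique _ h1 h2)// le_eqVlt; apply/orP; left; apply/eqP.
apply: eq_integral => t; rewrite inE/= in_itv/= andbT => t0; apply/esym/cvg_lim => //.
by apply: cvg_EFin; [exact: nearW|exact: T_cvg].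
Qed.

(** The integrated partial sums form a geometric series of ratio -z, with sum p^-1 / (1 + z) =
    p^(b-1) / (p^b + 1). *)
Lemma ML_laplace : 
  mu.-integrable D (fun t => (ML b (- t `^ b) * expR (- (p * t)))%:E) /\
  (\int[mu]_(t in D) (ML b (- t `^ b) * expR (- (p * t)))%:E =
   (p `^ (b - 1) / (p `^ b + 1))%:E)%E.
Proof.
have [z0 z1] := andP z01.
have E t : ML b (- t `^ b) = ML b (-1 * t `^ b) by rewrite mulN1r.
have f_f : {ae mu, forall t, D t -> (T (-1) n t)%:E @[n --> \oo] -->
    (ML b (- t `^ b) * expR (- (p * t)))%:E}.
  apply: aeW => t; rewrite /= in_itv/= andbT => t0; rewrite E.
  by apply: cvg_EFin; [exact: nearW|exact: T_cvg].
have dom : {ae mu, forall t n, D t -> (`|(T (-1) n t)%:E| <= (ML b (1 * t `^ b) * expR (- (p * t)))%:E)%E}.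
  apply: aeW => t n; rewrite /= in_itv/= andbT => t0; rewrite lee_fin.
  apply: (@le_trans _ _ (T 1 n t)).
    apply: le_trans (ler_norm_sum _ _ _) _; apply: ler_sum => h _.
    by rewrite normrM normrX normrN normr1 !expr1n !mul1r ger0_norm.
  rewrite -(cvg_lim _ (T_cvg (e := 1) t0))//.
  apply: (@nondecreasing_cvgn_le _ (fun n => T 1 n t) (nT t)).
  by apply/cvg_ex; eexists; exact: T_cvg.
have mlim' : measurable_fun D (fun t => (ML b (- t `^ b) * expR (- (p * t)))%:E).
  rewrite (_ : (fun t => _) = fun t => (ML b (-1 * t `^ b) * expR (- (p * t)))%:E); first exact: mlim.
  by apply/funext => t; rewrite E.
have [h1 _ h2] := @dominated_convergence _ _ R mu D (measurable_itv _) _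
  (fun t => (ML b (- t `^ b) * expR (- (p * t)))%:E) _ (mT (-1)) mlim' f_f int_pos dom.
have h3 : (\int[mu]_(t in D) (T (-1) n t)%:E)%E @[n --> \oo] --> (p `^ (b - 1) / (p `^ b + 1))%:E.
  under eq_cvg do rewrite int_T mulN1r.
  apply: cvg_EFin; first exact: nearW.
  rewrite (_ : p `^ (b - 1) / (p `^ b + 1) = p^-1 * (1 - (- z))^-1).
    by apply: cvg_geometric_series; rewrite normrN gtr0_norm.
  rewrite /z powRN powRD ?(gt_eqF p0) ?implybT// powR_inv1 ?(ltW p0)//.
  have := powR_gt0 b p0; set q := p `^ b => q0.
  by field; rewrite !lt0r_neq0// addr_gt0.
by split => //; exact: cvg_unique h2 h3.
Qed.

End MLLaplace.

(** * Uniqueness of Laplace transforms for continuous functions *)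

Section LaplaceUniqueness.
Context {R : realType}.
Notation mu := (@lebesgue_measure R).
Notation D := (`]0%R, +oo[%classic : set (measurableTypeR R)).
Implicit Types (t x c p : R) (k n : nat) (w f g : R -> R).

Lemma integrableM_le1 w g : mu.-integrable D (EFin \o w) -> measurable_fun D g ->
  (forall t, 0 < t -> `|g t| <= 1) -> mu.-integrable D (EFin \o (fun t => w t * g t)).
Proof.
move=> iw mg g1; apply: (@le_integrable _ _ R mu D _ _ (EFin \o w)) => //.
- apply/measurable_EFinP/measurable_funM => //.
  by apply/measurable_EFinP; exact: (measurable_int mu iw).
- move=> t; rewrite /= in_itv/= andbT => t0.
  by rewrite lee_fin normrM ler_piMr// g1.
Qed.

Section one_sided.
Variables (w : R -> R) (c : R).
Hypotheses (c0 : 0 < c) (cw : {for c, continuous w}) (iw : mu.-integrable D (EFin \o w)).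
Hypothesis w0 : forall k, \int[mu]_(t in D) (w t * expR (- (k%:R * t))) = 0.

(* [phi] is a polynomial in e^-t with a strict maximum over t > 0 at t = c: the
   weights phi^n concentrate at c, which detects the sign of w c. *)
Let phi t := 1 - (expR (- t) - expR (- c)) ^+ 2.

Let e01 t : 0 < t -> 0 < expR (- t) < 1.
Proof. by move=> t0; rewrite expR_gt0 expR_lt1 oppr_lt0. Qed.

Let phi01 t : 0 < t -> 0 <= phi t <= 1.
Proof.
move=> t0; rewrite /phi; have /andP[a0 a1] := e01 t0; have /andP[b0 b1] := e01 c0.
apply/andP; split; last by rewrite lerBlDl lerDr sqr_ge0.
move: a0 a1 b0 b1; set x := expR (- t); set y := expR (- c) => a0 a1 b0 b1.
by nra.
Qed.

Let cphi t : {for t, continuous phi}.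
Proof. by apply/differentiable_continuous/derivable1_diffP/ex_derive. Qed.

Let mphi : measurable_fun D phi.
Proof. by apply: pos_continuous_measurable => t _; exact: cphi. Qed.

Let mexp k : measurable_fun D (fun t => expR (- (k%:R * t))).
Proof. by apply: pos_continuous_measurable => t _; exact: continuous_expRM. Qed.

Let iwphi k n : mu.-integrable D (EFin \o (fun t => w t * (expR (- (k%:R * t)) * phi t ^+ n))).
Proof.
apply: integrableM_le1 => //.
  by apply: measurable_funM => //; exact: measurable_funX.
move=> t t0; have /andP[p0 p1] := phi01 t0.
rewrite ger0_norm ?mulr_ge0 ?expR_ge0 ?exprn_ge0//.
rewrite mulr_ile1 ?expR_ge0 ?exprn_ge0 ?exprn_ile1//.
by rewrite -expR0 ler_expR oppr_le0 mulr_ge0// ltW.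
Qed.

(** Each power of phi is a polynomial in e^(-t), so the vanishing moments of w carry over. The
    induction, for all k at once, peels off one factor phi = a + b e^(-t) - e^(-2 t). *)
Let wphi0 n k : \int[mu]_(t in D) (w t * (expR (- (k%:R * t)) * phi t ^+ n)) = 0.
Proof.
elim: n k => [|n IH] k.
  by under eq_Rintegral do rewrite expr0 mulr1; exact: w0.
pose a : R := 1 - expR (- c) ^+ 2; pose b : R := 2 * expR (- c).
pose F j t := w t * (expR (- (j%:R * t)) * phi t ^+ n).
have phiE t : w t * (expR (- (k%:R * t)) * phi t ^+ n.+1) =
    (a * F k t + b * F k.+1 t) - F k.+2 t.
  rewrite /F exprS -(addn1 k.+1) -(addn1 k) !natrD !mulrDl !mul1r !opprD !expRD.
  by rewrite {1}/phi /a /b; ring.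
under eq_Rintegral do rewrite phiE.
have iZ (r : R) j : mu.-integrable D (EFin \o (fun t => r * F j t)).
  apply: (@eq_integrable _ _ R mu _ _ (fun t => r%:E * (F j t)%:E)%E) => //.
  by apply: integrableZl => //; exact: iwphi.
have iD : mu.-integrable D (EFin \o (fun t => a * F k t + b * F k.+1 t)).
  apply: (@eq_integrable _ _ R mu _ _ (fun t => (a * F k t)%:E + (b * F k.+1 t)%:E)%E) => //.
  by apply: integrableD => //; exact: iZ.
rewrite RintegralB//; last exact: iwphi.
rewrite RintegralD// !RintegralZl//; try exact: iwphi.
by rewrite /F !IH !mulr0 subr0 addr0.
Qed.

(** If w c > 0, the integral of w phi^n is at least 2 d' eta q'^n - q^n M with q < q', which is
    positive for large n, whereas every such integral vanishes. *)
Lemma laplace_moments_le0 : w c <= 0.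
Proof.
rewrite leNgt; apply/negP => wc; have c0' := c0.
have /cvgrPdist_lt /(_ _ (divr_gt0 wc (@ltr0Sn R 1))) := cw.
move=> /nbhs_ballP[e /= e0 he].
(* The window of half-width [d] about c stays in t > 0 and keeps w above w c / 2. *)
pose d := Num.min (e / 2) (c / 2).
have d0 : 0 < d by rewrite lt_min !divr_gt0.
have de : d < e by rewrite gt_min; apply/orP; left; lra.
have dc : d < c by rewrite gt_min; apply/orP; right; lra.
have weta t : c - d <= t <= c + d -> w c / 2 <= w t.
  move=> /andP[h1 h2]; have /he : ball c e t.
    by rewrite /ball/= ltr_norml; apply/andP; split; lra.
  by rewrite ltr_norml => /andP[_]; lra.
(* Off the window e^(-t) differs from e^(-c) by at least [ep], by monotonicity, whence phi <= q
   there. *)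
pose ep := Num.min (expR (- (c - d)) - expR (- c)) (expR (- c) - expR (- (c + d))).
have ep0 : 0 < ep by rewrite lt_min !subr_gt0 !ltr_expR; apply/andP; split; lra.
pose q := 1 - ep ^+ 2.
have phiq t : 0 < t -> ~~ (c - d <= t <= c + d) -> phi t <= q.
  move=> t0 ht; rewrite /phi /q lerD2l lerN2.
  rewrite -[leRHS]real_normK ?num_real// ler_pXn2r ?nnegrE ?(ltW ep0)//.
  move: ht; rewrite negb_and -!ltNge => /orP[h|h].
    rewrite (le_trans _ (ler_norm _))// ge_min; apply/orP; left.
    by rewrite lerD2r ler_expR; lra.
  rewrite distrC (le_trans _ (ler_norm _))// ge_min; apply/orP; right.
  by rewrite lerD2l lerN2 ler_expR; lra.
have q1 : q < 1 by rewrite ltrBlDl ltrDr exprn_gt0.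
have q0 : 0 <= q.
  have t0 : 0 < c + d + 1 by rewrite !addr_gt0.
  have /andP[h _] := phi01 t0; apply: le_trans h _; apply: phiq => //.
  by rewrite negb_and -!ltNge; apply/orP; right; lra.
(* A level strictly between q and the maximum phi c = 1; by continuity phi stays above it on a
   smaller window, of half-width d'. *)
pose q' := (1 + q) / 2.
have qq' : q < q' by rewrite /q'; lra.
have q'0 : 0 < q' by rewrite (le_lt_trans q0).
have /cvgrPdist_lt : phi t @[t --> c] --> phi c by exact: cphi.
have h01 : 0 < 1 - q' by rewrite /q'; lra.
move=> /(_ _ h01) /nbhs_ballP[e' /= e'0 he'].
pose d' := Num.min (e' / 2) d.
have d'0 : 0 < d' by rewrite lt_min d0 divr_gt0.
have d'e : d' < e' by rewrite gt_min; apply/orP; left; lra.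
have d'd : d' <= d by rewrite ge_min lexx orbT.
have phiq' t : c - d' <= t <= c + d' -> q' <= phi t.
  move=> /andP[h1 h2]; have /he' : ball c e' t.
    by rewrite /ball/= ltr_norml; apply/andP; split; lra.
  by rewrite {1}/phi subrr expr0n/= subr0 ltr_norml => /andP[_]; lra.
pose I' : set (measurableTypeR R) := `[c - d', c + d']%classic.
have I'D : I' `<=` D.
  by move=> t; rewrite /I'/= !in_itv/= andbT => /andP[h _]; lra.
pose eta := w c / 2; have eta0 : 0 < eta by rewrite divr_gt0.
pose M := \int[mu]_(t in D) `|w t|.
have iabs : mu.-integrable D (EFin \o (fun t => `|w t|)).
  by have := integrable_abse iw.
have iI : mu.-integrable D (EFin \o (\1_I' : R -> R)).
  apply/integrableP; split.
    by apply/measurable_EFinP/measurable_indic; exact: measurable_itv.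
  under eq_integral do rewrite /= ger0_norm//.
  rewrite integral_indic//; last exact: measurable_itv.
  rewrite (@le_lt_trans _ _ (mu I'))//.
    by apply: le_measure; rewrite ?inE//; [apply: measurableI|exact: measurable_itv]; exact: measurable_itv.
  by rewrite /= lebesgue_measure_itv/=; case: ifPn => _; rewrite ?ltry// -EFinB ltry.
have intI : \int[mu]_(t in D) (\1_I' t : R) = d' *+ 2.
  rewrite /Rintegral integral_indic//; last exact: measurable_itv.
  rewrite setIidl// /I' /= lebesgue_measure_itv/= lte_fin ifT; last by lra.
  by rewrite -EFinB/=; ring.
(* Pointwise, w phi^n is at least eta q'^n on the small window, nonnegative on the rest of the large
   one, and at least - q^n |w| outside. *)
have main n : eta * q' ^+ n * (d' *+ 2) <= q ^+ n * M.
  rewrite -subr_ge0 -oppr_le0 opprB.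
  have iA (r : R) : mu.-integrable D (EFin \o (fun t => r * \1_I' t)).
    apply: (@eq_integrable _ _ R mu _ _ (fun t => r%:E * (EFin \o (\1_I' : R -> R)) t)%E) => //.
    exact: integrableZl.
  have iB (r : R) : mu.-integrable D (EFin \o (fun t => r * `|w t|)).
    apply: (@eq_integrable _ _ R mu _ _ (fun t => r%:E * (`|w t|%R)%:E)%E) => //.
    exact: integrableZl.
  rewrite -(wphi0 n 0) -intI /M -!RintegralZl// -RintegralB//.
  apply: le_Rintegral => //.
    apply: (@eq_integrable _ _ R mu _ _ (fun t => (eta * q' ^+ n * \1_I' t)%:E - (q ^+ n * `|w t|%R)%:E)%E) => //.
    by apply: integrableB => //; [exact: iA|exact: iB].
  move=> t; rewrite /= in_itv/= andbT => t0.
  rewrite mul0r oppr0 expR0 mul1r.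
  have /andP[p0 p1] := phi01 t0.
  have qn : 0 <= q ^+ n * `|w t| by rewrite mulr_ge0 ?exprn_ge0.
  have pn0 : 0 <= phi t ^+ n by exact: exprn_ge0.
  rewrite indicE; have [tI|tI] := boolP (t \in I').
    rewrite mulr1; move: tI; rewrite /I' inE/= in_itv/= => htI.
    have wt : eta <= w t by apply: weta; have /andP[? ?] := htI; apply/andP; split; lra.
    rewrite (@le_trans _ _ (eta * q' ^+ n)) ?lerBlDr ?lerDl//.
    apply: ler_pM => //; [exact: ltW|exact/exprn_ge0/ltW|].
    by apply: lerXn2r; rewrite ?nnegrE ?(ltW q'0)// phiq'.
  rewrite mulr0 sub0r.
  have [td|td] := boolP (c - d <= t <= c + d).
    rewrite (@le_trans _ _ 0) ?oppr_le0// mulr_ge0//.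
    by rewrite (le_trans _ (weta _ td))// ltW.
  rewrite -lerN2 opprK -mulNr (@le_trans _ _ (`|w t| * phi t ^+ n))//.
    by rewrite ler_wpM2r// -normrN ler_norm.
  rewrite mulrC ler_wpM2r//; apply: lerXn2r; rewrite ?nnegrE//.
  exact: phiq.
have lim0 : (q / q') ^+ n * M @[n --> \oo] --> (0 : R).
  rewrite -(mul0r M); apply: cvgM; last exact: cvg_cst.
  apply: cvg_expr; rewrite (ger0_norm (divr_ge0 q0 (ltW q'0))).
  by rewrite ltr_pdivrMr// mul1r.
have L0 : 0 < eta * (d' *+ 2) by rewrite mulr_gt0// mulr2n addr_gt0.
move: lim0 => /cvgrPdist_lt /(_ _ L0) [n _ /(_ n (leqnn n))].
rewrite sub0r normrN => hn.
have := le_lt_trans (ler_norm _) hn; rewrite ltNge => /negP; apply.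
rewrite expr_div_n [leRHS]mulrAC ler_pdivlMr ?exprn_gt0//.
by rewrite mulrAC; exact: main.
Qed.

End one_sided.

(** The one-sided statement is applied to f - g and to g - f. The weight e^(-2 t) turns the moments
    of order k >= 0 into transforms at p = k + 2, which lies in the range p > 1. *)
Lemma laplace_unique f g :
  (forall t, 0 < t -> {for t, continuous f}) -> (forall t, 0 < t -> {for t, continuous g}) ->
  (forall p, 1 < p -> mu.-integrable D (fun t => (f t * expR (- (p * t)))%:E)) ->
  (forall p, 1 < p -> mu.-integrable D (fun t => (g t * expR (- (p * t)))%:E)) ->
  (forall p, 1 < p -> (\int[mu]_(t in D) (f t * expR (- (p * t)))%:E =
                       \int[mu]_(t in D) (g t * expR (- (p * t)))%:E)%E) ->
  forall t, 0 < t -> f t = g t.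
Proof.
move=> cf cg if_ ig fg.
have p2 k : 1 < k%:R + 2 :> R by rewrite ltr_wpDl// ltr1n.
have half f1 g1 :
  (forall t, 0 < t -> {for t, continuous f1}) -> (forall t, 0 < t -> {for t, continuous g1}) ->
  (forall p, 1 < p -> mu.-integrable D (fun t => (f1 t * expR (- (p * t)))%:E)) ->
  (forall p, 1 < p -> mu.-integrable D (fun t => (g1 t * expR (- (p * t)))%:E)) ->
  (forall p, 1 < p -> (\int[mu]_(t in D) (f1 t * expR (- (p * t)))%:E =
                       \int[mu]_(t in D) (g1 t * expR (- (p * t)))%:E)%E) ->
  forall t, 0 < t -> f1 t <= g1 t.
  move=> {cf cg if_ ig fg}cf cg if_ ig fg t t0.
  have := @laplace_moments_le0 (fun t => (f1 t - g1 t) * expR (- (2 * t))) t t0.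
  rewrite pmulr_lle0 ?expR_gt0// subr_le0; apply.
  - apply: cvgM; last exact: continuous_expRM.
    by apply: cvgB; [exact: cf|exact: cg].
  - apply: (@eq_integrable _ _ R mu _ _ (fun t => (f1 t * expR (- (2 * t)))%:E - (g1 t * expR (- (2 * t)))%:E)%E) => //.
      by move=> x _; rewrite /= mulrBl EFinB.
    by apply: integrableB => //; [apply: if_|apply: ig]; rewrite ltr1n.
  - move=> k.
    transitivity (\int[mu]_(t in D) (f1 t * expR (- ((k%:R + 2) * t)) - g1 t * expR (- ((k%:R + 2) * t)))).
      apply: eq_Rintegral => x _; rewrite -mulrBl -mulrA -expRD; congr (_ * expR _).
      by ring.
    rewrite RintegralB//; [|exact: if_|exact: ig].
    by rewrite /Rintegral fg// subrr.
move=> t t0; apply/eqP; rewrite eq_le !half//.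
by move=> p p1; rewrite fg.
Qed.

End LaplaceUniqueness.

(** * Stieltjes transform and total mass at every index *)

Section KernelMass.
Context {R : realType}.
Notation D := (`]0%R, +oo[%classic : set (measurableTypeR R)).
Implicit Types (nu s r t : R).

Lemma integral_kernel_prob nu (nu01 : in01 nu) (f : R -> R) :
  measurable_fun [set: measurableTypeR R] f -> (forall r, 0 <= f r) ->
  (\int[kernel_prob nu01]_r (f r)%:E = \int[kref nu]_(r in D) (kern nu r * f r)%:E)%E.
Proof.
move=> mf f0; rewrite (@ge0_integral_kernel_prob _ _ nu01 (EFin \o f)).
- by apply: eq_integral => r _; rewrite EFinM.
- exact/measurable_EFinP.
- by move=> r; rewrite lee_fin.
Qed.

Lemma kref1_integral (f : R -> R) : measurable_fun D f ->
  (\int[kref 1]_(r in D) (kern 1 r * f r)%:E = (f 1)%:E)%E.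
Proof.
move=> mf; rewrite kref1 integral_dirac//; last first.
  apply/measurable_EFinP; apply: measurable_funM => //.
  by apply: measurable_funTS; exact: measurable_kern.
by rewrite diracE mem_set ?mul1e /= ?in_itv/= ?ltr01// /kern eqxx mul1r.
Qed.

Lemma measurable_inv_ge0 (f : R -> R) : (forall r, 0 <= f r) ->
  measurable_fun [set: measurableTypeR R] f -> measurable_fun [set: measurableTypeR R] (fun r => (f r)^-1).
Proof.
move=> f0 mf; under eq_fun do rewrite -powR_inv1//.
exact: (measurableT_comp (measurable_powR _)).
Qed.

Lemma measurable_normr : measurable_fun [set: measurableTypeR R] (fun r => `|r|).
Proof. exact: measurableT_comp. Qed.

(** For nu < 1 this is the contour computation; for nu = 1 the point mass gives 1 / (1 + s), in
    agreement with the same formula. *)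
Lemma stieltjes_kernel nu (nu01 : in01 nu) s : 0 < s ->
  (\int[kernel_prob nu01]_r ((`|r| + s)^-1)%:E = (s `^ (nu - 1) / (s `^ nu + 1))%:E)%E.
Proof.
move=> s0; have m : measurable_fun [set: measurableTypeR R] (fun r => (`|r| + s)^-1).
  apply: measurable_inv_ge0 => [r|]; first by rewrite addr_ge0// ltW.
  by apply: measurable_funD => //; exact: measurable_normr.
rewrite integral_kernel_prob// => [|r]; last by rewrite invr_ge0 addr_ge0// ltW.
have [e1|n1] := eqVneq nu 1.
  rewrite e1 kref1_integral; last exact: measurable_funTS.
  by rewrite subrr powRr0 powRr1 ?(ltW s0)// normr1 mul1r addrC.
have nu1 : nu < 1 by case/andP: nu01 => _; rewrite le_eqVlt (negbTE n1).
rewrite kref_lt1// -(@stieltjes_kern_lt1 _ nu s)//; last by case/andP: nu01 => ->.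
by apply: eq_integral => r; rewrite inE/= in_itv/= andbT => r0; rewrite gtr0_norm.
Qed.

(** As s grows, s / (|r| + s) increases to 1, and its integral s^nu / (s^nu + 1) tends to 1;
    monotone convergence along s = n + 1 gives the mass. *)
Lemma kernel_probT nu (nu01 : in01 nu) : kernel_prob nu01 setT = 1%E.
Proof.
have n0 n : (0 : R) < n.+1%:R by rewrite ltr0n.
have nu0 : 0 < nu by have /andP[] := nu01.
have h1 : (\int[kernel_prob nu01]_r (n.+1%:R / (`|r| + n.+1%:R))%:E)%E @[n --> \oo] -->
   (\int[kernel_prob nu01]_r limn (fun n => (n.+1%:R / (`|r| + n.+1%:R))%:E))%E.
  apply: cvg_monotone_convergence => [//|n|n r _|r _ i j ij].
  - apply/measurable_EFinP; apply: measurable_funM => //; apply: measurable_inv_ge0 => [r|].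
      by rewrite addr_ge0.
    by apply: measurable_funD => //; exact: measurable_normr.
  - by rewrite lee_fin divr_ge0 ?addr_ge0.
  - have ri : 0 < `|r| + i.+1%:R by rewrite ltr_wpDl.
    have rj : 0 < `|r| + j.+1%:R by rewrite ltr_wpDl.
    rewrite lee_fin ler_pdivrMr// mulrAC ler_pdivlMr//.
    rewrite !mulrDr [leRHS]addrC [leLHS]addrC mulrC lerD2l ler_wpM2r// ler_nat.
    by rewrite ltnS.
have lim1 r : (n.+1%:R / (`|r| + n.+1%:R)) @[n --> \oo] --> (1 : R).
  rewrite (_ : (fun n => _) = fun n => (`|r| * n.+1%:R^-1 + 1)^-1); last first.
    apply/funext => n; have ri : 0 < `|r| + n.+1%:R by rewrite ltr_wpDl.
    by field; rewrite !lt0r_neq0//.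
  rewrite -[X in _ --> X]invr1; apply: cvgV; first exact: oner_neq0.
  rewrite -[X in _ --> X]add0r; apply: cvgD; last exact: cvg_cst.
  by rewrite -(mulr0 `|r|); apply: cvgM; [exact: cvg_cst|exact: cvg_harmonic].
have h2 : (\int[kernel_prob nu01]_r (n.+1%:R / (`|r| + n.+1%:R))%:E)%E @[n --> \oo] --> 1%E.
  have E n : (\int[kernel_prob nu01]_r (n.+1%:R / (`|r| + n.+1%:R))%:E)%E = ((n.+1%:R^-1 `^ nu + 1)^-1)%:E.
    under eq_integral do rewrite EFinM.
    rewrite ge0_integralZl//; last first.
      apply/measurable_EFinP; apply: measurable_inv_ge0 => [r|].
        by rewrite addr_ge0.
      by apply: measurable_funD => //; exact: measurable_normr.
    rewrite stieltjes_kernel// -EFinM; congr EFin.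
    rewrite mulrA mulr_powRB1//.
    rewrite -(powR_inv1 (ltW (n0 n))) -powRrM mulN1r powRN.
    have := powR_gt0 nu (n0 n); set q := _ `^ _ => q0.
    by field; rewrite !lt0r_neq0// addr_gt0.
  under eq_cvg do rewrite E.
  apply: cvg_EFin; first exact: nearW.
  rewrite -[X in _ --> X]invr1; apply: cvgV; first exact: oner_neq0.
  rewrite -[X in _ --> X]add0r; apply: cvgD; last exact: cvg_cst.
  have /cvg_at_rightP h := powR_cvg0 nu0; apply: h; split.
    by move=> n; rewrite invr_gt0.
  exact: cvg_harmonic.
have := cvg_unique _ h1 h2 => <-//.
rewrite (eq_integral (cst 1%E)); first by rewrite integral_cst// mul1e.
move=> r _; apply/cvg_lim => //; apply: cvg_EFin; first exact: nearW.
exact: lim1.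
Qed.

HB.instance Definition _ nu (nu01 : in01 nu) :=
  Measure_isProbability.Build _ _ _ (kernel_prob nu01) (kernel_probT nu01).

End KernelMass.

(** * Mittag-Leffler functions as mixtures over the kernel *)

Section KernelMixture.
Context {R : realType}.
Notation mu := (@lebesgue_measure R).
Notation D := (`]0%R, +oo[%classic : set (measurableTypeR R)).
Implicit Types (nu al p r t x y : R).

Section mixture.
Variables (nu b : R) (nu01 : in01 nu) (b0 : 0 < b) (phi : R -> R -> R) (F : R -> R -> R).
Notation kap := (kernel_prob nu01).
Hypothesis phi01 : forall t r, 0 < t -> 0 <= phi t r <= 1.
Hypothesis mphi : measurable_fun [set: measurableTypeR R * measurableTypeR R] (fun z => phi z.1 z.2).
Hypothesis cphi : forall t r, 0 < t -> {for t, continuous (phi^~ r)}.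
Hypothesis phiF : forall p r, 1 < p ->
  (\int[mu]_(t in D) (phi t r * expR (- (p * t)))%:E = (F p r)%:E)%E.
Hypothesis FL : forall p, 1 < p ->
  (\int[kap]_r (F p r)%:E = (p `^ (b - 1) / (p `^ b + 1))%:E)%E.

Let mphi_r t : measurable_fun [set: measurableTypeR R] (phi t).
Proof.
exact: (measurableT_comp mphi (pair1_measurable (t : measurableTypeR R))).
Qed.

Let iphi t : 0 < t -> kap.-integrable setT (EFin \o phi t).
Proof.
move=> t0; apply: (@le_integrable _ _ R kap setT _ _ (EFin \o cst 1)) => //.
- exact/measurable_EFinP.
- move=> r _ /=; have /andP[h0 h1] := phi01 r t0.
  by rewrite lee_fin ger0_norm// ger0_norm.
- by apply: finite_measure_integrable_cst.
Qed.

Let g t := \int[kap]_r phi t r.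

Let gE t : 0 < t -> ((g t)%:E = \int[kap]_r (phi t r)%:E)%E.
Proof. by move=> t0; rewrite /g /Rintegral fineK//; apply: integrable_fin_num => //; exact: iphi. Qed.

Let cg t : 0 < t -> {for t, continuous g}.
Proof.
move=> t0; have mT : measurable [set: measurableTypeR R] by [].
have pos y : `]t / 2, (t * 2)[%classic y -> 0 < y.
  by rewrite /= in_itv/= => /andP[+ _]; apply: lt_trans; rewrite divr_gt0.
apply: (@continuity_under_integral R _ _ kap phi setT mT (t / 2) (t * 2) _ _ (cst 1)).
- by move=> y /pos; exact: iphi.
- by apply: aeW => r _ y; rewrite inE => /pos; exact: cphi.
- exact: finite_measure_integrable_cst.
- move=> y /pos y0; apply: aeW => r _ /=; have /andP[h0 h1] := phi01 r y0.
  by rewrite ger0_norm.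
- by rewrite inE/= in_itv/=; apply/andP; split; lra.
Qed.

Let g_laplace p : 1 < p ->
  (\int[mu]_(t in D) (g t * expR (- (p * t)))%:E = (p `^ (b - 1) / (p `^ b + 1))%:E)%E.
Proof.
(* The indicator of t > 0 makes the integrand nonnegative on the whole plane, where Tonelli
   applies. *)
move=> p1; pose h (x : measurableTypeR R * measurableTypeR R) : \bar R :=
  (\1_D x.1 * (phi x.1 x.2 * expR (- (p * x.1))))%:E.
have h0 (x : R * R) : (0 <= h x)%E.
  rewrite /h indicE lee_fin; have [|_] := boolP (x.1 \in D); last by rewrite mul0r.
  rewrite inE/= in_itv/= andbT => x0; have /andP[h0 h1] := phi01 x.2 x0.
  by rewrite mul1r mulr_ge0 ?expR_ge0.
have me : measurable_fun [set: measurableTypeR R] (fun t => expR (- (p * t))).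
  by apply: continuous_measurable_fun => t; exact: continuous_expRM.
have mh : measurable_fun [set: measurableTypeR R * measurableTypeR R] h.
  apply/measurable_EFinP; apply: measurable_funM.
    have mI : measurable_fun [set: measurableTypeR R] (\1_D : measurableTypeR R -> R).
      by apply: measurable_indic; exact: measurable_itv.
    exact: (measurableT_comp mI measurable_fst).
  apply: measurable_funM => //.
  exact: (measurableT_comp me measurable_fst).
have indicM (f : R -> R) : (\int[mu]_(t in D) (f t)%:E = \int[mu]_t (\1_D t * f t)%:E)%E.
  rewrite integral_mkcond; apply: eq_integral => t _.
  by rewrite patchE indicE; case: ifPn => _; rewrite ?mul1r ?mul0r.
transitivity (\int[mu]_t \int[kap]_r h (t, r))%E.
  rewrite indicM; apply: eq_integral => t _; rewrite /h/= indicE.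
  have [|_] := boolP (t \in D); last first.
    by rewrite mul0r; under eq_integral do rewrite mul0r; rewrite integral0.
  rewrite inE/= in_itv/= andbT => t0; rewrite mul1r.
  under [RHS]eq_integral do rewrite mul1r mulrC EFinM.
  have mE : measurable_fun [set: measurableTypeR R] (EFin \o phi t) by exact/measurable_EFinP.
  rewrite ge0_integralZl//; last first.
    by move=> r _; rewrite lee_fin; have /andP[] := phi01 r t0.
  by rewrite mulrC EFinM gE.
rewrite (@fubini_tonelli _ _ _ _ R mu kap h)// -FL//.
by apply: eq_integral => r _; rewrite -phiF// indicM.
Qed.

(** Both sides are continuous on t > 0, and Tonelli reduces the transform of the average to the
    average of the transforms [F]. The family [phi] will be exponentials at first, then
    Mittag-Leffler functions. *)
Lemma ML_mixture t : 0 < t -> ((ML b (- t `^ b))%:E = \int[kap]_r (phi t r)%:E)%E.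
Proof.
move=> t0; rewrite -gE//; congr EFin; move: t t0.
have g0 t : 0 < t -> 0 <= g t.
  by move=> t0; apply: Rintegral_ge0 => r _; have /andP[] := phi01 r t0.
have cge p t : 0 < t -> {for t, continuous (fun t => g t * expR (- (p * t)))}.
  by move=> t0; apply: cvgM; [exact: cg|exact: continuous_expRM].
apply: laplace_unique => //.
- move=> t t0; apply: continuous_comp; last exact: ML_continuous.
  by apply: cvgN; exact: continuous_powR_gt0.
- by move=> p p1; have [] := ML_laplace b0 p1.
- move=> p p1; apply/integrableP; split.
    by apply/measurable_EFinP; apply: pos_continuous_measurable => t; exact: cge.
  under eq_integral.
    move=> t; rewrite inE/= in_itv/= andbT => t0.
    by rewrite ger0_norm ?mulr_ge0 ?expR_ge0 ?g0//; over.
  by rewrite g_laplace// ltry.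
- by move=> p p1; rewrite g_laplace//; have [] := ML_laplace b0 p1.
Qed.

End mixture.

Lemma ML0 b : 0 < b -> ML b 0 = 1 :> R.
Proof.
move=> b0; have G1 : Gamma (0 + 1) = 1 :> R.
  apply: EFin_inj; rewrite -Gamma_EFin//.
  under eq_integral do rewrite powRr0 mul1r -[- _]mulN1r.
  have := @integral_expR_itv0y R 1 ltr01; rewrite invr1 => <-.
  by apply: eq_integral => t _; rewrite mul1r mulN1r.
(* The shift skips the empty partial sum, after which every partial sum at 0 is 1. *)
have := @ML_cvg R b 0 b0; rewrite -cvg_shiftS => h.
have h1 : (fun=> 1 : R) n @[n --> \oo] --> ML b 0.
  apply: cvg_trans h; apply: near_eq_cvg; apply: nearW => n /=.
  rewrite /series/= big_nat_recl// expr0 mulr0 G1 divr1 big1 ?addr0// => i _.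
  by rewrite expr0n mul0r.
by have := cvg_unique _ h1 (cvg_cst (1 : R)) => ->.
Qed.

(** The Laplace transform of e^(-t r) in t is 1 / (r + p), whose average over the kernel is the
    Stieltjes transform at p. *)
Lemma ML_kernel_gt0 nu (nu01 : in01 nu) t : 0 < t ->
  ((ML nu (- t `^ nu))%:E = \int[kernel_prob nu01]_r (expR (- (t * `|r|)))%:E)%E.
Proof.
have nu0 : 0 < nu by have /andP[] := nu01.
apply: (@ML_mixture nu nu nu01 nu0 (fun t r => expR (- (t * `|r|))) (fun p r => (`|r| + p)^-1)).
- by move=> {}t r t0; rewrite expR_ge0 -expR0 ler_expR oppr_le0 mulr_ge0// ltW.
- apply: (@measurableT_comp _ _ _ _ _ _ expR) => //.
  apply: measurableT_comp => //; apply: measurable_funM => //.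
  exact: (measurableT_comp measurable_normr).
- move=> {}t r t0; apply/differentiable_continuous/derivable1_diffP.
  exact: ex_derive.
- move=> p r p1; have r0 : 0 < `|r| + p by rewrite ltr_wpDl// (lt_trans _ p1).
  rewrite -integral_expR_itv0y//; apply: eq_integral => x _.
  by rewrite -expRD; congr (expR _)%:E; ring.
- by move=> p p1; apply: stieltjes_kernel; exact: lt_trans p1.
Qed.

Lemma ML_kernel al (al01 : in01 al) y : 0 <= y ->
  ((ML al (- y))%:E = \int[kernel_prob al01]_r (expR (- (y `^ al^-1 * `|r|)))%:E)%E.
Proof.
have al0 : 0 < al by have /andP[] := al01.
rewrite le_eqVlt => /predU1P[<-|y0].
  rewrite oppr0 ML0// powR0 ?invr_eq0 ?lt0r_neq0//.
  under eq_integral do rewrite mul0r oppr0 expR0.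
  by rewrite integral_cst// mul1e; apply/esym; exact: kernel_probT.
rewrite -ML_kernel_gt0 ?powR_gt0//; congr (ML al _)%:E.
by rewrite -powRrM mulVf ?lt0r_neq0// powRr1// ltW.
Qed.

Lemma ML_01 al y : in01 al -> 0 <= y -> 0 <= ML al (- y) <= 1.
Proof.
move=> al01 y0; rewrite -!lee_fin (ML_kernel al01 y0).
have m : measurable_fun [set: measurableTypeR R] (fun r => (expR (- (y `^ al^-1 * `|r|)))%:E).
  apply/measurable_EFinP; apply: (@measurableT_comp _ _ _ _ _ _ expR) => //.
  apply: measurableT_comp => //; apply: measurable_funM => //; exact: measurable_normr.
rewrite integral_ge0 => [/=|r _]; last by rewrite lee_fin expR_ge0.
apply: (@le_trans _ _ (\int[kernel_prob al01]_r (cst 1%E r))%E); last first.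
  by rewrite integral_cst// mul1e (_ : _ setT = 1%E)//; exact: kernel_probT.
apply: ge0_le_integral => //.
by move=> r _; rewrite lee_fin -expR0 ler_expR oppr_le0 mulr_ge0 ?powR_ge0.
Qed.

End KernelMixture.

(** * The composition formula and the integral relation *)

Section MittagLefflerComposition.
Context {R : realType}.
Notation mu := (@lebesgue_measure R).
Notation D := (`]0%R, +oo[%classic : set (measurableTypeR R)).
Implicit Types (nu al be p r t x y c lam : R).

Lemma in01_gt0 nu : in01 nu -> 0 < nu. Proof. by case/andP. Qed.

Lemma in01M nu al : in01 nu -> in01 al -> in01 (nu * al).
Proof.
move=> /andP[nu0 nu1] /andP[al0 al1]; apply/andP; split; first exact: mulr_gt0.
by rewrite mulr_ile1// ltW.
Qed.

Lemma in01_1 : in01 (1 : R). Proof. by rewrite /in01 ltr01 lexx. Qed.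

Lemma measurable_ML al (f : R -> R) (A : set (measurableTypeR R)) : 0 < al ->
  measurable_fun A f -> measurable_fun A (fun r => ML al (f r)).
Proof.
move=> al0; apply: measurableT_comp.
by apply: continuous_measurable_fun; exact: ML_continuous.
Qed.

(** The series computation covers x = 1 and p > 1; the mixture of exponentials is nonnegative, so
    Tonelli yields all x >= 0 and p > 0. With X = x^(1/al) the inner integral is 1 / (p + X r), a
    Stieltjes transform at p / X up to the factor 1 / X. *)
Lemma ML_laplace_scaled al x p : in01 al -> 0 <= x -> 0 < p ->
  (\int[mu]_(t in D) (ML al (- (x * t `^ al)) * expR (- (p * t)))%:E =
   (p `^ (al - 1) / (p `^ al + x))%:E)%E.
Proof.
move=> al01 x0 p0; have al0 := in01_gt0 al01.
have me : measurable_fun [set: measurableTypeR R] (fun t => expR (- (p * t))).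
  by apply: continuous_measurable_fun => t; exact: continuous_expRM.
pose X := x `^ al^-1.
have X0 : 0 <= X by exact: powR_ge0.
pose h (z : measurableTypeR R * measurableTypeR R) : \bar R :=
  (\1_D z.1 * (expR (- (X * z.1 * `|z.2|)) * expR (- (p * z.1))))%:E.
have h0 (z : R * R) : (0 <= h z)%E.
  by rewrite /h lee_fin !mulr_ge0 ?expR_ge0.
have mh : measurable_fun [set: measurableTypeR R * measurableTypeR R] h.
  apply/measurable_EFinP; apply: measurable_funM.
    have mI : measurable_fun [set: measurableTypeR R] (\1_D : measurableTypeR R -> R).
      by apply: measurable_indic; exact: measurable_itv.
    exact: (measurableT_comp mI measurable_fst).
  apply: measurable_funM; last exact: (measurableT_comp me measurable_fst).
  apply: (@measurableT_comp _ _ _ _ _ _ expR) => //.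
  apply: measurableT_comp => //; apply: measurable_funM => //.
    by apply: measurable_funM.
  exact: (measurableT_comp measurable_normr).
have indicM (f : R -> R) : (\int[mu]_(t in D) (f t)%:E = \int[mu]_t (\1_D t * f t)%:E)%E.
  rewrite integral_mkcond; apply: eq_integral => t _.
  by rewrite patchE indicE; case: ifPn => _; rewrite ?mul1r ?mul0r.
transitivity (\int[mu]_t \int[kernel_prob al01]_r h (t, r))%E.
  rewrite indicM; apply: eq_integral => t _; rewrite /h/= indicE.
  have [|_] := boolP (t \in D); last first.
    by rewrite mul0r; under eq_integral do rewrite mul0r; rewrite integral0.
  rewrite inE/= in_itv/= andbT => t0; rewrite mul1r.
  under [RHS]eq_integral do rewrite mul1r mulrC EFinM.
  have mE : measurable_fun [set: measurableTypeR R] (fun r => (expR (- (X * t * `|r|)))%:E).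
    apply/measurable_EFinP; apply: (@measurableT_comp _ _ _ _ _ _ expR) => //.
    apply: measurableT_comp => //; apply: measurable_funM => //; exact: measurable_normr.
  rewrite ge0_integralZl//.
  rewrite mulrC EFinM; congr (_ * _)%E.
  apply: (etrans (ML_kernel al01 (mulr_ge0 x0 (powR_ge0 _ _)))).
  apply: eq_integral => r _.
  rewrite powRM ?powR_ge0// -powRrM mulfV ?lt0r_neq0// powRr1 ?(ltW t0)//.
rewrite (@fubini_tonelli _ _ _ _ R mu (kernel_prob al01) h)//.
transitivity (\int[kernel_prob al01]_r ((p + X * `|r|)^-1)%:E)%E.
  apply: eq_integral => r _; rewrite /h/= -indicM.
  rewrite -integral_expR_itv0y; last by rewrite ltr_wpDr// mulr_ge0.
  by apply: eq_integral => t _; rewrite -expRD; congr (expR _)%:E; ring.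
(* At x = 0 the point p / X is lost, but the integrand is the constant 1 / p. *)
have [x00|xn0] := eqVneq x 0.
  rewrite /X x00 powR0 ?invr_eq0 ?lt0r_neq0// addr0.
  under eq_integral do rewrite mul0r addr0.
  rewrite integral_cst// (_ : _ setT = 1%E); last exact: kernel_probT.
  rewrite mule1 powRD ?(gt_eqF p0) ?implybT// powR_inv1 ?(ltW p0)//.
  by congr EFin; rewrite mulrAC mulfV ?mul1r// lt0r_neq0// powR_gt0.
have xp : 0 < x by rewrite lt_neqAle eq_sym xn0.
have Xp : 0 < X by exact: powR_gt0.
have mi s : 0 < s -> measurable_fun [set: measurableTypeR R] (fun r => ((`|r| + s)^-1)%:E).
  move=> s0; apply/measurable_EFinP; apply: measurable_inv_ge0 => [r|]; first by rewrite addr_ge0// ltW.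
  by apply: measurable_funD => //; exact: measurable_normr.
transitivity (X^-1%:E * \int[kernel_prob al01]_r ((`|r| + p / X)^-1)%:E)%E.
  rewrite -ge0_integralZl//; last 3 first.
  - by apply: mi; rewrite divr_gt0.
  - by move=> r _; rewrite lee_fin invr_ge0 addr_ge0// divr_ge0// ltW.
  - by rewrite lee_fin invr_ge0.
  apply: eq_integral => r _; rewrite -EFinM -invfM mulrDr mulrCA mulfV ?mulr1 1?addrC//.
  by rewrite lt0r_neq0.
rewrite stieltjes_kernel ?divr_gt0// -EFinM; congr EFin.
have pX q : (p / X) `^ q = p `^ q / X `^ q.
  by rewrite powRM ?invr_ge0 ?(ltW p0)// -powR_inv1// -powRrM mulN1r powRN.
have XE : X `^ al = x by rewrite /X -powRrM mulVf ?powRr1// lt0r_neq0.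
have XB : X `^ (al - 1) = x / X.
  by rewrite powRB ?(gt_eqF Xp) ?implybT// XE powRr1.
rewrite !pX XE XB; have q0 := powR_gt0 al p0.
by field; rewrite !lt0r_neq0 ?addr_gt0.
Qed.

(** With c = t^al, the average of p^(al-1) / (p^al + r) is p^(al-1) times the Stieltjes transform at
    s = p^al, that is p^(al nu - 1) / (p^(al nu) + 1). *)
Lemma ML_compose nu al (nu01 : in01 nu) c : in01 al -> 0 <= c ->
  ((ML (nu * al) (- c `^ nu))%:E = \int[kernel_prob nu01]_r (ML al (- (`|r| * c)))%:E)%E.
Proof.
move=> al01; have al0 := in01_gt0 al01; have nu0 := in01_gt0 nu01.
rewrite le_eqVlt => /predU1P[<-|c0].
  rewrite powR0 ?lt0r_neq0// oppr0 ML0 ?mulr_gt0//.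
  under eq_integral do rewrite mulr0 oppr0 ML0//.
  by rewrite integral_cst// mul1e; apply/esym; exact: kernel_probT.
pose t := c `^ al^-1; have t0 : 0 < t by exact: powR_gt0.
have cE : c = t `^ al by rewrite /t -powRrM mulVf ?lt0r_neq0// powRr1// ltW.
rewrite cE -powRrM (mulrC al).
apply: (@ML_mixture _ nu (nu * al) nu01 _ (fun t r => ML al (- (`|r| * t `^ al)))
   (fun p r => p `^ (al - 1) / (p `^ al + `|r|))) => //.
- exact: mulr_gt0.
- by move=> {}t' r t0'; apply: ML_01; rewrite ?mulr_ge0 ?powR_ge0.
- apply: (measurableT_comp (f := ML al)); first by apply: continuous_measurable_fun; exact: ML_continuous.
  apply: measurableT_comp => //; apply: measurable_funM.
    exact: (measurableT_comp measurable_normr measurable_snd).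
  exact: (measurableT_comp (measurable_powR _) measurable_fst).
- move=> t' r t0'; apply: (@continuous_comp _ _ _ (fun t => - (`|r| * t `^ al)) (ML al)); last exact: ML_continuous.
  by apply: cvgN; apply: cvgM; [exact: cvg_cst|exact: continuous_powR_gt0].
- by move=> p r p1; apply: ML_laplace_scaled => //; exact: lt_trans p1.
- move=> p p1; have p0 : 0 < p by exact: lt_trans p1.
  have q0 : 0 < p `^ al by exact: powR_gt0.
  under eq_integral do rewrite EFinM [_ `^ al + _]addrC.
  rewrite ge0_integralZl//; last 3 first.
  + apply/measurable_EFinP; apply: measurable_inv_ge0 => [r|]; first by rewrite addr_ge0// ltW.
    by apply: measurable_funD => //; exact: measurable_normr.
  + by move=> r _; rewrite lee_fin invr_ge0 addr_ge0// ltW.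
  + by rewrite lee_fin powR_ge0.
  rewrite stieltjes_kernel// -EFinM; congr EFin.
  rewrite -!powRrM (mulrC nu) mulrA -powRD ?(gt_eqF p0) ?implybT//.
  by rewrite (_ : al - 1 + al * (nu - 1) = al * nu - 1)//; ring.
Qed.

(** The kernel of index 1 being the point mass at 1, the mixture of exponentials has a single
    term. *)
Lemma ML1 y : 0 <= y -> ML 1 (- y) = expR (- y).
Proof.
move=> y0; apply: EFin_inj; rewrite (ML_kernel in01_1 y0) integral_kernel_prob.
- rewrite kref1_integral ?invr1 ?powRr1 ?normr1 ?mulr1//.
  apply: (@measurableT_comp _ _ _ _ _ _ expR) => //.
  by apply: measurableT_comp => //; apply: measurable_funM => //; exact: measurable_funTS measurable_normr.
- apply: (@measurableT_comp _ _ _ _ _ _ expR) => //.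
  by apply: measurableT_comp => //; apply: measurable_funM => //; exact: measurable_normr.
- by move=> r; exact: expR_ge0.
Qed.

Lemma ML_kref nu al c : in01 nu -> in01 al -> 0 <= c ->
  ((ML (nu * al) (- c `^ nu))%:E = \int[kref nu]_(r in D) (kern nu r * ML al (- (r * c)))%:E)%E.
Proof.
move=> nu01 al01 c0; rewrite (ML_compose nu01)// integral_kernel_prob.
- by apply: eq_integral => r; rewrite inE/= in_itv/= andbT => r0; rewrite gtr0_norm.
- apply: measurable_ML; first exact: in01_gt0.
  by apply: measurableT_comp => //; apply: measurable_funM => //; exact: measurable_normr.
- by move=> r; have /andP[] : 0 <= ML al (- (`|r| * c)) <= 1 by apply: ML_01; rewrite ?mulr_ge0.
Qed.

Lemma powR_scale nu lam x : 0 < nu -> 0 <= lam -> 0 <= x ->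
  (lam `^ nu^-1 * x) `^ nu = lam * x `^ nu.
Proof.
by move=> nu0 l0 x0; rewrite powRM ?powR_ge0// -powRrM mulVf ?lt0r_neq0// powRr1.
Qed.

Lemma ML_subordination nu al lam t : in01 nu -> in01 al -> 0 <= lam -> 0 <= t ->
  ((ML (nu * al) (- (lam * t `^ (nu * al))))%:E =
   \int[kref nu]_(r in D) (kern nu r * ML al (- (r * lam `^ nu^-1 * t `^ al)))%:E)%E.
Proof.
move=> nu01 al01 l0 t0; under eq_integral do rewrite -[_ * _ `^ _ * _]mulrA.
apply: etrans (ML_kref nu01 al01 (mulr_ge0 (powR_ge0 _ _) (powR_ge0 _ _))).
rewrite powR_scale ?powR_ge0 ?in01_gt0//.
by rewrite -powRrM (mulrC al).
Qed.

(** Under r -> r^nu, kern2 nu (r^nu) nu r^(nu-1) = pi kern nu r, so the composition formula applies.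
    At index 1 both kernels are point masses and the identity is read off directly. *)
Lemma kern2_ML nu al c : in01 nu -> in01 al -> 0 <= c ->
  (\int[kref nu]_(r in D) (kern2 nu r * ML al (- (r `^ nu^-1 * c)))%:E =
   (pi * ML (nu * al) (- c `^ nu))%:E)%E.
Proof.
move=> nu01 al01 c0; have nu0 := in01_gt0 nu01; have al0 := in01_gt0 al01.
have [e1|n1] := eqVneq nu 1.
  rewrite e1 mul1r powRr1// kref1 integral_dirac//; last first.
    apply/measurable_EFinP; rewrite /kern2 eqxx; apply: measurable_funM => //.
    apply: measurable_ML => //; apply: measurableT_comp => //; apply: measurable_funM => //.
    by apply: measurable_funTS; exact: measurable_powR.
  by rewrite diracE mem_set ?mul1e /= ?in_itv/= ?ltr01// /kern2 eqxx powR1 mul1r.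
have nu1 : nu < 1 by case/andP: (nu01) => _; rewrite le_eqVlt (negbTE n1).
have sn0 : 0 < sin (nu * pi).
  by apply: sin_gt0_pi; rewrite mulr_gt0 ?pi_gt0//= gtr_pMl// pi_gt0.
have den r : r ^+ 2 + 2 * r * cos (nu * pi) + 1 = (r + cos (nu * pi)) ^+ 2 + sin (nu * pi) ^+ 2.
  by rewrite sin2cos2; ring.
have den0 r : 0 < r ^+ 2 + 2 * r * cos (nu * pi) + 1.
  by rewrite den ltr_wpDl ?sqr_ge0 ?exprn_gt0.
rewrite [RHS]EFinM (ML_kref nu01 al01 c0) (kref_lt1 nu1).
rewrite (@ge0_integral_subst_powR _ 1 nu) ?ltr01//; last 2 first.
- move=> x x0; rewrite mulr_ge0//.
    by rewrite /kern2 (negbTE n1) mulr_ge0 ?divr_ge0 ?invr_ge0 ?(ltW (den0 _)) ?ltW.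
  by have /andP[] : 0 <= ML al (- (x `^ nu^-1 * c)) <= 1 by apply: ML_01; rewrite ?mulr_ge0 ?powR_ge0.
- move=> x x0; apply: cvgM.
    rewrite /kern2 (negbTE n1); apply: cvgM; first exact: cvg_cst.
    apply: cvgV; first exact: lt0r_neq0.
    suff : {for x, continuous (fun r => r ^+ 2 + 2 * r * cos (nu * pi) + 1)} by [].
    exact/differentiable_continuous/derivable1_diffP/ex_derive.
  apply: (@continuous_comp _ _ _ (fun r => - (r `^ nu^-1 * c)) (ML al)); last exact: ML_continuous.
  by apply: cvgN; apply: cvgM; [exact: continuous_powR_gt0|exact: cvg_cst].
rewrite -ge0_integralZl//; last 3 first.
- apply/measurable_EFinP; apply: measurable_funM.
    by apply: measurable_funTS; exact: measurable_kern.
  by apply: measurable_ML => //; apply: measurableT_comp => //; exact: measurable_funM.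
- move=> r; rewrite /= in_itv/= andbT => r0; rewrite lee_fin mulr_ge0 ?kern_ge0//.
  by have /andP[] : 0 <= ML al (- (r * c)) <= 1 by apply: ML_01; rewrite ?mulr_ge0 ?(ltW r0).
- by rewrite lee_fin pi_ge0.
apply: eq_integral => r; rewrite inE/= in_itv/= andbT => r0.
rewrite !mul1r -powRrM mulfV ?lt0r_neq0// powRr1 ?(ltW r0)// -EFinM.
rewrite [in LHS]mulrAC [in RHS]mulrA; congr (_ * _)%:E.
rewrite /kern2 /kern (negbTE n1) (mulrC 2 nu) powRrM powR_mulrn ?powR_ge0//.
have := den0 (r `^ nu); have p0 := lt0r_neq0 (@pi_gt0 R).
set p := pi in p0 *; clearbody p => d0.
field; rewrite p0 !lt0r_neq0//.
Qed.

End MittagLefflerComposition.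

(** * Laws of weighted products and iterated integrals *)

Section IteratedKernels.
Context {R : realType}.
Notation mR := (measurableTypeR R).
Notation D := (`]0%R, +oo[%classic : set (measurableTypeR R)).
Implicit Types (c : R).

Definition mul_powR c (z : mR * mR) : mR := z.1 * z.2 `^ c.

Lemma measurable_mul_powR c : measurable_fun [set: mR * mR] (mul_powR c).
Proof.
apply: measurable_funM; first exact: measurable_fst.
exact: (measurableT_comp (measurable_powR c) measurable_snd).
Qed.

HB.instance Definition _ c := isMeasurableFun.Build _ _ _ _ (mul_powR c) (measurable_mul_powR c).

(** The law of V W^c for independent V and W of laws [P] and [Q]. *)
Definition mul_powR_law (P Q : probability mR R) c : probability mR R :=
  distribution (P \x Q)%E (mul_powR c).

Lemma mul_powR_lawE (P Q : probability mR R) c (A : set mR) :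
  mul_powR_law P Q c A = (P \x Q)%E (mul_powR c @^-1` A).
Proof. by []. Qed.

Lemma measurable_fun_mul_powR c (Q : probability mR R) (f : mR -> \bar R) :
  measurable_fun setT f -> (forall x, 0 <= f x)%E ->
  measurable_fun [set: mR] (fun v => \int[Q]_w f (v * w `^ c)%R)%E.
Proof.
move=> mf f0; have mfc := measurableT_comp mf (measurable_mul_powR c).
exact: (@measurable_fun_fubini_tonelli_F _ _ mR mR R Q (f \o mul_powR c) mfc (fun z => f0 _)).
Qed.

Lemma integral_mul_powR_law (P Q : probability mR R) c (f : mR -> \bar R) :
  measurable_fun setT f -> (forall x, 0 <= f x)%E ->
  (\int[mul_powR_law P Q c]_x f x = \int[P]_v \int[Q]_w f (v * w `^ c)%R)%E.
Proof.
move=> mf f0; rewrite (ge0_integral_pushforward (@measurable_mul_powR c))//.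
have mfc := measurableT_comp mf (measurable_mul_powR c).
by rewrite preimage_setT (@fubini_tonelli1 _ _ mR mR R P Q (f \o mul_powR c) mfc (fun z => f0 _)).
Qed.

(** The order with the earlier variables innermost, which the Mittag-Leffler recursion needs;
    [iter_int] puts the newest variable innermost. *)
Lemma integral_mul_powR_lawC (P Q : probability mR R) c (f : mR -> \bar R) :
  measurable_fun setT f -> (forall x, 0 <= f x)%E ->
  (\int[mul_powR_law P Q c]_x f x = \int[Q]_w \int[P]_v f (v * w `^ c)%R)%E.
Proof.
move=> mf f0; rewrite integral_mul_powR_law//.
have mfc := measurableT_comp mf (measurable_mul_powR c).
exact: (@fubini_tonelli _ _ mR mR R P Q (f \o mul_powR c) mfc (fun z => f0 _)).
Qed.

Lemma eq_iter_int (kr : nat -> {measure set mR -> \bar R}) m (F G : (nat -> R) -> \bar R) :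
  (forall r : nat -> R, (forall j, (1 <= j <= m)%N -> 0 < r j) -> F r = G r) ->
  iter_int kr m F = iter_int kr m G.
Proof.
elim: m F G => [|m IH] F G FG /=; first by apply: FG => j /andP[]; case: j.
apply: IH => r r0; apply: eq_integral => x; rewrite inE/= in_itv/= andbT => x0.
apply: FG => j /andP[j1 jm] /=.
by case: eqP => // jm'; apply: r0; rewrite j1 -ltnS ltn_neqAle jm andbT; exact/eqP.
Qed.

Variables (nu c : nat -> R).

(** The exponents stay abstract here; they will be c_j = 1 / eta_(j-1). *)
Definition wprod m (r : nat -> R) : R := r 1%N * \prod_(2 <= j < m.+1) r j `^ c j.

Lemma wprodS m r : (0 < m)%N -> wprod m.+1 r = wprod m r * r m.+1 `^ c m.+1.
Proof. by move=> m0; rewrite /wprod big_nat_recr//= mulrA. Qed.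

Lemma wprod1 r : wprod 1 r = r 1%N.
Proof. by rewrite /wprod big_geq// mulr1. Qed.

Lemma eq_wprod m r r' : (0 < m)%N -> (forall j, (1 <= j <= m)%N -> r j = r' j) ->
  wprod m r = wprod m r'.
Proof.
move=> m0 e; rewrite /wprod e//; congr (_ * _); apply: eq_big_nat => j /andP[j2 jm].
by rewrite e// (leq_trans _ j2).
Qed.

Definition kprod m (r : nat -> R) : R := \prod_(1 <= j < m.+1) kern (nu j) (r j).

Lemma kprodS m r : kprod m.+1 r = kprod m r * kern (nu m.+1) (r m.+1).
Proof. by rewrite /kprod big_nat_recr. Qed.

Lemma eq_kprod m r r' : (forall j, (1 <= j <= m)%N -> r j = r' j) -> kprod m r = kprod m r'.
Proof. by move=> e; apply: eq_big_nat => j jm; rewrite e. Qed.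

Lemma kprod_ge0 m r : (forall j, (1 <= j <= m)%N -> in01 (nu j)) -> 0 <= kprod m r.
Proof.
move=> n01; rewrite /kprod big_seq_cond; apply: prodr_ge0 => j.
by rewrite andbT mem_index_iota => jm; exact/kern_ge0/n01.
Qed.

(* [Q] is the law of [wprod m] under the product of the first m kernels. *)
Definition iter_rep m (Q : probability mR R) := forall f : mR -> \bar R,
  measurable_fun setT f -> (forall x, 0 <= f x)%E ->
  iter_int (fun j => kref (nu j)) m (fun r => (kprod m r)%:E * f (wprod m r))%E =
  (\int[Q]_x f x)%E.

Lemma iter_rep1 (nu01 : in01 (nu 1%N)) : iter_rep 1 (kernel_prob nu01).
Proof.
move=> f mf f0; rewrite (ge0_integral_kernel_prob nu01)//=.
apply: eq_integral => r _.
by rewrite /kprod big_nat1 wprod1.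
Qed.

(** The innermost integral is the one against the new kernel; the earlier kernels, constant in it,
    move inside. Setting coordinate m + 1 leaves the first m factors unchanged. *)
Lemma iter_repS m Q (nu01 : in01 (nu m.+1)) : (0 < m)%N ->
  (forall j, (1 <= j <= m)%N -> in01 (nu j)) ->
  iter_rep m Q -> iter_rep m.+1 (mul_powR_law Q (kernel_prob nu01) (c m.+1)).
Proof.
move=> m0 n01 hQ f mf f0; rewrite integral_mul_powR_law// -hQ; first last.
- by move=> v; apply: integral_ge0 => w _; exact: f0.
- exact: measurable_fun_mul_powR.
rewrite /=; apply: eq_iter_int => r r0.
have mfv : measurable_fun [set: mR] (fun w => f (wprod m r * w `^ c m.+1)).
  apply: (measurableT_comp mf); apply: measurable_funM => //; exact: measurable_powR.
rewrite (ge0_integral_kernel_prob nu01) => [|//|w]; last exact: f0.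
have mk : measurable_fun D (fun w => ((kern (nu m.+1) w)%:E * f (wprod m r * w `^ c m.+1)%R)%E).
  apply: emeasurable_funM; last exact: measurable_funTS.
  by apply/measurable_EFinP/measurable_funTS; exact: measurable_kern.
rewrite -ge0_integralZl//; last 2 first.
- by move=> w _; rewrite mule_ge0// lee_fin kern_ge0.
- by rewrite lee_fin kprod_ge0.
apply: eq_integral => w _.
rewrite kprodS wprodS//= eqxx (@eq_kprod m _ r); last first.
  by move=> j /andP[_ jm] /=; rewrite ltn_eqF.
rewrite (@eq_wprod m _ r)// ?EFinM ?muleA// => j /andP[_ jm] /=.
by rewrite ltn_eqF.
Qed.

End IteratedKernels.

(** * One law for the integrals, the Mittag-Leffler functions and the random variables *)

Section KernelProducts.
Context {R : realType}.
Notation mR := (measurableTypeR R).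
Variables (nu c : nat -> R).

Lemma measurable_wprod d (T : measurableType d) (W : nat -> T -> R) m : (0 < m)%N ->
  (forall j, measurable_fun [set: T] (W j : T -> mR)) ->
  measurable_fun [set: T] (fun w => wprod c m (fun j => W j w) : mR).
Proof.
move=> + mW; case: m => // m _; elim: m => [|m IH].
  by under eq_fun do rewrite wprod1; exact: mW.
under eq_fun do rewrite wprodS//.
apply: measurable_funM => //.
exact: (measurableT_comp (measurable_powR _) (mW m.+2)).
Qed.

(* The law of [wprod c m W] is [Q], and it is independent of the later W_i. *)
Definition law_rep n m (Q : probability mR R) := forall (d : measure_display)
    (T : measurableType d) (P : probability T R) (W : nat -> {RV P >-> R}),
  independent_RVs [set j : nat | (1 <= j < n)%N] W ->
  (forall j : nat, (1 <= j < n)%N -> has_kernel_law (W j) (nu j)) ->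
  forall (B : set R) (A : nat -> set R) (J : seq nat), measurable B -> uniq J ->
  (forall i, i \in J -> (m < i < n)%N /\ measurable (A i)) ->
  P ((fun w => wprod c m (fun j => W j w)) @^-1` B `&` \bigcap_(i in [set` J]) (W i @^-1` A i)) =
  (Q B * \prod_(i <- J) P (W i @^-1` A i))%E.

Lemma bigcap_preimage_cons T (W : nat -> T -> R) (A : nat -> set R) k (B : set R) (J : seq nat) :
  k \notin J ->
  \bigcap_(i in [set` k :: J]) (W i @^-1` (if i == k then B else A i)) =
  W k @^-1` B `&` \bigcap_(i in [set` J]) (W i @^-1` A i).
Proof.
move=> kJ; apply/seteqP; split=> w.
  move=> h; split; first by have := h k (mem_head _ _); rewrite eqxx.
  move=> i /= iJ; have := h i; rewrite /= inE iJ orbT => /(_ isT).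
  by case: eqP => // ik; rewrite -ik iJ in kJ.
move=> [h1 h2] i /=; rewrite inE => /predU1P[->|iJ]; first by rewrite eqxx.
by case: eqP => [->//|_]; exact: h2.
Qed.

Lemma prod_preimage_cons d (T : measurableType d) (P : probability T R) (W : nat -> T -> R)
    (A : nat -> set R) k (B : set R) (J : seq nat) : k \notin J ->
  (\prod_(i <- k :: J) P (W i @^-1` (if i == k then B else A i)) =
   P (W k @^-1` B) * \prod_(i <- J) P (W i @^-1` A i))%E.
Proof.
move=> kJ; rewrite big_cons eqxx; congr (_ * _)%E.
rewrite big_seq [RHS]big_seq; apply: eq_bigr => i iJ.
by case: eqP => // ik; rewrite -ik iJ in kJ.
Qed.

(** The event on W_1 joins the finite family under index 1, and independence is applied to the
    enlarged family. *)
Lemma law_rep1 n (nu01 : in01 (nu 1%N)) : (1 < n)%N -> law_rep n 1 (kernel_prob nu01).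
Proof.
move=> n1 d T P W indW lawW B A J mB uJ hJ.
have J1 : 1%N \notin J by apply/negP => /hJ[].
have -> : (fun w => wprod c 1 (fun j => W j w)) = W 1%N.
  by apply/funext => w; rewrite wprod1.
rewrite -(bigcap_preimage_cons W A B J1) indW ?prod_preimage_cons//=.
- congr (_ * _)%E; exact: lawW.
- by rewrite J1.
- move=> i; rewrite inE => /predU1P[->|iJ]; first by rewrite eqxx.
  have [/andP[i1 ->] mA] := hJ _ iJ; rewrite (ltnW i1); split => //.
  by case: ifP.
Qed.

(** Let P be restricted to the event [E] on the later variables, normalised, and pushed forward by
    (V, W_(m+1)). By the induction hypothesis, with index m + 1 joined to J, it agrees on rectangles
    with the product of Q and the kernel; uniqueness of product measures extends this to the
    preimage of B. Carrying the later variables in [law_rep] is what closes the induction. *)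
Lemma law_repS n m Q (nu01 : in01 (nu m.+1)) : (0 < m)%N -> (m.+1 < n)%N ->
  law_rep n m Q -> law_rep n m.+1 (mul_powR_law Q (kernel_prob nu01) (c m.+1)).
Proof.
move=> m0 mn hQ d T P W indW lawW B A J mB uJ hJ.
have hJm i : i \in J -> (m < i < n)%N /\ measurable (A i).
  by move=> /hJ[/andP[h1 ->] mA]; rewrite (ltnW h1).
have mJ : m.+1 \notin J by apply/negP => /hJ[]; rewrite ltnn.
pose E := \bigcap_(i in [set` J]) (W i @^-1` A i).
have mE : measurable E.
  apply: fin_bigcap_measurable => [|i /= iJ]; first exact: finite_seq.
  by rewrite -[_ @^-1` _]setTI; apply: measurable_funP => //; have [] := hJ _ iJ.
have PE : P E = (\prod_(i <- J) P (W i @^-1` A i))%E.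
  have := hQ d T P W indW lawW setT A J measurableT uJ hJm.
  by rewrite preimage_setT setTI probability_setT mul1e.
pose V w : mR := wprod c m (fun j => W j w).
have mV : measurable_fun [set: T] V.
  by apply: (@measurable_wprod d T (fun j => W j) m m0) => j; exact: (measurable_funPT (W j)).
pose Z w : mR * mR := (V w, W m.+1 w).
have mZ : measurable_fun [set: T] Z.
  exact: (measurable_fun_pair mV (measurable_funPT (W m.+1))).
have mC : measurable (mul_powR (c m.+1) @^-1` B).
  by rewrite -[_ @^-1` _]setTI; exact: measurable_mul_powR.
have -> : (fun w => wprod c m.+1 (fun j => W j w)) @^-1` B =
    Z @^-1` (mul_powR (c m.+1) @^-1` B).
  by apply/seteqP; split => w; rewrite /= wprodS.
rewrite -/E -PE mul_powR_lawE.
have PEfin : P E \is a fin_num by exact: fin_num_measure.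
have mZC : measurable (Z @^-1` (mul_powR (c m.+1) @^-1` B)).
  by rewrite -[_ @^-1` _]setTI; exact: mZ.
(* A null [E] admits no normalisation, but then both sides are 0. *)
have [PE0|PEn0] := eqVneq (P E) 0%E.
  rewrite PE0 mule0; apply/eqP; rewrite eq_le measure_ge0 andbT -PE0.
  by apply: le_measure; rewrite ?inE//; exact: measurableI.
have q0 : 0 < fine (P E).
  by rewrite fine_gt0// lt0e PEn0 measure_ge0/= ltey_eq PEfin.
have qV0 : 0 <= (fine (P E))^-1 by rewrite invr_ge0 ltW.
pose q : {nonneg R} := NngNum qV0.
pose rho : {measure set (mR * mR) -> \bar R} := mscale q (pushforward (mrestr P mE) Z).
have qE x : (q%:num%:E * (x * P E) = x)%E.
  by rewrite muleCA -{1}(fineK PEfin) -EFinM mulVf ?mule1// lt0r_neq0.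
have -> : (Q \x kernel_prob nu01)%E (mul_powR (c m.+1) @^-1` B) =
    rho mZ (mul_powR (c m.+1) @^-1` B).
  apply: product_measure_unique => // A1 B1 mA1 mB1.
  rewrite /rho /= /mscale /= /pushforward /mrestr.
  have -> : Z @^-1` (A1 `*` B1) `&` E =
     V @^-1` A1 `&` \bigcap_(i in [set` m.+1 :: J]) (W i @^-1` (if i == m.+1 then B1 else A i)).
    by rewrite bigcap_preimage_cons// setIA.
  rewrite hQ//=; last 2 first.
  - by rewrite mJ.
  - move=> i; rewrite inE => /predU1P[->|iJ]; first by rewrite eqxx ltnSn mn.
    by have [-> mA] := hJm _ iJ; split => //; case: ifP.
  rewrite prod_preimage_cons// -PE (muleA (Q A1)) qE; congr (_ * _)%E.
  exact: (lawW m.+1 _ B1 mB1).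
rewrite /rho /= /mscale /= /pushforward /mrestr.
by rewrite -muleA qE.
Qed.

Let eta k : R := \prod_(1 <= i < k.+1) nu i.

Let etaS k : eta k.+1 = eta k * nu k.+1.
Proof. by rewrite /eta big_nat_recr. Qed.

Let eta_in01 k : (forall j, (1 <= j <= k)%N -> in01 (nu j)) -> in01 (eta k).
Proof.
elim: k => [_|k IH h]; first by rewrite /eta big_geq//; exact: in01_1.
rewrite etaS; apply: in01M; last by apply: h; rewrite leqnn.
by apply: IH => j /andP[j1 jk]; apply: h; rewrite j1 ltnW.
Qed.

(** The composition formula for m kernels at once; [be] and [C] are free because the induction step
    changes both. *)
Definition ML_rep m (Q : probability mR R) := forall (be C : R), in01 be -> 0 <= C ->
  (\int[Q]_v (ML be (- (`|v| * C)))%:E = (ML (eta m * be) (- C `^ eta m))%:E)%E.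

Lemma ML_rep1 (nu01 : in01 (nu 1%N)) : ML_rep 1 (kernel_prob nu01).
Proof.
have e1 : eta 1 = nu 1%N by rewrite /eta big_nat1.
by move=> be C be01 C0; rewrite e1; apply/esym; exact: ML_compose.
Qed.

Lemma measurable_ML_norm be (C : R) : in01 be ->
  measurable_fun [set: mR] (fun v => (ML be (- (`|v| * C)))%:E).
Proof.
move=> be01; apply/measurable_EFinP; apply: measurable_ML; first exact: in01_gt0.
by apply: measurableT_comp => //; apply: measurable_funM => //; exact: measurable_normr.
Qed.

Lemma ML_norm_ge0 be (C v : R) : in01 be -> 0 <= C -> (0 <= (ML be (- (`|v| * C)))%:E)%E.
Proof.
by move=> be01 C0; rewrite lee_fin; have /andP[] := ML_01 be01 (mulr_ge0 (normr_ge0 v) C0).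
Qed.

(** Averaging over v gives index eta_m be and argument (w^c C)^(eta_m). The choice c = 1 / eta_m
    makes this w C^(eta_m), linear in w, so the formula for the single kernel nu_(m+1) applies: this
    is the origin of the exponents 1 / eta_(j-1). *)
Lemma ML_repS m Q (nu01 : in01 (nu m.+1)) : (forall j, (1 <= j <= m)%N -> in01 (nu j)) ->
  c m.+1 = (eta m)^-1 ->
  ML_rep m Q -> ML_rep m.+1 (mul_powR_law Q (kernel_prob nu01) (c m.+1)).
Proof.
move=> n01 cE hQ be C be01 C0.
have e01 := eta_in01 n01; have e0 := in01_gt0 e01.
have mC := @measurable_ML_norm be C be01.
rewrite integral_mul_powR_lawC//; last by move=> v; exact: ML_norm_ge0.
transitivity (\int[kernel_prob nu01]_w (ML (eta m * be) (- (w `^ c m.+1 * C) `^ eta m))%:E)%E.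
  apply: eq_integral => w _.
  have wC0 : 0 <= w `^ c m.+1 * C by rewrite mulr_ge0 ?powR_ge0.
  apply: etrans (hQ be _ be01 wC0).
  apply: eq_integral => v _.
  by rewrite normrM (ger0_norm (powR_ge0 _ _)) mulrA.
rewrite integral_kernel_prob; first last.
- move=> w; have /andP[] // : 0 <= ML (eta m * be) (- (w `^ c m.+1 * C) `^ eta m) <= 1.
  by apply: ML_01; [exact: in01M|exact: powR_ge0].
- apply: measurable_ML; first by apply: in01_gt0; exact: in01M.
  apply: measurableT_comp => //; apply: (measurableT_comp (measurable_powR _)).
  by apply: measurable_funM => //; exact: measurable_powR.
rewrite etaS -(mulrC (nu m.+1)) -mulrA [nu m.+1 * eta m]mulrC powRrM.
apply: etrans (esym (ML_kref nu01 (in01M e01 be01) (powR_ge0 _ _))).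
apply: eq_integral => w; rewrite inE/= in_itv/= andbT => w0.
by rewrite cE powRM ?powR_ge0// -powRrM mulVf ?powRr1 ?(ltW w0)// lt0r_neq0.
Qed.

(** The three properties must hold for the same [Q], since it is through this law that the iterated
    integral and the expectation are compared. *)
Lemma iterated_law n m : (0 < m)%N -> (m < n)%N ->
  (forall j, (1 <= j < n)%N -> in01 (nu j)) ->
  (forall j, (1 < j < n)%N -> c j = (eta j.-1)^-1) ->
  exists Q : probability mR R, [/\ iter_rep nu c m Q, ML_rep m Q & law_rep n m Q].
Proof.
case: m => // m _ mn n01 hc; elim: m mn => [|m IH] mn.
  have n1 : in01 (nu 1%N) by exact: n01.
  by exists (kernel_prob n1); split; [exact: iter_rep1|exact: ML_rep1|exact: law_rep1].
have [Q [h1 h2 h3]] := IH (ltnW mn).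
have nm : in01 (nu m.+2) by apply: n01; rewrite mn.
have n01' j : (1 <= j <= m.+1)%N -> in01 (nu j).
  by move=> /andP[j1 jm]; apply: n01; rewrite j1 (leq_trans _ mn)// ltnS leqW.
exists (mul_powR_law Q (kernel_prob nm) (c m.+2)); split.
- exact: iter_repS.
- by apply: ML_repS => //; rewrite hc.
- exact: law_repS.
Qed.

End KernelProducts.

(** * The statements of the theorem, formula by formula *)

Section MainParts.
Context {R : realType}.
Notation mR := (measurableTypeR R).
Notation D := (`]0%R, +oo[%classic : set (measurableTypeR R)).
Implicit Types (nu al be lam t : R).

Lemma ML_subordination_exp nu lam t : in01 nu -> 0 <= lam -> 0 <= t ->
  ((ML nu (- (lam * t `^ nu)))%:E =
   \int[kref nu]_(r in D) (kern nu r * expR (- (r * lam `^ nu^-1 * t)))%:E)%E.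
Proof.
move=> nu01 l0 t0; have := ML_subordination nu01 (@in01_1 R) l0 t0.
rewrite mulr1 => ->; apply: eq_integral => r; rewrite inE/= in_itv/= andbT => r0.
by rewrite powRr1// ML1// mulr_ge0// mulr_ge0 ?powR_ge0// ltW.
Qed.

(** Both sides equal pi E_(nu al)(-lam t^(nu al)): [kern2_ML] is used with indices nu and al on the
    left, nu al and 1 on the right. *)
Lemma kern2_relation nu al lam t : in01 nu -> in01 al -> 0 <= lam -> 0 <= t ->
  (\int[kref nu]_(r in D)
     (kern2 nu r * ML al (- (r `^ nu^-1 * lam `^ nu^-1 * t `^ al)))%:E =
   \int[kref (nu * al)]_(r in D) (kern2 (nu * al) r *
      expR (- (r `^ (nu * al)^-1 * lam `^ (nu * al)^-1 * t)))%:E)%E.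
Proof.
move=> nu01 al01 l0 t0; have e01 := in01M nu01 al01.
transitivity ((pi * ML (nu * al) (- (lam * t `^ (nu * al))))%:E).
  rewrite [in RHS](_ : lam * t `^ (nu * al) = (lam `^ nu^-1 * t `^ al) `^ nu); last first.
    by rewrite powR_scale ?powR_ge0 ?in01_gt0// -powRrM (mulrC al).
  apply: etrans (kern2_ML nu01 al01 (mulr_ge0 (powR_ge0 _ _) (powR_ge0 _ _))).
  by apply: eq_integral => r _; rewrite mulrA.
rewrite [in LHS](_ : lam * t `^ (nu * al) = (lam `^ (nu * al)^-1 * t) `^ (nu * al)); last first.
  by rewrite powR_scale ?in01_gt0.
have := kern2_ML e01 (@in01_1 R) (mulr_ge0 (powR_ge0 lam (nu * al)^-1) t0).
rewrite mulr1 => <-; apply: eq_integral => r _.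
by rewrite mulrA ML1// mulr_ge0// mulr_ge0 ?powR_ge0.
Qed.

Lemma integral_EFinZl (mu : {measure set mR -> \bar R}) (g : mR -> R) (k : R) :
  measurable_fun D g -> (forall w, D w -> 0 <= g w) -> 0 <= k ->
  (\int[mu]_(w in D) (k * g w)%:E = k%:E * \int[mu]_(w in D) (g w)%:E)%E.
Proof.
move=> mg g0 k0; under eq_integral do rewrite EFinM.
apply: (@ge0_integralZl _ _ R mu D) => //; first exact/measurable_EFinP.
Qed.

(** For fixed r the inner function is expanded by the two-index formula with r lam^(1/nu) in the
    role of lam; its power 1/al splits into r^(1/al) lam^(1/(nu al)). *)
Lemma ML_subordination2 nu al be lam t : in01 nu -> in01 al -> in01 be -> 0 <= lam -> 0 <= t ->
  (\int[kref nu]_(r in D)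
     (kern nu r * ML (al * be) (- (r * lam `^ nu^-1 * t `^ (al * be))))%:E =
   \int[kref nu]_(r in D) \int[kref al]_(w in D)
     (kern nu r * kern al w *
      ML be (- (w * r `^ al^-1 * lam `^ (nu * al)^-1 * t `^ be)))%:E)%E.
Proof.
move=> nu01 al01 be01 l0 t0.
apply: eq_integral => r; rewrite inE/= in_itv/= andbT => r0.
have x0 : 0 <= r * lam `^ nu^-1 by rewrite mulr_ge0 ?powR_ge0// ltW.
apply: etrans (EFinM _ _) _.
apply: etrans (congr1 (mule (kern nu r)%:E) (ML_subordination al01 be01 x0 t0)) _.
have cE : (r * lam `^ nu^-1) `^ al^-1 = r `^ al^-1 * lam `^ (nu * al)^-1.
  by rewrite powRM ?powR_ge0 ?(ltW r0)// -powRrM invfM.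
pose g w := kern al w * ML be (- (w * (r * lam `^ nu^-1) `^ al^-1 * t `^ be)).
have mg : measurable_fun D g.
  apply: measurable_funM; first by apply: measurable_funTS; exact: measurable_kern.
  apply: measurable_ML; first exact: in01_gt0.
  by apply: measurableT_comp => //; apply: measurable_funM => //; exact: measurable_funM.
have g0 w : D w -> 0 <= g w.
  rewrite /= in_itv/= andbT => w0; rewrite mulr_ge0 ?kern_ge0//.
  have y0 : 0 <= w * (r * lam `^ nu^-1) `^ al^-1 * t `^ be.
    by rewrite mulr_ge0 ?powR_ge0// mulr_ge0 ?powR_ge0// ltW.
  by have /andP[] := ML_01 be01 y0.
apply: etrans (esym (integral_EFinZl _ mg g0 (kern_ge0 r nu01))) _.
by apply: eq_integral => w _; rewrite /g cE !mulrA.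
Qed.

Section iterated.
Variables (m : nat) (nu : nat -> R) (lam t : R).
Hypotheses (m0 : (0 < m)%N) (l0 : 0 <= lam).
Hypothesis nu01 : forall i, (1 <= i <= m.+1)%N -> in01 (nu i).

Let eta k : R := \prod_(1 <= i < k.+1) nu i.
Let c j : R := (eta j.-1)^-1.
Let arg (r : nat -> R) : R :=
  - (r 1%N * \prod_(2 <= j < m.+1) r j `^ c j * lam `^ (eta m)^-1 * t `^ nu m.+1).
Let C := lam `^ (eta m)^-1 * t `^ nu m.+1.
Let f (v : mR) : \bar R := (ML (nu m.+1) (- (`|v| * C)))%:E.

Let C0 : 0 <= C. Proof. by rewrite mulr_ge0 ?powR_ge0. Qed.

Let argE (r : nat -> R) : arg r = - (wprod c m r * C).
Proof. by rewrite /arg /C /wprod !mulrA. Qed.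

Let num01 : in01 (nu m.+1). Proof. by apply: nu01; rewrite leqnn. Qed.

Let nu01' j : (1 <= j < m.+1)%N -> in01 (nu j).
Proof. by move=> /andP[j1 jm]; apply: nu01; rewrite j1 ltnW. Qed.

Let eta_gt0 : 0 < eta m.
Proof.
rewrite /eta big_seq_cond; apply: prodr_gt0 => j.
by rewrite andbT mem_index_iota => jm; exact/in01_gt0/nu01'.
Qed.

Let mf : measurable_fun [set: mR] f.
Proof. exact: measurable_ML_norm. Qed.

Let f0 v : (0 <= f v)%E.
Proof. exact: ML_norm_ge0. Qed.

Let wprod_ge0 (r : nat -> R) : 0 <= r 1%N -> 0 <= wprod c m r.
Proof. by move=> r0; rewrite mulr_ge0// prodr_ge0// => j _; exact: powR_ge0. Qed.

(** Both quantities are the integral of [f] against [Q]; the absolute value in [f] disappears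
    because the iterated integral sees only positive variables. *)
Lemma ML_iterated : exists Q : probability mR R, [/\
  ((ML (eta m.+1) (- (lam * t `^ eta m.+1)))%:E = \int[Q]_v f v)%E,
  iter_int (fun j => kref (nu j)) m
    (fun r : nat -> R => (\prod_(1 <= j < m.+1) kern (nu j) (r j) * ML (nu m.+1) (arg r))%:E) =
  (\int[Q]_v f v)%E & law_rep nu c m.+1 m Q].
Proof.
have [Q [h1 h2 h3]] := iterated_law (c := c) m0 (ltnSn m) nu01' (fun j _ => erefl).
exists Q; split => //.
  apply: etrans _ (esym (h2 _ _ num01 C0)).
  have eS : eta m.+1 = eta m * nu m.+1 by rewrite /eta big_nat_recr.
  have eC : lam * t `^ eta m.+1 = C `^ eta m.
    by rewrite /C powR_scale ?powR_ge0// -powRrM (mulrC (nu m.+1)) -eS.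
  by rewrite eC eS.
apply: etrans _ (h1 f mf f0); apply: eq_iter_int => r r0.
apply: etrans (EFinM _ _) _; congr (_ * _)%E.
rewrite argE /f ger0_norm//; apply: wprod_ge0.
by apply/ltW/r0; rewrite m0.
Qed.

(** [Q] is the law of the random product, by [law_rep] with an empty family of later variables. As
    [arg] carries no absolute value, it agrees with [f] only almost surely: W_1 is nonnegative
    outside a null set, and the other factors are powers, nonnegative everywhere. *)
Lemma ML_iterated_expectation (d : measure_display) (T : measurableType d)
    (P : probability T R) (W : nat -> {RV P >-> R}) (Q : probability mR R) :
  independent_RVs [set j : nat | (1 <= j < m.+1)%N] W ->
  (forall j : nat, (1 <= j < m.+1)%N -> has_kernel_law (W j) (nu j)) ->
  law_rep nu c m.+1 m Q ->
  ('E_P[fun w : T => ML (nu m.+1) (arg (fun j => W j w))] = \int[Q]_v f v)%E.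
Proof.
move=> indW lawW hQ; rewrite unlock.
pose V w : mR := wprod c m (fun j => W j w).
have mV : measurable_fun [set: T] V.
  by apply: (@measurable_wprod _ _ d T (fun j => W j) m m0) => j; exact: (measurable_funPT (W j)).
have W0 : {ae P, forall w, 0 <= W 1%N w}.
  exists (W 1%N @^-1` `]-oo, 0[); split.
  - by rewrite -[_ @^-1` _]setTI; apply: measurable_funP => //; exact: measurable_itv.
  - have := lawW 1%N m0 `]-oo, 0[%classic (measurable_itv _).
    rewrite /distribution /pushforward => ->.
    rewrite (_ : _ `&` _ = set0) ?integral_set0//.
    apply/seteqP; split => // x [] /=; rewrite !in_itv/= andbT => x0 /(lt_trans x0).
    by rewrite ltxx.
  - by move=> w /= /negP; rewrite -ltNge in_itv.
have mML : measurable_fun [set: T] (fun w => (ML (nu m.+1) (arg (fun j => W j w)))%:E).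
  apply/measurable_EFinP.
  have mm : measurable_fun [set: mR] (ML (nu m.+1)).
    by apply: continuous_measurable_fun; apply: ML_continuous; exact: in01_gt0.
  apply: (measurableT_comp mm).
  by under eq_fun do rewrite argE; apply: measurableT_comp => //; exact: measurable_funM.
transitivity (\int[P]_w f (V w))%E.
  apply: ae_eq_integral => //; first exact: (measurableT_comp mf mV).
  apply: filterS W0 => w w0 _.
  by rewrite argE /f ger0_norm// wprod_ge0.
rewrite -(@ge0_integral_pushforward _ _ T mR R V mV P setT f)//.
apply: eq_measure_integral => A mA _.
have := hQ d T P W indW lawW A (fun=> setT) [::] mA isT (fun i h => False_ind _ (notF h)).
rewrite big_nil mule1.
by rewrite (_ : [set` [::]] = set0) ?bigcap_set0 ?setIT//; apply/seteqP; split.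
Qed.

End iterated.
End MainParts.

Unset Implicit Arguments.

Theorem mainTheorem9 (R : realType) (lam t : R) (lam_gt0 : 0 < lam)
    (t_gt0 : 0 < t) :
  (forall nu al : R, in01 nu -> in01 al ->
    (ML (nu * al) (- (lam * t `^ (nu * al))))%:E =
    (\int[kref nu]_(r in `]0%R, +oo[)
       (kern nu r * ML al (- (r * lam `^ (nu^-1) * t `^ al)))%:E)%E) /\
  (forall nu al : R, in01 nu -> in01 al ->
    (ML (al * nu) (- (lam * t `^ (al * nu))))%:E =
    (\int[kref al]_(r in `]0%R, +oo[)
       (kern al r * ML nu (- (r * lam `^ (al^-1) * t `^ nu)))%:E)%E) /\
  (forall nu al : R, in01 nu -> in01 al ->
    (\int[kref nu]_(r in `]0%R, +oo[)
       (kern2 nu r *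
        ML al (- (r `^ (nu^-1) * lam `^ (nu^-1) * t `^ al)))%:E =
     \int[kref (nu * al)]_(r in `]0%R, +oo[)
       (kern2 (nu * al) r *
        expR (- (r `^ ((nu * al)^-1) * lam `^ ((nu * al)^-1) * t)))%:E)%E) /\
  (forall nu : R, in01 nu ->
    (ML nu (- (lam * t `^ nu)))%:E =
    (\int[kref nu]_(r in `]0%R, +oo[)
       (kern nu r * expR (- (r * lam `^ (nu^-1) * t)))%:E)%E) /\
  (forall al : R, in01 al ->
    (ML al (- (lam * t `^ al)))%:E =
    (\int[kref 1]_(r in `]0%R, +oo[)
       (kern 1 r * ML al (- (r * lam `^ (1^-1) * t `^ al)))%:E)%E) /\
  (forall nu al be : R, in01 nu -> in01 al -> in01 be ->
    (ML (nu * al * be) (- (lam * t `^ (nu * al * be))))%:E =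
    (\int[kref nu]_(r in `]0%R, +oo[)
       (kern nu r *
        ML (al * be) (- (r * lam `^ (nu^-1) * t `^ (al * be))))%:E)%E /\
    (\int[kref nu]_(r in `]0%R, +oo[)
       (kern nu r *
        ML (al * be) (- (r * lam `^ (nu^-1) * t `^ (al * be))))%:E)%E =
    (\int[kref nu]_(r in `]0%R, +oo[)
       \int[kref al]_(w in `]0%R, +oo[)
         (kern nu r * kern al w *
          ML be (- (w * r `^ (al^-1) * lam `^ ((nu * al)^-1)
                    * t `^ be)))%:E)%E) /\
  (forall (n : nat) (nu : nat -> R), (2 <= n)%N ->
    (forall i : nat, (1 <= i <= n)%N -> in01 (nu i)) ->
    let eta (k : nat) : R := \prod_(1 <= i < k.+1) nu i in
    let arg (r : nat -> R) : R :=
      - (r 1%N * \prod_(2 <= j < n) r j `^ ((eta j.-1)^-1)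
         * lam `^ ((eta n.-1)^-1) * t `^ nu n) in
    (ML (eta n) (- (lam * t `^ eta n)))%:E =
      iter_int (fun j => kref (nu j)) n.-1
        (fun r => ((\prod_(1 <= j < n) kern (nu j) (r j)) *
                   ML (nu n) (arg r))%:E) /\
    (forall (d : measure_display) (T : measurableType d)
        (P : probability T R) (W : nat -> {RV P >-> R}),
      independent_RVs [set j : nat | (1 <= j < n)%N] W ->
      (forall j : nat, (1 <= j < n)%N -> has_kernel_law (W j) (nu j)) ->
      (ML (eta n) (- (lam * t `^ eta n)))%:E =
      ('E_P[fun w : T => ML (nu n) (arg (fun j => W j w))])%E)).
Proof.
have l0 := ltW lam_gt0; have t0 := ltW t_gt0.
split; first by move=> nu al nu01 al01; exact: ML_subordination.
split; first by move=> nu al nu01 al01; exact: ML_subordination.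
split; first by move=> nu al nu01 al01; exact: kern2_relation.
split; first by move=> nu nu01; exact: ML_subordination_exp.
split.
  by move=> al al01; have := ML_subordination (@in01_1 R) al01 l0 t0; rewrite mul1r.
split.
  move=> nu al be nu01 al01 be01; split; last exact: ML_subordination2.
  by rewrite -mulrA; apply: ML_subordination => //; exact: in01M.
(* With n = m + 2, the number n - 1 of variables reduces to m + 1 > 0. *)
move=> [//|[//|m]] nu _ nu01 eta arg.
have [Q [e1 e2 hQ]] := ML_iterated t (isT : (0 < m.+1)%N) l0 nu01.
split; first by apply: etrans e1 (esym e2).
move=> d T P W indW lawW; apply: etrans e1 (esym _).
exact (ML_iterated_expectation lam t (isT : (0 < m.+1)%N) nu01 indW lawW hQ).
Qed.
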